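(* Let $G$ be smooth and compactly supported in the lifted variables, and let $$U=-\partial_z(-\Delta_5)^{-1}G.$$ Then, with a constant $C$ (independent of $G$), $$\|U\|_{L^{10/3}(d\mu_5)}\le C\|G\|_{L^2(d\mu_5)}.$$ The same estimate holds locally after the usual decomposition into a localized source and a smooth harmonic remainder.
   Context: $\Delta_5=\partial_r^2+\frac3r\partial_r+\partial_z^2$ is the ordinary Laplacian of $\mathbb R^5=\mathbb R^4_y\times\mathbb R_z$ acting on functions radial in $y$, with $r=|y|$, and $d\mu_5=r^3\,dr\,dz$. The ''lifted variables'' are $(y,z)\in\mathbb R^5$: functions $G=G(r,z)$ are identified with functions on $\mathbb R^5$ radial in $y$. $(-\Delta_5)^{-1}$ is the inverse of $-\Delta_5$ on $\mathbb R^5$, given by the Newtonian potential. *)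

(* Defs.v *)
From HB Require Import structures.
From mathcomp Require Import all_boot all_order all_algebra.
From mathcomp Require Import all_classical all_reals all_analysis.
From mathcomp Require Import measurable_realfun.

Set Implicit Arguments.
Unset Strict Implicit.
Unset Printing Implicit Defensive.
Import Order.TTheory GRing.Theory Num.Theory.
Import numFieldNormedType.Exports.
Local Open Scope classical_set_scope.
Local Open Scope ring_scope.

(* [R4 R] and [R5 R] carry the max norm and the product topology of the
   library; the Euclidean norms are [enorm4] and [enorm5]. *)
Notation R4 R := (R * R * R * R)%type.
Notation R5 R := (R4 R * R)%type.

Section lifted_space.
Context {R : realType}.
Implicit Types (f G : R5 R -> R) (A : set (R5 R)).

Definition enorm4 (y : R4 R) : R :=
  let: (y1, y2, y3, y4) := y in
  Num.sqrt (y1 ^+ 2 + y2 ^+ 2 + y3 ^+ 2 + y4 ^+ 2).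

Definition enorm5 (x : R5 R) : R := Num.sqrt (enorm4 x.1 ^+ 2 + x.2 ^+ 2).

Definition radial {T : Type} (f : R5 R -> T) : Prop :=
  forall (y y' : R4 R) (z : R), enorm4 y = enorm4 y' -> f (y, z) = f (y', z).

(* [f] is recovered from its profile as f (y, z) = profile f (enorm4 y, z) when
   it is radial. *)
Definition profile {T : Type} (f : R5 R -> T) (p : R * R) : T :=
  f ((p.1, 0, 0, 0), p.2).

(* C^oo on an open set [A]: every iterated directional derivative is Frechet
   differentiable at each point of [A]. *)
Definition smooth_on A f : Prop :=
  forall (vs : seq (R5 R)) (x : R5 R), A x ->
    differentiable (foldr (fun v g => fun w : R5 R => 'D_v g w) f vs) x.

Definition supported_in A f : Prop := forall x, ~ A x -> f x = 0.

Definition axes : seq (R5 R) :=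
  [:: (1, 0, 0, 0, 0); (0, 1, 0, 0, 0); (0, 0, 1, 0, 0);
      (0, 0, 0, 1, 0); (0, 0, 0, 0, 1)].

Definition dz f (x : R5 R) : R := 'D_((0, 0, 0, 0, 1) : R5 R) f x.

Definition laplacian5 f (x : R5 R) : R :=
  \sum_(e <- axes) 'D_e (fun w : R5 R => 'D_e f w) x.

Definition lebesgue5 : set (R5 (measurableTypeR R)) -> \bar R :=
  (lebesgue_measure \x lebesgue_measure \x lebesgue_measure
   \x lebesgue_measure \x lebesgue_measure)%E.

HB.instance Definition _ := Measure.on lebesgue5.

(* The fundamental solution of -Delta on R^5 is 1 / (3 |S^4| |x|^3),
   where |S^4| = 8 pi^2 / 3. *)
Definition newtonian5 f (x : R5 R) : R :=
  (8 * pi ^+ 2)^-1 * \int[lebesgue5]_w (f w / enorm5 (x - w) ^+ 3).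

(* The measure r^3 dr dz on the half-plane r > 0. *)
Definition mu5 (A : set (measurableTypeR R * measurableTypeR R)) : \bar R :=
  (\int[@lebesgue_measure R \x @lebesgue_measure R]_(p in A)
     (Num.max 0 p.1 ^+ 3)%:E)%E.

Let mu5_0 : mu5 set0 = 0%E.
Proof. by rewrite /mu5 integral_set0. Qed.

Let mu5_ge0 (A : set (measurableTypeR R * measurableTypeR R)) :
  (0 <= mu5 A)%E.
Proof.
by apply: integral_ge0 => p _; rewrite lee_fin exprn_ge0// le_max lexx.
Qed.

Let mu5_sigma_additive : semi_sigma_additive mu5.
Proof.
move=> /= F mF tF mUF; rewrite /mu5; apply: cvg_toP.
  apply: ereal_nondecreasing_is_cvgn => m n mn.
  by apply: lee_sum_nneg_natr => // k _ _; exact: mu5_ge0.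
rewrite ge0_integral_bigcup//=.
- apply: measurable_funTS; apply: measurableT_comp => //.
  by apply: measurable_funX; exact: measurable_maxr.
- by move=> p _; rewrite lee_fin exprn_ge0// le_max lexx.
Qed.

HB.instance Definition _ :=
  isMeasure.Build _ _ _ mu5 mu5_0 mu5_ge0 mu5_sigma_additive.

Definition Lp5 (p : R) f : \bar R := ('N[mu5]_(p%:E)[EFin \o profile f])%E.

End lifted_space.

(* Main.v *)
(* The estimate is the Hardy-Littlewood-Sobolev inequality L^2 -> L^(10/3) on R^5 for
   the kernel |w|^-4, read in polar coordinates in y.  Integrating by parts against the
   regularized kernel (e^2 + |w|^2)^(-3/2) and letting e tend to 0 gives
   |dz (newtonian5 G)| <= C (|w|^-4 * |G|).  The HLS inequality follows Hedberg: the
   dyadic pieces of the potential are controlled by the averages of |G| over cubes for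
   small radii and by the L^2 norm for large ones.  Only the L^2 bound of the maximal
   function is needed, and a TT* argument yields it without covering lemmas.
   Differentiating the regularized kernel once more produces the approximate identity
   15 e^2 (e^2 + |w|^2)^(-7/2), whence - Delta (newtonian5 G) = G.  The potential of a
   radial source is radial because rotations are products of shears, which preserve
   Lebesgue measure, and the push-forward of Lebesgue measure under (y, z) |-> (|y|, z)
   is a multiple of mu5.  Locally, the remainder h differs from Phi by the potential of
   the cut-off source, so Minkowski's inequality reduces the claim to the global one. *)
From HB Require Import structures.
Require Import Defs.
From mathcomp Require Import all_boot all_order all_algebra.
From mathcomp Require Import all_classical all_reals all_analysis.
From mathcomp Require Import measurable_realfun.
From mathcomp Require Import ring lra zify.
Set Implicit Arguments.
Unset Strict Implicit.
Unset Printing Implicit Defensive.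
Import Order.TTheory GRing.Theory Num.Theory.
Import numFieldNormedType.Exports.
Local Open Scope classical_set_scope.
Local Open Scope ring_scope.

(** * Measurability and measure-preserving maps *)

(** The exponents come from Hedberg's balance. A dyadic piece of radius r is at most r M, where M is
    the maximal function of the source, and also at most a multiple of r^(-3/2) times the L^2 norm.
    Balancing the two at the radius where they agree bounds the potential by a multiple of M^(3/5)
    |G|_2^(2/5). Its power 10/3 is M^2 |G|_2^(4/3), which is why the L^2 bound of M suffices. The
    TT* argument rests on a near-semigroup property: composing averages over cubes of two radii is
    dominated by a single average at the scale after the larger one. Derivatives are never taken of
    the singular kernel. The kernel is recentred at the origin, so that derivatives of the potential
    fall on the source, and a uniform Taylor bound for the source replaces differentiation under the
    integral sign. No area of a sphere is computed. The normalisation 8 pi^2 is matched by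
    integrating out the five coordinates one at a time, and the volume of the unit ball of R^4 stays
    an unevaluated number, known only to be positive and finite. *)

Section separable_measurable.
Context {R : realType}.

Lemma inv_succ_lt (e : R) : 0 < e -> exists n : nat, n.+1%:R^-1 < e.
Proof.
move=> e0; exists (Num.bound e^-1); rewrite invf_plt ?posrE//.
apply: (@lt_le_trans _ _ (Num.bound e^-1)%:R); last by rewrite ler_nat.
by apply: archi_boundP; rewrite invr_ge0 ltW.
Qed.

(* [M] carries the sigma-algebra and [T] the topology; [phi] is an identity in all
   instances, the two structures living on convertible types. *)
Definition separable_measurable d (M : measurableType d) (T : pseudoMetricType R)
    (phi : M -> T) :=
  (forall x r, measurable (phi @^-1` ball x r)) /\
  exists D : nat -> T, forall x r, 0 < r -> exists k, ball x r (D k).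

(** An open set is the countable union of the balls of radius 1/(n+1), centred in the dense
    sequence, that it contains. This links the product topology to the product sigma-algebra. *)
Lemma open_preimage_measurable d (M : measurableType d) (T : pseudoMetricType R)
  (phi : M -> T) (U : set T) :
  separable_measurable phi -> open U -> measurable (phi @^-1` U).
Proof.
move=> [mb [D dD]] oU.
have -> : phi @^-1` U = \bigcup_k \bigcup_n
   (if `[< ball (D k) n.+1%:R^-1 `<=` U >] then phi @^-1` ball (D k) n.+1%:R^-1 else set0).
  apply/seteqP; split => [x /= Ux|x [k _ [n _]] /=].
    have /nbhs_ballP[e /= e0 eU] : nbhs (phi x) U by apply: open_nbhs_nbhs.
    have [n ne] := inv_succ_lt (divr_gt0 e0 (@ltr0Sn R 1)).
    have n0 : 0 < n.+1%:R^-1 :> R by rewrite invr_gt0.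
    have [k kx] := dD (phi x) _ n0.
    exists k => //; exists n => //; rewrite ifT /=; first exact: ball_sym.
    apply/asboolP => y ky; apply: eU.
    rewrite [e](_ : _ = e / 2 + e / 2); last by rewrite -splitr.
    by apply: (@ball_triangle _ _ (D k)); [exact: le_ball (ltW ne) _ kx|exact: le_ball (ltW ne) _ ky].
  by case: asboolP => // H; apply: H.
apply: bigcup_measurable => k _; apply: bigcup_measurable => n _.
by case: ifP => // _; exact: mb.
Qed.

Lemma separable_measurable_real :
  separable_measurable (id : measurableTypeR R -> R).
Proof.
split=> [x r|]; first exact: measurable_ball.
exists (fun k => if unpickle k is Some q then ratr q else 0) => x r r0.
have /rat_in_itvoo[q qxr] : x - r < x + r by rewrite ltrBlDr -addrA ltrDl addr_gt0.
exists (pickle q); rewrite pickleK /ball/= ltr_distlC.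
by move: qxr; rewrite in_itv.
Qed.

Lemma separable_measurable_prod d1 d2 (M1 : measurableType d1) (M2 : measurableType d2)
  (T1 T2 : pseudoMetricType R) (f1 : M1 -> T1) (f2 : M2 -> T2) :
  separable_measurable f1 -> separable_measurable f2 ->
  separable_measurable (fun p : M1 * M2 => (f1 p.1, f2 p.2) : T1 * T2).
Proof.
move=> [m1 [D1 d1D]] [m2 [D2 d2D]]; split=> [x r|].
  have -> : (fun p : M1 * M2 => (f1 p.1, f2 p.2) : T1 * T2) @^-1` ball x r =
    (f1 @^-1` ball x.1 r) `*` (f2 @^-1` ball x.2 r) by [].
  exact: measurableX.
exists (fun k => if unpickle k is Some (i, j) then (D1 i, D2 j) else (D1 0%N, D2 0%N)).
move=> x r r0; have [i Hi] := d1D x.1 _ r0; have [j Hj] := d2D x.2 _ r0.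
by exists (pickle (i, j)); rewrite pickleK; split.
Qed.

Lemma separable_measurable_R2 :
  separable_measurable (id : measurableTypeR R * measurableTypeR R -> R * R).
Proof.
have := separable_measurable_prod separable_measurable_real separable_measurable_real.
by congr separable_measurable; apply/funext => -[].
Qed.

Lemma separable_measurable_R5 :
  separable_measurable (id : R5 (measurableTypeR R) -> R5 R).
Proof.
have s := separable_measurable_real.
have s2 := separable_measurable_R2.
have s3 := separable_measurable_prod s2 s.
have s4 := separable_measurable_prod s3 s.
have := separable_measurable_prod s4 s.
by congr separable_measurable; apply/funext => -[[[[]]]].
Qed.

(** Continuity is asked only at the points of an open set, because the local estimate deals with
    functions controlled on [V] or [Omega] alone. *)
Lemma continuous_on_measurable d (M : measurableType d) (T : pseudoMetricType R)
  (phi : M -> T) (U : set T) (f : T -> R) :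
  separable_measurable phi -> open U -> (forall x, U x -> {for x, continuous f}) ->
  measurable_fun (phi @^-1` U) (f \o phi : M -> measurableTypeR R).
Proof.
move=> sphi oU cf.
have mU := open_preimage_measurable sphi oU.
apply: (measurability _ (RGenOpens.measurableE R)) => _ [_ [a [b ->]] <-].
have -> : phi @^-1` U `&` (f \o phi) @^-1` `]a, b[ =
    phi @^-1` (U `&` f @^-1` `]a, b[) by [].
apply: open_preimage_measurable sphi _.
rewrite openE => x [Ux fx]; apply: filterI; first exact: open_nbhs_nbhs.
apply: (cf x Ux); apply: open_nbhs_nbhs; split => //; exact: interval_open.
Qed.

End separable_measurable.

(* The library's canonical sigma-finite structure on a product measure is the one
   of finite factors, so general sigma-finite products need their own constant. *)
Section sigma_finite_product.
Local Open Scope ereal_scope.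
Context {R : realType} d1 (T1 : measurableType d1) d2 (T2 : measurableType d2).
Variable m1 : {sigma_finite_measure set T1 -> \bar R}.
Variable m2 : {sigma_finite_measure set T2 -> \bar R}.

Definition sigma_product : set (T1 * T2)%type -> \bar R := m1 \x m2.

HB.instance Definition _ := Measure.on sigma_product.

Let sigma_product_sigma_finite : sigma_finite setT sigma_product.
Proof.
have /sigma_finiteP[F [TF ndF Foo]] := sigma_finiteT m1.
have /sigma_finiteP[G [TG ndG Goo]] := sigma_finiteT m2.
exists (fun n => F n `*` G n).
  rewrite -setXTT TF TG predeqE => -[x y]; split.
    move=> [/= [n _ Fnx] [k _ Gky]]; exists (maxn n k) => //; split.
    - by move: x Fnx; exact/subsetPset/ndF/leq_maxl.
    - by move: y Gky; exact/subsetPset/ndG/leq_maxr.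
  by move=> [n _ []/= ? ?]; split; exists n.
move=> k; have [? ?] := Foo k; have [? ?] := Goo k.
split; first exact: measurableX.
by rewrite /sigma_product product_measure1E// lte_mul_pinfty// ge0_fin_numE.
Qed.

HB.instance Definition _ := Measure_isSigmaFinite.Build _ _ _ sigma_product
  sigma_product_sigma_finite.

Lemma tonelli_fst f : measurable_fun setT f -> (forall x, 0 <= f x) ->
  \int[sigma_product]_x f x = \int[m1]_x \int[m2]_y f (x, y).
Proof. exact: fubini_tonelli1. Qed.

Lemma tonelli_snd f : measurable_fun setT f -> (forall x, 0 <= f x) ->
  \int[sigma_product]_x f x = \int[m2]_y \int[m1]_x f (x, y).
Proof. exact: fubini_tonelli2. Qed.

End sigma_finite_product.
Arguments tonelli_fst {R d1 T1 d2 T2 m1 m2 f}.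
Arguments tonelli_snd {R d1 T1 d2 T2 m1 m2 f}.

Section measure_preserving.
Local Open Scope ereal_scope.
Context {R : realType}.
Notation mR := (measurableTypeR R).
Notation leb := (@lebesgue_measure R).

(** Phrased with nonnegative integrals rather than measures of sets, so that compositions and
    products follow directly from Tonelli. *)
Definition measure_preserving d (T : measurableType d)
    (mu : {measure set T -> \bar R}) (phi : T -> T) :=
  measurable_fun setT phi /\
  forall f : T -> \bar R, measurable_fun setT f -> (forall x, 0 <= f x) ->
    \int[mu]_x f (phi x) = \int[mu]_x f x.

Lemma measure_preserving_comp d (T : measurableType d)
    (mu : {measure set T -> \bar R}) (phi psi : T -> T) :
  measure_preserving mu phi -> measure_preserving mu psi ->
  measure_preserving mu (phi \o psi).
Proof.
move=> [m1 h1] [m2 h2]; split; first exact: measurableT_comp.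
move=> f mf f0; rewrite -[RHS]h1// -[RHS]h2//.
exact: measurableT_comp.
Qed.

Lemma eq_measure_preserving d (T : measurableType d)
    (mu : {measure set T -> \bar R}) (phi psi : T -> T) :
  phi =1 psi -> measure_preserving mu phi -> measure_preserving mu psi.
Proof. by move=> /funext ->. Qed.

Lemma measure_preserving_integral d (T : measurableType d)
    (mu : {measure set T -> \bar R}) (phi : T -> T) (f : T -> \bar R) :
  measure_preserving mu phi -> measurable_fun setT f ->
  \int[mu]_x f (phi x) = \int[mu]_x f x.
Proof.
move=> [m1 h1] mf; rewrite integralE [RHS]integralE.
have -> : (fun x => f (phi x))^\+ = f^\+ \o phi by exact: funepos_comp.
have -> : (fun x => f (phi x))^\- = f^\- \o phi by exact: funeneg_comp.
rewrite [X in X - _]h1 ?[X in _ - X = _]h1//.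
- exact: measurable_funeneg.
- exact: measurable_funepos.
Qed.

Lemma measure_preserving_prodl d1 (T1 : measurableType d1)
  (m1 : {sigma_finite_measure set T1 -> \bar R}) d2 (T2 : measurableType d2)
  (m2 : {sigma_finite_measure set T2 -> \bar R})
  (phi : T1 -> T1) : measure_preserving m1 phi ->
  measure_preserving (sigma_product m1 m2) (fun p : T1 * T2 => (phi p.1, p.2)).
Proof.
move=> [mphi h].
have mphi' : measurable_fun [set: T1 * T2] (fun p : T1 * T2 => (phi p.1, p.2)).
  apply: measurable_fun_pair; last exact: measurable_snd.
  by apply: measurableT_comp => //; exact: measurable_fst.
split=> // f mf f0.
apply: (etrans (tonelli_snd (measurableT_comp mf mphi') (fun x => f0 _))).
apply: (etrans _ (esym (tonelli_snd mf f0))).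
apply: eq_integral => y _.
by apply: (h (fun x => f (x, y))) => //; exact: measurableT_comp.
Qed.

Section push_measure.
Context d1 d2 (X : measurableType d1) (Y : measurableType d2).
Variables (phi : X -> Y) (mphi : measurable_fun setT phi).
Variable mu : {measure set X -> \bar R}.

Definition push_measure : {measure set Y -> \bar R} :=
  measure_function_pushforward__canonical__measure_function_Measure mu mphi.

Lemma push_measureE A : push_measure A = mu (phi @^-1` A).
Proof. by []. Qed.

Lemma ge0_integral_push (f : Y -> \bar R) :
  measurable_fun setT f -> (forall y, 0 <= f y) ->
  \int[mu]_x f (phi x) = \int[push_measure]_y f y.
Proof.
by move=> mf f0; rewrite -[LHS](@ge0_integral_pushforward _ _ _ _ _ _ mphi mu setT f).
Qed.

End push_measure.

(** The translated measure agrees with Lebesgue measure on half-open intervals, hence everywhere by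
    uniqueness; dilations are treated in the same way below. *)
Lemma lebesgue_integral_shift (f : mR -> \bar R) (a : R) :
  measurable_fun setT f -> (forall x, 0 <= f x) ->
  \int[leb]_x f (x + a)%R = \int[leb]_x f x.
Proof.
move=> mf f0.
have ma : measurable_fun setT ((fun x => x + a)%R : mR -> mR).
  by apply: measurable_funD => //; exact: measurable_cst.
rewrite (ge0_integral_push ma leb)//.
apply: eq_measure_integral => A mA _.
apply/esym/lebesgue_measure_unique => // _ [[u v]] _ <-.
rewrite ?/mscale push_measureE (_ : _ @^-1` _ = `](u - a)%R, (v - a)%R]%classic); last first.
  by apply/seteqP; split=> x/=; rewrite !in_itv/= ltrBlDr lerBrDr.
rewrite lebesgue_measure_itv [RHS]lebesgue_measure_itv/= !lte_fin ltrD2r.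
by case: ifP => // _; congr EFin; ring.
Qed.

Lemma lebesgue_integral_scale (f : mR -> \bar R) (a : R) : (0 < a)%R ->
  measurable_fun setT f -> (forall x, 0 <= f x) ->
  \int[leb]_x f (a * x)%R = (a^-1)%:E * \int[leb]_x f x.
Proof.
move=> a0 mf f0.
have ma : measurable_fun setT ((fun x => a * x)%R : mR -> mR).
  by apply: measurable_funM => //; exact: measurable_cst.
rewrite (ge0_integral_push ma leb)//.
have ai : (0 <= a^-1)%R by rewrite invr_ge0 ltW.
have a0' : (0 <= a)%R by exact: ltW.
suff -> : \int[leb]_x f x =
  \int[mscale (NngNum a0') (push_measure ma leb)]_x f x.
  rewrite ge0_integral_mscale//= muleA -EFinM mulVf ?mul1e//.
  by rewrite gt_eqF.
apply: eq_measure_integral => A mA _.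
apply: (@lebesgue_measure_unique R (mscale (NngNum a0') (push_measure ma leb))) => // _ [[u v]] _ <-.
rewrite [RHS](_ : _ = a%:E * leb ((fun x => a * x)%R @^-1` `]u, v]%classic))//.
rewrite (_ : _ @^-1` _ = `](u / a)%R, (v / a)%R]%classic); last first.
  by apply/seteqP; split=> x/=; rewrite !in_itv/= ltr_pdivrMr// ler_pdivlMr// ![(x * a)%R]mulrC.
rewrite lebesgue_measure_itv [in RHS]lebesgue_measure_itv/= !lte_fin ltr_pM2r ?invr_gt0//.
case: ifP => _; rewrite -?EFinM; congr EFin; last by rewrite mulr0.
by field; rewrite gt_eqF.
Qed.

(** By Tonelli the last coordinate is integrated first, and on each fibre the shear is a translation
    by a constant. *)
Lemma measure_preserving_shear d1 (T1 : measurableType d1)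
  (m1 : {sigma_finite_measure set T1 -> \bar R}) (c : T1 -> R) :
  measurable_fun setT (c : T1 -> mR) ->
  measure_preserving (sigma_product m1 leb) (fun p : T1 * mR => (p.1, (p.2 + c p.1)%R)).
Proof.
move=> mc.
have mphi' : measurable_fun [set: T1 * mR]
    (fun p : T1 * mR => (p.1, (p.2 + c p.1)%R)).
  apply: measurable_fun_pair; first exact: measurable_fst.
  apply: measurable_funD; first exact: measurable_snd.
  by apply: measurableT_comp => //; exact: measurable_fst.
split=> // f mf f0.
apply: (etrans (tonelli_fst (measurableT_comp mf mphi') (fun x => f0 _))).
apply: (etrans _ (esym (tonelli_fst mf f0))).
apply: eq_integral => y _ /=.
apply: (@lebesgue_integral_shift (fun x => f (y, x)) (c y)) => //.
exact: measurableT_comp.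
Qed.

Lemma measure_preserving_swap0 d1 (T1 : measurableType d1)
  (m1 : {sigma_finite_measure set T1 -> \bar R}) :
  measure_preserving (sigma_product m1 m1) (fun p : T1 * T1 => (p.2, p.1)).
Proof.
have ms : measurable_fun [set: T1 * T1] (fun p : T1 * T1 => (p.2, p.1)).
  exact: measurable_swap.
split=> // f mf f0.
apply: (etrans (tonelli_fst (measurableT_comp mf ms) (fun x => f0 _))).
exact: (esym (tonelli_snd mf f0)).
Qed.

(** With [measure_preserving_swap0] and products by further factors, this yields every adjacent
    transposition of the five coordinates. *)
Lemma measure_preserving_swap d1 (T1 : measurableType d1)
  (m1 : {sigma_finite_measure set T1 -> \bar R}) d2 (T2 : measurableType d2)
  (m2 : {sigma_finite_measure set T2 -> \bar R}) :
  measure_preserving (sigma_product (sigma_product m1 m2) m2)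
    (fun p : T1 * T2 * T2 => (p.1.1, p.2, p.1.2)).
Proof.
have ms : measurable_fun setT
    (fun p : T1 * T2 * T2 => (p.1.1, p.2, p.1.2)).
  apply: measurable_fun_pair.
    apply: measurable_fun_pair; last exact: measurable_snd.
    by apply: measurableT_comp; [exact: measurable_fst|exact: measurable_fst].
  by apply: measurableT_comp; [exact: measurable_snd|exact: measurable_fst].
split=> // f mf f0.
have E g : measurable_fun setT g -> (forall x, 0 <= g x) ->
    \int[sigma_product (sigma_product m1 m2) m2]_x g x = \int[m1]_x \int[m2]_y \int[m2]_z g (x, y, z).
  move=> mg g0; apply: (etrans (tonelli_fst mg g0)).
  have mF := @measurable_fun_fubini_tonelli_F _ _ _ _ R m2 g mg g0.
  have F0 q : 0 <= fubini_F m2 g q by apply: integral_ge0.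
  exact: (@fubini_tonelli1 _ _ _ _ R m1 m2 (fubini_F m2 g) mF F0).
apply: (etrans (E _ (measurableT_comp mf ms) (fun x => f0 _))).
apply: (etrans _ (esym (E _ mf f0))).
apply: eq_integral => x _ /=.
rewrite [LHS](fubini_tonelli (fun p : T2 * T2 => f (x, p.2, p.1)))//.
apply: measurableT_comp mf _.
apply: measurable_fun_pair; last exact: measurable_fst.
by apply: measurable_fun_pair; [exact: measurable_cst|exact: measurable_snd].
Qed.

End measure_preserving.

(** * Lebesgue measure on R^5: permutations, shears and translations *)

Section R5_measure.
Context {R : realType}.
Notation mR := (measurableTypeR R).
Notation leb := (@lebesgue_measure R).

(** Same nested product as [lebesgue5], built with [sigma_product] so that every prefix is
    sigma-finite; the two measures are therefore convertible, as [lebesgue5E] records. *)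
Definition leb4 : {sigma_finite_measure set (R4 mR) -> \bar R} :=
  sigma_product (sigma_product (sigma_product leb leb) leb) leb.
Definition leb5 : {sigma_finite_measure set (R5 mR) -> \bar R} :=
  sigma_product leb4 leb.

Lemma lebesgue5E (f : R5 mR -> \bar R) : (\int[lebesgue5]_x f x = \int[leb5]_x f x)%E.
Proof. by []. Qed.

Lemma Rlebesgue5E (f : R5 mR -> R) : \int[lebesgue5]_x f x = \int[leb5]_x f x.
Proof. exact: (congr1 fine (lebesgue5E (EFin \o f))). Qed.

Definition swap12 (x : R5 R) : R5 R := let: (a, b, c, d, e) := x in (b, a, c, d, e).
Definition swap23 (x : R5 R) : R5 R := let: (a, b, c, d, e) := x in (a, c, b, d, e).
Definition swap34 (x : R5 R) : R5 R := let: (a, b, c, d, e) := x in (a, b, d, c, e).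
Definition swap45 (x : R5 R) : R5 R := let: (a, b, c, d, e) := x in (a, b, c, e, d).
Definition shear34 (k : R) (x : R5 R) : R5 R :=
  let: (a, b, c, d, e) := x in (a, b, c, d + k * c, e).

Lemma measure_preserving_swap12 : measure_preserving leb5 (swap12 : R5 mR -> R5 mR).
Proof.
refine (eq_measure_preserving _ (measure_preserving_prodl leb (measure_preserving_prodl leb
  (measure_preserving_prodl leb (measure_preserving_swap0 leb))))).
by move=> [[[[? ?] ?] ?] ?].
Qed.

Lemma measure_preserving_swap23 : measure_preserving leb5 (swap23 : R5 mR -> R5 mR).
Proof.
refine (eq_measure_preserving _ (measure_preserving_prodl leb (measure_preserving_prodl leb
  (measure_preserving_swap leb leb)))).
by move=> [[[[? ?] ?] ?] ?].
Qed.

Lemma measure_preserving_swap34 : measure_preserving leb5 (swap34 : R5 mR -> R5 mR).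
Proof.
refine (eq_measure_preserving _ (measure_preserving_prodl leb
  (measure_preserving_swap (sigma_product leb leb) leb))).
by move=> [[[[? ?] ?] ?] ?].
Qed.

Lemma measure_preserving_swap45 : measure_preserving leb5 (swap45 : R5 mR -> R5 mR).
Proof.
refine (eq_measure_preserving _
  (measure_preserving_swap (sigma_product (sigma_product leb leb) leb) leb)).
by move=> [[[[? ?] ?] ?] ?].
Qed.

Lemma measure_preserving_shear34 k : measure_preserving leb5 (shear34 k : R5 mR -> R5 mR).
Proof.
have mc : measurable_fun setT ((fun p => k * p.2) : mR * mR * mR -> mR).
  by apply: measurable_funM; [exact: measurable_cst|exact: measurable_snd].
refine (eq_measure_preserving _ (measure_preserving_prodl leb
  (measure_preserving_shear (sigma_product (sigma_product leb leb) leb) mc))).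
by move=> [[[[? ?] ?] ?] ?].
Qed.

Lemma measure_preserving_translate (v : R5 R) :
  measure_preserving leb5 ((fun w => v + w) : R5 mR -> R5 mR).
Proof.
have h1 (a : R) : measure_preserving leb ((fun x => x + a) : mR -> mR).
  split; last by move=> f mf f0; exact: lebesgue_integral_shift.
  by apply: measurable_funD => //; exact: measurable_cst.
have step d (T : measurableType d) (m : {sigma_finite_measure set T -> \bar R}) phi (a : R) :
    measure_preserving m phi ->
    measure_preserving (sigma_product m leb) (fun p : T * mR => (phi p.1, p.2 + a)).
  move=> hphi.
  exact: (measure_preserving_comp
    (measure_preserving_shear m (measurable_cst (a : mR))) (measure_preserving_prodl leb hphi)).
case: v => [[[[a b] c] d] e].
refine (eq_measure_preserving _
  (step _ _ _ _ e (step _ _ _ _ d (step _ _ _ _ c (step _ _ _ _ b (h1 a)))))).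
move=> [[[[x1 x2] x3] x4] x5] /=.
by rewrite [LHS](_ : _ = (a + x1, b + x2, c + x3, d + x4, e + x5))//= ![_ + x1]addrC
  [_ + x2]addrC [_ + x3]addrC [_ + x4]addrC [_ + x5]addrC.
Qed.

Lemma Rintegral_measure_preserving (phi : R5 R -> R5 R) (f : R5 R -> R) :
  measure_preserving leb5 (phi : R5 mR -> R5 mR) ->
  measurable_fun setT (f : R5 mR -> mR) ->
  \int[leb5]_w f (phi w) = \int[leb5]_w f w.
Proof.
move=> hphi mf; have me : measurable_fun setT (EFin \o f : R5 mR -> \bar R) by exact/measurable_EFinP.
exact: (congr1 fine (measure_preserving_integral hphi me)).
Qed.

End R5_measure.

(** * The Euclidean norm and measurable functions on R^5 *)

Section enorm5.
Context {R : realType}.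
Notation mR := (measurableTypeR R).
Implicit Types (w x : R5 R).

Definition sqn (w : R5 R) : R :=
  w.1.1.1.1 ^+ 2 + w.1.1.1.2 ^+ 2 + w.1.1.2 ^+ 2 + w.1.2 ^+ 2 + w.2 ^+ 2.

Lemma sqn_ge0 w : 0 <= sqn w.
Proof. by rewrite /sqn !addr_ge0// sqr_ge0. Qed.

Lemma enorm4_ge0 (y : R4 R) : 0 <= enorm4 y.
Proof. by case: y => [[[a b] c] d]; exact: sqrtr_ge0. Qed.

Lemma enorm4_sqr a b c d : enorm4 (a, b, c, d) ^+ 2 = a ^+ 2 + b ^+ 2 + c ^+ 2 + d ^+ 2 :> R.
Proof. by rewrite /enorm4 sqr_sqrtr// !addr_ge0// sqr_ge0. Qed.

Lemma enorm5E w : enorm5 w = Num.sqrt (sqn w).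
Proof.
by case: w => [[[[a b] c] d] e]; rewrite /enorm5 /sqn/= sqr_sqrtr// !addr_ge0// sqr_ge0.
Qed.

Lemma enorm5_ge0 w : 0 <= enorm5 w. Proof. exact: sqrtr_ge0. Qed.

Lemma enorm5_sqr w : enorm5 w ^+ 2 = sqn w.
Proof. by rewrite enorm5E sqr_sqrtr// sqn_ge0. Qed.

Lemma enorm5N w : enorm5 (- w) = enorm5 w.
Proof. by rewrite !enorm5E /sqn/= !sqrrN. Qed.

Lemma norm_le_enorm5 w : `|w| <= enorm5 w.
Proof.
have H a b : a ^+ 2 <= b -> `|a| <= Num.sqrt b :> R.
  by move=> ab; rewrite -sqrtr_sqr ler_wsqrtr.
case: w => [[[[a b] c] d] e]; rewrite enorm5E /sqn !prod_normE/= !ge_max.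
have := (sqr_ge0 a, sqr_ge0 b, sqr_ge0 c, sqr_ge0 d, sqr_ge0 e).
move=> [[[[a0 b0] c0] d0] e0].
by rewrite !H//=; lra.
Qed.

Lemma enorm5_eq0 w : (enorm5 w == 0) = (w == 0).
Proof.
apply/eqP/eqP => [w0|->]; last by rewrite enorm5E /sqn/= expr0n/= !addr0 sqrtr0.
by apply/eqP; rewrite -normr_le0 -w0 norm_le_enorm5.
Qed.

Lemma cont_sqn : continuous sqn.
Proof.
move=> w; rewrite /sqn.
have c5 : {for w, continuous (fun w : R5 R => w.2)} by exact: cvg_snd.
have f1 : {for w, continuous (fun w : R5 R => w.1)} by exact: cvg_fst.
have c4 : {for w, continuous (fun w : R5 R => w.1.2)}.
  by apply: continuous_comp f1 _; exact: cvg_snd.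
have f2 : {for w, continuous (fun w : R5 R => w.1.1)}.
  by apply: continuous_comp f1 _; exact: cvg_fst.
have c3 : {for w, continuous (fun w : R5 R => w.1.1.2)}.
  by apply: continuous_comp f2 _; exact: cvg_snd.
have f3 : {for w, continuous (fun w : R5 R => w.1.1.1)}.
  by apply: continuous_comp f2 _; exact: cvg_fst.
have c2 : {for w, continuous (fun w : R5 R => w.1.1.1.2)}.
  by apply: continuous_comp f3 _; exact: cvg_snd.
have c1 : {for w, continuous (fun w : R5 R => w.1.1.1.1)}.
  by apply: continuous_comp f3 _; exact: cvg_fst.
have sq (f : R5 R -> R) : {for w, continuous f} -> {for w, continuous (fun w => f w ^+ 2)}.
  by move=> cf; exact: (cvg_comp _ _ cf (@exprn_continuous _ 2 (f w))).
by do 4![apply: cvgD; last exact: sq]; exact: sq.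
Qed.

Lemma cont_enorm5 : continuous (@enorm5 R).
Proof.
have -> : @enorm5 R = Num.sqrt \o sqn by apply/funext => w; rewrite enorm5E.
by move=> w; apply: continuous_comp; [exact: cont_sqn|exact: sqrt_continuous].
Qed.

Definition measurable5 (f : R5 R -> R) : Prop :=
  measurable_fun [set: R5 mR] (f : R5 mR -> mR).

Lemma continuous_measurable5 (f : R5 R -> R) : continuous f -> measurable5 f.
Proof.
move=> cf; rewrite /measurable5.
have := @continuous_on_measurable R _ _ _ _ setT f separable_measurable_R5 openT.
by rewrite preimage_setT; apply => x _; exact: cf.
Qed.

Lemma measurable5_cst c : measurable5 (fun=> c).
Proof. exact: measurable_cst. Qed.

Lemma measurable5D f g : measurable5 f -> measurable5 g -> measurable5 (fun w => f w + g w).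
Proof. exact: measurable_funD. Qed.

Lemma measurable5B f g : measurable5 f -> measurable5 g -> measurable5 (fun w => f w - g w).
Proof. exact: measurable_funB. Qed.

Lemma measurable5M f g : measurable5 f -> measurable5 g -> measurable5 (fun w => f w * g w).
Proof. exact: measurable_funM. Qed.

Lemma measurable5_norm f : measurable5 f -> measurable5 (fun w => `|f w|).
Proof. move=> mf; exact: (measurableT_comp (@normr_measurable R setT) mf). Qed.

Lemma measurable5_preserving (phi : R5 R -> R5 R) f :
  measure_preserving leb5 (phi : R5 mR -> R5 mR) -> measurable5 f ->
  measurable5 (fun w => f (phi w)).
Proof. move=> [mphi _] mf; exact: (measurableT_comp mf mphi). Qed.

Lemma measurable5_translate v f : measurable5 f -> measurable5 (fun w => f (v + w)).
Proof. exact: (measurable5_preserving (measure_preserving_translate v)). Qed.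

Lemma measurable5_enormV n : measurable5 (fun w => (enorm5 w ^+ n)^-1).
Proof.
(* Inversion is read as the power -1, whose measurability is known; the two agree at 0 as well. *)
rewrite (_ : (fun w => _) = (fun w => powR (enorm5 w ^+ n) (-1))); last first.
  by apply/funext => w; rewrite powR_inv1// exprn_ge0// enorm5_ge0.
have m1 : measurable5 (fun w => enorm5 w ^+ n).
  by apply: measurable_funX; exact: continuous_measurable5 cont_enorm5.
exact: (measurableT_comp (measurable_powR (-1)) m1).
Qed.

(** The kernel is recentred at the origin, so that the point [x] enters through the source only and
    derivatives will fall on [f]. *)
Lemma newtonian5E (f : R5 R -> R) x : measurable5 f ->
  newtonian5 f x = (8 * pi ^+ 2)^-1 * \int[leb5]_w (f (x + w) / enorm5 w ^+ 3).
Proof.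
move=> mf; rewrite /newtonian5; apply: f_equal.
apply: (etrans (Rlebesgue5E (fun w => f w / enorm5 (x - w) ^+ 3))).
have mg : measurable5 (fun w => f w / enorm5 (x - w) ^+ 3).
  apply: measurable5M => //.
  rewrite (_ : (fun w => _) = (fun w => (enorm5 (- x + w) ^+ 3)^-1)).
    exact: (measurable5_translate _ (measurable5_enormV 3)).
  by apply/funext => w/=; rewrite -[in LHS]enorm5N opprB addrC.
rewrite -(Rintegral_measure_preserving (measure_preserving_translate x) mg).
by apply: eq_Rintegral => w _; rewrite opprD addNKr enorm5N.
Qed.

End enorm5.

(** * The maximal inequality *)

Section averaging.
Context d (T : measurableType d) {R : realType}.
Variable mu : {sigma_finite_measure set T -> \bar R}.
Implicit Types f g h : T -> R.

(** Nonnegativity lets every exchange of integrals below go through Tonelli; the kernels and maximal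
    functions are nonnegative anyway. *)
Definition pos_L2 f := [/\ measurable_fun setT f, (forall x, 0 <= f x)
  & (\int[mu]_x (f x ^+ 2)%:E < +oo)%E].

Definition inner f g := \int[mu]_x (f x * g x).

Lemma pos_L2_integrable f g : pos_L2 f -> pos_L2 g ->
  mu.-integrable setT (fun x => (f x * g x)%:E).
Proof.
move=> [mf f0 fi] [mg g0 gi].
have I h : measurable_fun setT h -> (\int[mu]_x (h x ^+ 2)%:E < +oo)%E ->
    mu.-integrable setT (fun x => (h x ^+ 2)%:E).
  move=> mh hi; apply/integrableP; split.
    by apply/measurable_EFinP; exact: measurable_funX.
  by under eq_integral do rewrite gee0_abs ?lee_fin ?sqr_ge0//.
apply: le_integrable (integrableD _ (I _ mf fi) (I _ mg gi)) => //.
  by apply/measurable_EFinP; exact: measurable_funM.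
move=> x _ /=; rewrite lee_fin !ger0_norm ?addr_ge0 ?mulr_ge0 ?sqr_ge0//.
by have := sqr_ge0 (f x - g x); have := sqr_ge0 (f x + g x); lra.
Qed.

Lemma innerE f g : pos_L2 f -> pos_L2 g ->
  (inner f g)%:E = (\int[mu]_x (f x * g x)%:E)%E.
Proof.
move=> Lf Lg; rewrite /inner /Rintegral fineK//.
by apply: integrable_fin_num => //; exact: pos_L2_integrable.
Qed.

Lemma innerC f g : inner f g = inner g f.
Proof. by apply: eq_Rintegral => x _; rewrite mulrC. Qed.

Lemma inner_ge0 f g : pos_L2 f -> pos_L2 g -> 0 <= inner f g.
Proof. by move=> [_ f0 _] [_ g0 _]; apply: Rintegral_ge0 => x _; rewrite mulr_ge0. Qed.

Lemma inner_le f f' g g' : pos_L2 f -> pos_L2 f' -> pos_L2 g -> pos_L2 g' ->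
  (forall x, f x * g x <= f' x * g' x) -> inner f g <= inner f' g'.
Proof.
move=> Lf Lf' Lg Lg' H; apply: le_Rintegral => //.
- exact: pos_L2_integrable.
- exact: pos_L2_integrable.
Qed.

Lemma pos_L2_0 : pos_L2 (fun=> 0).
Proof.
split => //; under eq_integral do rewrite expr0n/=.
by rewrite integral0.
Qed.

Lemma pos_L2_le f g : measurable_fun setT f -> (forall x, 0 <= f x) ->
  (forall x, f x <= g x) -> pos_L2 g -> pos_L2 f.
Proof.
move=> mf f0 fg [mg g0 gi]; split => //.
apply: le_lt_trans gi; apply: ge0_le_integral => //.
- by move=> x _; rewrite lee_fin sqr_ge0.
- by apply/measurable_EFinP; exact: measurable_funX.
- by apply/measurable_EFinP; exact: measurable_funX.
- by move=> x _; rewrite lee_fin lerXn2r// nnegrE.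
Qed.

Lemma pos_L2D f g : pos_L2 f -> pos_L2 g -> pos_L2 (fun x => f x + g x).
Proof.
move=> [mf f0 fi] [mg g0 gi]; split; first exact: measurable_funD.
  by move=> x; rewrite addr_ge0.
apply: (@le_lt_trans _ _ (\int[mu]_x (2%:E * (f x ^+ 2)%:E + 2%:E * (g x ^+ 2)%:E))%E).
  apply: ge0_le_integral => //.
  - by move=> x _; rewrite lee_fin sqr_ge0.
  - by apply/measurable_EFinP; apply: measurable_funX; exact: measurable_funD.
  - under eq_fun do rewrite -!EFinM -EFinD.
    apply/measurable_EFinP; apply: measurable_funD; apply: measurable_funM => //;
    exact: measurable_funX.
  - move=> x _; rewrite -!EFinM -EFinD lee_fin.
    by have := sqr_ge0 (f x - g x); lra.
have m2 h : measurable_fun setT h -> measurable_fun setT (fun x => (h x ^+ 2)%:E).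
  by move=> mh; apply/measurable_EFinP; exact: measurable_funX.
have p2 h x : (0 <= (h x ^+ 2)%:E)%E by rewrite lee_fin sqr_ge0.
rewrite ge0_integralD//; first last.
- by apply: measurable_funeM; exact: m2.
- by move=> x _; rewrite mule_ge0.
- by apply: measurable_funeM; exact: m2.
- by move=> x _; rewrite mule_ge0.
rewrite !ge0_integralZl//; [|exact: m2|exact: m2].
by rewrite lte_add_pinfty// lte_mul_pinfty.
Qed.

Lemma pos_L2Z k f : 0 <= k -> pos_L2 f -> pos_L2 (fun x => k * f x).
Proof.
move=> k0 [mf f0 fi]; split; first exact: measurable_funM.
  by move=> x; rewrite mulr_ge0.
under eq_integral do rewrite exprMn EFinM.
rewrite ge0_integralZl//.
- by rewrite lte_mul_pinfty// lee_fin sqr_ge0.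
- by apply/measurable_EFinP; exact: measurable_funX.
- by move=> x _; rewrite lee_fin sqr_ge0.
- by rewrite lee_fin sqr_ge0.
Qed.

Lemma pos_L2_weight (p : T -> R) f : measurable_fun setT p -> (forall x, 0 <= p x <= 1) ->
  pos_L2 f -> pos_L2 (fun x => p x * f x).
Proof.
move=> mp p01 Lf; have [mf f0 _] := Lf.
apply: (pos_L2_le _ _ _ Lf); first exact: measurable_funM.
  by move=> x; have /andP[p0 _] := p01 x; rewrite mulr_ge0.
by move=> x; have /andP[p0 p1] := p01 x; rewrite ler_piMl.
Qed.

Lemma pos_L2_sum n (F : 'I_n -> T -> R) : (forall i, pos_L2 (F i)) ->
  pos_L2 (fun x => \sum_(i < n) F i x).
Proof.
elim: n F => [|n IH] F LF.
  by under eq_fun do rewrite big_ord0; exact: pos_L2_0.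
under eq_fun do rewrite big_ord_recl.
by apply: pos_L2D => //; exact: IH.
Qed.

Lemma innerDl f f' g : pos_L2 f -> pos_L2 f' -> pos_L2 g ->
  inner (fun x => f x + f' x) g = inner f g + inner f' g.
Proof.
move=> Lf Lf' Lg; rewrite /inner -RintegralD//; try exact: pos_L2_integrable.
by apply: eq_Rintegral => x _; rewrite mulrDl.
Qed.

Lemma innerZl k f g : pos_L2 f -> pos_L2 g ->
  inner (fun x => k * f x) g = k * inner f g.
Proof.
move=> Lf Lg; rewrite /inner -RintegralZl//; last exact: pos_L2_integrable.
by apply: eq_Rintegral => x _; rewrite mulrA.
Qed.

Lemma inner_suml n (F : 'I_n -> T -> R) g : (forall i, pos_L2 (F i)) -> pos_L2 g ->
  inner (fun x => \sum_(i < n) F i x) g = \sum_(i < n) inner (F i) g.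
Proof.
elim: n F => [|n IH] F LF Lg.
  rewrite big_ord0; transitivity (inner (fun=> 0) g).
    by apply: eq_Rintegral => x _; rewrite big_ord0.
  by rewrite /inner; under eq_Rintegral do rewrite mul0r; rewrite Rintegral_cst// mul0r.
rewrite big_ord_recl -IH// -innerDl//; last exact: pos_L2_sum.
by apply: eq_Rintegral => x _; rewrite big_ord_recl.
Qed.

Lemma inner_sumr n (F : 'I_n -> T -> R) g : (forall i, pos_L2 (F i)) -> pos_L2 g ->
  inner g (fun x => \sum_(i < n) F i x) = \sum_(i < n) inner g (F i).
Proof.
by move=> LF Lg; rewrite innerC inner_suml//; apply: eq_bigr => i _; rewrite innerC.
Qed.

(** The integral of (s f - g)^2 / (2 s) is nonnegative. The free weight [s] takes the place of
    Cauchy-Schwarz and makes absorption arguments linear. *)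
Lemma inner_young s f g : 0 < s -> pos_L2 f -> pos_L2 g ->
  inner f g <= (s * inner f f + s^-1 * inner g g) / 2.
Proof.
move=> s0 Lf Lg; have s20 : 0 <= s / 2 by rewrite divr_ge0// ltW.
have si20 : 0 <= s^-1 / 2 by rewrite divr_ge0// invr_ge0 ltW.
rewrite mulrDl mulrAC [s^-1 * _ / _]mulrAC -!innerZl// /inner -RintegralD//; last 2 first.
- by apply: pos_L2_integrable => //; exact: pos_L2Z.
- by apply: pos_L2_integrable => //; exact: pos_L2Z.
apply: le_Rintegral => //; first exact: pos_L2_integrable.
  have I := integrableD measurableT (pos_L2_integrable (pos_L2Z s20 Lf) Lf)
    (pos_L2_integrable (pos_L2Z si20 Lg) Lg).
  by apply: eq_integrable I.
move=> x _; set a := f x; set b := g x.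
rewrite -subr_ge0 (_ : _ - _ = (s * a - b) ^+ 2 * (s^-1 / 2)); last first.
  by field; rewrite gt_eqF.
by rewrite mulr_ge0 ?sqr_ge0.
Qed.


Variable K : nat -> T -> T -> R.
Variables (c0 C : R) (b : nat -> R).
Hypothesis c0_gt0 : 0 < c0.
Hypothesis C_gt0 : 0 < C.
Hypothesis mK : forall i, measurable_fun [set: T * T] (fun p => K i p.1 p.2).
Hypothesis K_ge0 : forall i x y, 0 <= K i x y.
Hypothesis K_le : forall i x y, K i x y <= b i.
Hypothesis KC : forall i x y, K i x y = K i y x.
Hypothesis K_int : forall i x, (\int[mu]_y (K i x y)%:E = c0%:E)%E.
(** The geometric input of the maximal inequality: two averages compose, up to [C], into one average
    at the scale after the larger. It is stated for ordered scales; [KC] supplies the other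
    order. *)
Hypothesis K_conv : forall i j x z, (i <= j)%N ->
  (\int[mu]_y (K i x y * K j y z)%:E <= (C * K j.+1 x z)%:E)%E.

Definition average i g x := inner (K i x) g.

Lemma measurable_kernel i x : measurable_fun setT (K i x).
Proof. exact: (measurableT_comp (mK i) (measurable_pair1 x)). Qed.

(** K^2 is at most [b i] times K, and K has integral [c0]. *)
Lemma kernel_pos_L2 i x : pos_L2 (K i x).
Proof.
split => //; first exact: measurable_kernel.
apply: (@le_lt_trans _ _ (\int[mu]_y ((b i)%:E * (K i x y)%:E))%E).
  apply: ge0_le_integral => //.
  - by move=> y _; rewrite lee_fin sqr_ge0.
  - by apply/measurable_EFinP; apply: measurable_funX; exact: measurable_kernel.
  - by apply: measurable_funeM; apply/measurable_EFinP; exact: measurable_kernel.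
  - by move=> y _; rewrite -EFinM lee_fin expr2 ler_wpM2r.
rewrite ge0_integralZl//; last 3 first.
- by apply/measurable_EFinP; exact: measurable_kernel.
- by move=> y _; rewrite lee_fin.
- by rewrite lee_fin (le_trans (K_ge0 i x x))//; exact: K_le.
by rewrite K_int -EFinM ltry.
Qed.

Lemma averageE i g x : pos_L2 g -> (average i g x)%:E = (\int[mu]_y (K i x y * g y)%:E)%E.
Proof. by move=> Lg; rewrite /average innerE//; exact: kernel_pos_L2. Qed.

Lemma average_ge0 i g x : pos_L2 g -> 0 <= average i g x.
Proof. by move=> Lg; apply: inner_ge0 => //; exact: kernel_pos_L2. Qed.

Lemma measurable_kernelM i g : measurable_fun setT g ->
  measurable_fun [set: T * T] (fun p => (K i p.1 p.2 * g p.2)%:E).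
Proof.
move=> mg; apply/measurable_EFinP; apply: measurable_funM => //.
exact: measurableT_comp mg measurable_snd.
Qed.

Lemma measurable_average i g : pos_L2 g -> measurable_fun setT (average i g).
Proof.
move=> Lg; have [mg g0 _] := Lg.
apply/measurable_EFinP.
have -> : EFin \o average i g = fubini_F mu (fun p => (K i p.1 p.2 * g p.2)%:E).
  by apply/funext => x; rewrite /= averageE.
apply: measurable_fun_fubini_tonelli_F; first exact: measurable_kernelM.
by move=> p; rewrite lee_fin mulr_ge0.
Qed.

(* Jensen: [(A g)^2 <= c0 A (g^2)], from [g <= (t + g^2 / t) / 2] with [t = A g / c0]. *)
Lemma average_sqr i g x : pos_L2 g ->
  ((average i g x ^+ 2)%:E <= c0%:E * \int[mu]_y (K i x y * g y ^+ 2)%:E)%E.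
Proof.
move=> Lg; have [mg g0 _] := Lg.
have mKx := measurable_kernel i x.
have Q0 : (0 <= \int[mu]_y (K i x y * g y ^+ 2)%:E)%E.
  by apply: integral_ge0 => y _; rewrite lee_fin mulr_ge0 ?sqr_ge0.
have := average_ge0 i x Lg; rewrite le_eqVlt => /orP[/eqP<-|a0].
  by rewrite expr0n/= mule_ge0// lee_fin ltW.
set a := average i g x in a0 *.
set Q := (\int[mu]_y _)%E in Q0 *.
have [Qoo|Qfin] := eqVneq Q +oo%E.
  by rewrite Qoo gt0_muley ?leey// lte_fin.
have Qf : Q \is a fin_num by rewrite ge0_fin_numE// ltey.
have t0 : 0 < a / c0 by rewrite divr_gt0.
have h1 : 0 <= a / c0 / 2 by rewrite divr_ge0// ltW.
have h2 : 0 <= (a / c0)^-1 / 2 by rewrite divr_ge0// invr_ge0 ltW.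
have H : (a%:E <= ((a / c0) / 2)%:E * c0%:E + ((a / c0)^-1 / 2)%:E * Q)%E.
  rewrite /Q [leLHS](averageE i x Lg) -(K_int i x) -!ge0_integralZl//; first last.
  - by move=> y _; rewrite lee_fin.
  - exact/measurable_EFinP.
  - by move=> y _; rewrite lee_fin mulr_ge0 ?sqr_ge0.
  - by apply/measurable_EFinP; apply: measurable_funM => //; exact: measurable_funX.
  rewrite -ge0_integralD//; first last.
  - apply: measurable_funeM; apply/measurable_EFinP; apply: measurable_funM => //.
    exact: measurable_funX.
  - by move=> y _; rewrite -EFinM lee_fin mulr_ge0// mulr_ge0// sqr_ge0.
  - by apply: measurable_funeM; exact/measurable_EFinP.
  - by move=> y _; rewrite -EFinM lee_fin mulr_ge0.
  apply: ge0_le_integral => //.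
  - by move=> y _; rewrite lee_fin mulr_ge0.
  - by apply/measurable_EFinP; exact: measurable_funM.
  - apply: emeasurable_funD; apply: measurable_funeM; apply/measurable_EFinP => //.
    by apply: measurable_funM => //; exact: measurable_funX.
  - move=> y _; rewrite -!EFinM -EFinD lee_fin.
    set t := a / c0 in t0 *; set u := g y.
    rewrite -subr_ge0 (_ : _ - _ = K i x y * ((t - u) ^+ 2 * (t^-1 / 2))).
      by rewrite mulr_ge0// mulr_ge0 ?sqr_ge0.
    by field; rewrite gt_eqF.
move: H; rewrite -(fineK Qf) -!EFinM -EFinD !lee_fin => H.
set q := fine Q in H *.
(* After multiplication by 2 a the right-hand side is exactly a^2 + c0 q, and a^2 is absorbed on the
   left. *)
have : (2 * a) * a <= (2 * a) * ((a / c0) / 2 * c0 + (a / c0)^-1 / 2 * q).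
  by rewrite ler_pM2l// mulr_gt0.
rewrite (_ : _ * (_ + _) = a ^+ 2 + c0 * q); first by rewrite expr2; lra.
by field; rewrite ?gt_eqF.
Qed.

(** Schur's test: the pointwise Jensen bound contributes one factor [c0]; Tonelli and the symmetry
    of the kernel integrate it in its first variable and contribute the other. *)
Lemma integral_average_sqr i g : pos_L2 g ->
  (\int[mu]_x (average i g x ^+ 2)%:E <= (c0 ^+ 2)%:E * \int[mu]_x (g x ^+ 2)%:E)%E.
Proof.
move=> Lg; have [mg g0 gi] := Lg.
have mA := measurable_average i Lg.
have c00 : (0 <= c0%:E)%E by rewrite lee_fin ltW.
have mg2 : measurable_fun setT (fun x => g x ^+ 2) by exact: measurable_funX.
have mk := measurable_kernelM i mg2.
have k0 p : (0 <= (K i p.1 p.2 * g p.2 ^+ 2)%:E)%E.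
  by rewrite lee_fin mulr_ge0// sqr_ge0.
apply: (@le_trans _ _ (\int[mu]_x (c0%:E * fubini_F mu (fun p => (K i p.1 p.2 * g p.2 ^+ 2)%:E) x))%E).
  apply: ge0_le_integral => //.
  - by move=> x _; rewrite lee_fin sqr_ge0.
  - by apply/measurable_EFinP; exact: measurable_funX.
  - by apply: measurable_funeM; exact: measurable_fun_fubini_tonelli_F.
  - by move=> x _; exact: average_sqr.
rewrite ge0_integralZl//; first last.
- by move=> x _; exact: integral_ge0.
- exact: measurable_fun_fubini_tonelli_F.
rewrite expr2 EFinM -muleA lee_wpmul2l// (fubini_tonelli _ mk k0)/=.
rewrite le_eqVlt; apply/orP; left; apply/eqP.
rewrite -ge0_integralZl//; first last.
- by move=> x _; rewrite lee_fin sqr_ge0.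
- exact/measurable_EFinP.
apply: eq_integral => y _.
rewrite -(K_int i y) -ge0_integralZr//; first last.
- by rewrite lee_fin sqr_ge0.
- by move=> x _; rewrite lee_fin.
- by apply/measurable_EFinP; exact: measurable_kernel.
by apply: eq_integral => x _; rewrite -EFinM KC.
Qed.

Lemma average_pos_L2 i g : pos_L2 g -> pos_L2 (average i g).
Proof.
move=> Lg; split; first exact: measurable_average.
  by move=> x; exact: average_ge0.
have [_ _ gi] := Lg.
apply: le_lt_trans (integral_average_sqr i Lg) _.
by rewrite lte_mul_pinfty// ?lee_fin ?sqr_ge0.
Qed.

Lemma inner_average i g : pos_L2 g ->
  inner (average i g) (average i g) <= c0 ^+ 2 * inner g g.
Proof.
move=> Lg; have LA := average_pos_L2 i Lg.
rewrite -lee_fin EFinM !innerE//.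
have := integral_average_sqr i Lg.
by under eq_integral do rewrite expr2.
Qed.

Lemma averageC i f g : pos_L2 f -> pos_L2 g ->
  inner f (average i g) = inner (average i f) g.
Proof.
move=> Lf Lg; have [mf f0 _] := Lf; have [mg g0 _] := Lg.
have LAf := average_pos_L2 i Lf; have LAg := average_pos_L2 i Lg.
apply: EFin_inj; rewrite !innerE//.
have mF : measurable_fun [set: T * T] (fun p => (f p.1 * (K i p.1 p.2 * g p.2))%:E).
  apply/measurable_EFinP; apply: measurable_funM.
    exact: measurableT_comp mf measurable_fst.
  apply/measurable_EFinP; exact: measurable_kernelM.
have F0 p : (0 <= (f p.1 * (K i p.1 p.2 * g p.2))%:E)%E by rewrite lee_fin !mulr_ge0.
transitivity (\int[mu]_x \int[mu]_y (f x * (K i x y * g y))%:E)%E.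
  apply: eq_integral => x _; rewrite EFinM averageE// -ge0_integralZl//.
  - by apply/measurable_EFinP; apply: measurable_funM => //; exact: measurable_kernel.
  - by move=> y _; rewrite lee_fin mulr_ge0.
  - by rewrite lee_fin.
apply: (etrans (@fubini_tonelli _ _ _ _ _ mu mu _ mF F0)); apply: eq_integral => y _ /=.
rewrite mulrC EFinM averageE// -ge0_integralZl//.
- by apply: eq_integral => x _; rewrite -EFinM KC; congr EFin; ring.
- by apply/measurable_EFinP; apply: measurable_funM => //; exact: measurable_kernel.
- by move=> x _; rewrite lee_fin mulr_ge0.
- by rewrite lee_fin.
Qed.

Lemma average_average i j f x : pos_L2 f ->
  average i (average j f) x <= C * average (maxn i j).+1 f x.
Proof.
move=> Lf; have [mf f0 _] := Lf.
have LA := average_pos_L2 j Lf.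
rewrite -lee_fin EFinM !averageE//.
have mKx k y := measurable_kernel k y.
have mF : measurable_fun [set: T * T] (fun p => (K i x p.1 * (K j p.1 p.2 * f p.2))%:E).
  apply/measurable_EFinP; apply: measurable_funM.
    exact: measurableT_comp (mKx i x) measurable_fst.
  apply/measurable_EFinP; exact: measurable_kernelM.
have F0 p : (0 <= (K i x p.1 * (K j p.1 p.2 * f p.2))%:E)%E by rewrite lee_fin !mulr_ge0.
have -> : (\int[mu]_y (K i x y * average j f y)%:E =
    \int[mu]_z \int[mu]_y (K i x y * (K j y z * f z))%:E)%E.
  apply: (etrans _ (@fubini_tonelli _ _ _ _ _ mu mu _ mF F0)).
  apply: eq_integral => y _; rewrite EFinM averageE// -ge0_integralZl//.
  - by apply/measurable_EFinP; exact: measurable_funM.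
  - by move=> z _; rewrite lee_fin mulr_ge0.
  - by rewrite lee_fin.
rewrite -ge0_integralZl//; first last.
- by rewrite lee_fin ltW.
- by move=> z _; rewrite lee_fin mulr_ge0.
- by apply/measurable_EFinP; exact: measurable_funM.
have mz z : measurable_fun setT (fun y => K j y z).
  by rewrite (_ : (fun y => K j y z) = K j z) //; apply/funext => y; rewrite KC.
apply: ge0_le_integral => //.
- by move=> z _; apply: integral_ge0 => y _; rewrite lee_fin !mulr_ge0.
- exact: (measurable_fun_fubini_tonelli_G _ mF F0).
- by apply: measurable_funeM; apply/measurable_EFinP; exact: measurable_funM.
move=> z _; rewrite -EFinM mulrA EFinM.
have -> : (\int[mu]_y (K i x y * (K j y z * f z))%:E =
  (\int[mu]_y (K i x y * K j y z)%:E) * (f z)%:E)%E.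
  rewrite -ge0_integralZr//.
  - by apply: eq_integral => y _; rewrite -EFinM mulrA.
  - by apply/measurable_EFinP; exact: measurable_funM.
  - by move=> y _; rewrite lee_fin mulr_ge0.
  - by rewrite lee_fin.
rewrite lee_wpmul2r ?lee_fin//.
have [ij|/ltnW ji] := leqP i j; first exact: K_conv.
(* For j < i, symmetry of all three kernels exchanges the roles of x and z and restores the order
   required by [K_conv]. *)
rewrite KC; apply: le_trans (K_conv z x ji).
rewrite le_eqVlt; apply/orP; left; apply/eqP; apply: eq_integral => y _.
by rewrite mulrC KC [K i x y]KC.
Qed.

(** The solution D of D = 2 C ((2 C + D / (2 C)) / 2 + (1 + c0^2) / 2), the equation that closes the
    induction in [linearized_maximal]. *)
Definition maximal_const : R := 4 * C ^+ 2 + 2 * C * (1 + c0 ^+ 2).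

Lemma maximal_const_gt0 : 0 < maximal_const.
Proof.
rewrite /maximal_const addr_gt0// ?mulr_gt0 ?exprn_gt0//.
by rewrite addr_gt0// exprn_gt0.
Qed.

(* TT* argument: [T g = sum_i phi_i A_(k0+i) g] satisfies
   [TT* f <= 2 C sum_i phi_i A_(k0+i+1) f], an operator of the same kind up to its last term;
   hence its norm is controlled by induction on the number of terms. *)
Lemma linearized_maximal n k0 (phi : nat -> T -> R) g :
  (forall i, measurable_fun setT (phi i)) -> (forall i x, 0 <= phi i x) ->
  (forall x, \sum_(i < n) phi i x <= 1) -> pos_L2 g ->
  inner (fun x => \sum_(i < n) phi i x * average (k0 + i) g x)
        (fun x => \sum_(i < n) phi i x * average (k0 + i) g x) <=
  maximal_const * inner g g.
Proof.
elim: n k0 g => [|n IH] k0 g mphi phi0 phi1 Lg.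
  rewrite {1 2}/inner; under eq_Rintegral do rewrite big_ord0 mul0r.
  by rewrite Rintegral_cst// mul0r mulr_ge0 ?inner_ge0// ltW// maximal_const_gt0.
set D := maximal_const; have D0 : 0 < D := maximal_const_gt0.
set f := fun x => _.
have phi01 (i : 'I_n.+1) x : 0 <= phi i x <= 1.
  rewrite phi0/=; apply: le_trans (phi1 x).
  by rewrite (bigD1 i)//= lerDl sumr_ge0.
have LA k h : pos_L2 h -> pos_L2 (average k h) by exact: average_pos_L2.
have LpA (i : 'I_n.+1) k h : pos_L2 h -> pos_L2 (fun x => phi i x * average k h x).
  by move=> Lh; apply: pos_L2_weight => //; exact: LA.
have Lf : pos_L2 f by apply: pos_L2_sum => i; exact: LpA.
pose F (i : 'I_n.+1) (x : T) := phi i x * f x.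
have LF i : pos_L2 (F i) by exact: pos_L2_weight.
pose A (i : 'I_n.+1) := average (k0 + i) (F i).
have LAF i : pos_L2 (A i) by exact: LA.
pose S (x : T) := \sum_(i < n.+1) A i x.
have LS : pos_L2 S by exact: pos_L2_sum.
(* Here f = T g and S = T* f, so this is the identity (T g, T g) = (T* T g, g). *)
have E1 : inner f f = inner S g.
  rewrite {1}/f inner_suml; [|by move=> i; exact: LpA|by []].
  rewrite /S inner_suml//; apply: eq_bigr => i _; rewrite /A -averageC//.
  by apply: eq_Rintegral => x _; rewrite /F; ring.
have E2 : inner S S <= D * inner f f.
  pose a (i j : 'I_n.+1) := inner (average (k0 + i).+1 (F i)) (F j).
  (* Each pairing of A_i F_i with A_j F_j is reduced to one average at scale max + 1. Adding both
     candidates for the maximum makes the bound symmetric in i and j and costs the factor 2 in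
     [H3]. *)
  have H1 : inner S S <= C * \sum_(i < n.+1) \sum_(j < n.+1) (a i j + a j i).
    rewrite {1}/S inner_suml// mulr_sumr; apply: ler_sum => i _.
    rewrite /S inner_sumr// mulr_sumr; apply: ler_sum => j _.
    rewrite /A -averageC//; last exact: LA.
    apply: (@le_trans _ _ (C * inner (F i) (average (maxn (k0 + i) (k0 + j)).+1 (F j)))).
      rewrite [X in _ <= C * X]innerC -innerZl//; last exact: LA.
      rewrite innerC; apply: inner_le => //.
      + exact: LA (LA _ _ (LF j)).
      + exact: pos_L2Z (ltW C_gt0) (LA _ _ (LF j)).
      by move=> x; rewrite ler_wpM2r ?average_average//; have [] := LF i.
    rewrite ler_wpM2l ?(ltW C_gt0)//.
    have aij : inner (F i) (average (k0 + i).+1 (F j)) = a i j by exact: averageC.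
    have aji : inner (F i) (average (k0 + j).+1 (F j)) = a j i by rewrite innerC.
    have a0 u v : 0 <= a u v by apply: inner_ge0 => //; exact: LA.
    rewrite /maxn; case: ifP => _; first by rewrite aji lerDr.
    by rewrite aij lerDl.
  pose H (x : T) := \sum_(i < n.+1) phi i x * average (k0 + i).+1 f x.
  have LH : pos_L2 H by apply: pos_L2_sum => i; exact: LpA.
  (* Summing over j first, the F_j add up to (sum of phi_j) f, which is at most f. *)
  have H2 : \sum_(i < n.+1) \sum_(j < n.+1) a i j <= inner f H.
    rewrite innerC {1}/H inner_suml//; last by move=> i; exact: LpA.
    apply: ler_sum => i _.
    have -> : inner (fun x => phi i x * average (k0 + i).+1 f x) f =
        inner (average (k0 + i).+1 (F i)) f.
      by rewrite -averageC//; apply: eq_Rintegral => x _; rewrite /F; ring.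
    rewrite /a -inner_sumr//; last exact: LA.
    apply: inner_le; [exact: LA|exact: LA|exact: pos_L2_sum|by []|].
    move=> x; rewrite ler_wpM2l//; first exact: average_ge0.
    by rewrite /F -mulr_suml ler_piMl//; have [] := Lf.
  have H3 : inner S S <= 2 * C * inner f H.
    apply: le_trans H1 _; under eq_bigr do rewrite big_split/=.
    rewrite big_split/= [X in C * (_ + X)]exchange_big/=.
    rewrite -mulr2n -[_ *+ 2]mulr_natl mulrA [C * _]mulrC.
    by apply: ler_wpM2l H2; rewrite mulr_ge0// ltW.
  apply: (le_trans H3).
  (* [H] is the linearized operator shifted by one scale. Its first n terms fall under the induction
     hypothesis, applied at [k0.+1] and to f itself instead of g; the last term is a single average,
     bounded by Schur's test. *)
  pose h (x : T) := \sum_(i < n) phi i x * average (k0.+1 + i) f x.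
  pose l (x : T) := phi n x * average (k0 + n).+1 f x.
  have Lh : pos_L2 h.
    apply: pos_L2_sum => i; exact: (LpA (widen_ord (leqnSn n) i)).
  have Ll : pos_L2 l by exact: (LpA ord_max).
  have HE : inner f H = inner f h + inner f l.
    rewrite innerC [inner f h]innerC [inner f l]innerC -innerDl//.
    apply: eq_Rintegral => x _; congr (_ * _).
    by rewrite /H big_ord_recr/=; congr (_ + _); apply: eq_bigr => i _; rewrite addSn.
  have hh : inner h h <= D * inner f f.
    apply: IH => // x; apply: le_trans (phi1 x).
    by rewrite big_ord_recr/= lerDl.
  have C2 : 0 < 2 * C by rewrite mulr_gt0.
  have B1 := inner_young C2 Lf Lh.
  have B2 : inner f l <= (inner f f + c0 ^+ 2 * inner f f) / 2.
    have LAf := LA (k0 + n).+1 f Lf.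
    apply: (@le_trans _ _ (inner f (average (k0 + n).+1 f))).
      apply: (inner_le Lf Lf Ll LAf) => x; have [_ f0 _] := Lf.
      have A0 := average_ge0 (k0 + n).+1 x Lf.
      have /andP[_ p1] := phi01 ord_max x.
      exact: ler_wpM2l (f0 x) _ _ (ler_piMl A0 p1).
    have := inner_young ltr01 Lf LAf; rewrite invr1 !mul1r => /le_trans; apply.
    by rewrite ler_pM2r ?invr_gt0// lerD2l inner_average.
  rewrite HE.
  have B1' : inner f h <= (2 * C * inner f f + (2 * C)^-1 * (D * inner f f)) / 2.
    apply: le_trans B1 _; rewrite ler_pM2r ?invr_gt0// lerD2l ler_pM2l// invr_gt0//.
  apply: (@le_trans _ _ (2 * C * ((2 * C * inner f f + (2 * C)^-1 * (D * inner f f)) / 2 +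
     (inner f f + c0 ^+ 2 * inner f f) / 2))).
    by rewrite ler_pM2l// lerD.
  rewrite le_eqVlt; apply/orP; left; apply/eqP; rewrite /D /maximal_const.
  by field; rewrite gt_eqF.
(* Weight D^-1 in Young's inequality for (S, g) leaves half of (f, f) on the right, where it is
   absorbed. *)
have Di : 0 < D^-1 by rewrite invr_gt0.
have := inner_young Di LS Lg; rewrite -E1 invrK => B.
have : D^-1 * inner S S <= inner f f by rewrite mulrC ler_pdivrMr// mulrC.
lra.
Qed.

Fixpoint max_average n k0 g x : R :=
  if n is n'.+1 then Num.max (max_average n' k0 g x) (average (k0 + n) g x)
  else average k0 g x.

Lemma average_le_max n k0 g x i : (i <= n)%N ->
  average (k0 + i) g x <= max_average n k0 g x.
Proof.
elim: n => [|n IH] /=; first by rewrite leqn0 => /eqP ->; rewrite addn0.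
rewrite leq_eqVlt ltnS le_max => /orP[/eqP->|/IH ->//].
by rewrite lexx orbT.
Qed.

(** Linearization of the maximum: phi_i is the indicator of the set where scale i is the first to
    attain it. A new scale takes over, through [c], exactly where it is strictly larger. *)
Lemma max_averageP n k0 g : pos_L2 g -> exists phi : nat -> T -> R,
  [/\ (forall i, measurable_fun setT (phi i)), (forall i x, 0 <= phi i x),
      (forall x, \sum_(i < n.+1) phi i x <= 1),
      measurable_fun setT (max_average n k0 g) &
      (forall x, max_average n k0 g x = \sum_(i < n.+1) phi i x * average (k0 + i) g x)].
Proof.
move=> Lg; elim: n => [|n [phi [mphi phi0 phi1 mM ME]]].
  exists (fun _ _ => 1); split => //.
  - by move=> x; rewrite big_ord_recl big_ord0 addr0.
  - exact: measurable_average.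
  - by move=> x; rewrite big_ord_recl big_ord0 addr0 mul1r addn0.
pose c (x : T) : R := (max_average n k0 g x < average (k0 + n.+1) g x)%R%:R.
have mA := measurable_average (k0 + n.+1) Lg.
have mc : measurable_fun setT c.
  have mb := measurable_fun_ltr mM mA.
  rewrite (_ : c = fun x => if max_average n k0 g x < average (k0 + n.+1) g x then 1 else 0).
    exact: measurable_fun_ifT.
  by apply/funext => x; rewrite /c; case: ifP.
have c01 x : 0 <= c x <= 1 by rewrite /c; case: (_ < _); rewrite ?lexx ?ler01.
exists (fun i x => if i == n.+1 then c x else (1 - c x) * phi i x); split.
- move=> i; case: (i == n.+1) => //; apply: measurable_funM => //.
  by apply: measurable_funB => //; exact: measurable_cst.
- move=> i x; have /andP[c0' c1] := c01 x.
  by case: ifP => // _; rewrite mulr_ge0 ?subr_ge0.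
- move=> x; rewrite big_ord_recr/= eqxx.
  rewrite (eq_bigr (fun i : 'I_n.+1 => (1 - c x) * phi i x)); last first.
    by move=> i _; rewrite ltn_eqF.
  rewrite -mulr_sumr; have /andP[c0' c1] := c01 x.
  have : (1 - c x) * \sum_(i < n.+1) phi i x <= (1 - c x) * 1.
    by rewrite ler_wpM2l ?subr_ge0.
  by lra.
- exact: measurable_maxr.
- move=> x; rewrite big_ord_recr/= eqxx.
  rewrite (eq_bigr (fun i : 'I_n.+1 => (1 - c x) * (phi i x * average (k0 + i) g x))); last first.
    by move=> i _; rewrite ltn_eqF// mulrA.
  rewrite -mulr_sumr -ME /c /Num.max /Order.max; case: ifP => _.
    by rewrite subrr mul0r add0r mul1r.
  by rewrite subr0 mul1r mul0r addr0.
Qed.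

Lemma max_average_L2 n k0 g : pos_L2 g ->
  pos_L2 (max_average n k0 g) /\
  inner (max_average n k0 g) (max_average n k0 g) <= maximal_const * inner g g.
Proof.
move=> Lg; have [phi [mphi phi0 phi1 mM ME]] := max_averageP n k0 Lg.
have E : max_average n k0 g = fun x => \sum_(i < n.+1) phi i x * average (k0 + i) g x.
  by apply/funext => x; rewrite ME.
split; last by rewrite E; exact: linearized_maximal.
rewrite E; apply: pos_L2_sum => i; apply: pos_L2_weight => //; last exact: average_pos_L2.
move=> x; rewrite phi0/=; apply: le_trans (phi1 x).
by rewrite (bigD1 i)//= lerDl sumr_ge0.
Qed.

End averaging.

(** * The Hardy-Littlewood-Sobolev inequality *)

Section dyadic.
Context {R : realType}.

(* [min r (t ^+ 2 / r)] is dominated by the increment from [r] to [2 * r] of the bounded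
   function [psi] of the proof, so that the sum telescopes. *)
Lemma dyadic_telescope (s t : R) (h : R -> R) n : 0 < s -> 0 < t ->
  (forall r, 0 < r -> r <= t -> h r <= r) ->
  (forall r, t < r -> h r <= t ^+ 2 / r) ->
  \sum_(i < n) h (s * 2 ^+ i) <= 4 * t.
Proof.
move=> s0 t0 h1 h2.
pose psi r := if r <= t then r else 4 * t - 2 * t ^+ 2 / r.
have psi4 r : 0 < r -> psi r <= 4 * t.
  move=> r0; rewrite /psi; case: ifP => [rt|_]; first by lra.
  by rewrite gerDl oppr_le0 divr_ge0 ?(ltW r0)// mulr_ge0// sqr_ge0.
have r0 i : 0 < s * 2 ^+ i by rewrite mulr_gt0// exprn_gt0.
suff H : \sum_(i < n) h (s * 2 ^+ i) <= psi (s * 2 ^+ n).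
  exact: le_trans H (psi4 _ (r0 n)).
elim: n => [|n IH].
  rewrite big_ord0 expr0 mulr1 /psi; case: ifP => [_|/negbT]; first exact: ltW.
  rewrite -ltNge => ts; rewrite subr_ge0 ler_pdivrMr//.
  by rewrite expr2; nra.
rewrite big_ord_recr/=.
have := r0 n; set r := s * 2 ^+ n in IH * => rp.
have -> : s * 2 ^+ n.+1 = 2 * r by rewrite exprS /r mulrCA.
suff : psi r + h r <= psi (2 * r) by move: IH; lra.
rewrite /psi; have [rt|tr] := leP r t.
  have := h1 r rp rt; have [_|t2r] := leP (2 * r) t; first by lra.
  have E : 2 * t ^+ 2 / (2 * r) <= 2 * t.
    by rewrite ler_pdivrMr ?mulr_gt0// expr2; nra.
  by lra.
have -> : (2 * r <= t) = false by apply/negbTE; rewrite -ltNge; lra.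
have := h2 r tr.
have -> : 2 * t ^+ 2 / (2 * r) = t ^+ 2 / r by field; rewrite gt_eqF.
have -> : 2 * t ^+ 2 / r = 2 * (t ^+ 2 / r) by rewrite mulrA.
by lra.
Qed.

(** Hedberg's optimization. The bounds v <= A and v^2 r^5 <= B meet at the radius t with t^5 = B /
    A^2; the sum is then at most 4 A t, whose fifth power is 4^5 A^3 B. The degenerate cases A = 0
    and B = 0, in which t is not positive or not defined, force v = 0. *)
Lemma dyadic_sum (s A B : R) (v : nat -> R) n : 0 < s -> 0 <= A -> 0 <= B ->
  (forall i, (i < n)%N -> 0 <= v i <= A) ->
  (forall i, (i < n)%N -> v i ^+ 2 * (s * 2 ^+ i) ^+ 5 <= B) ->
  (\sum_(i < n) s * 2 ^+ i * v i) ^+ 5 <= 4 ^+ 5 * A ^+ 3 * B.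
Proof.
move=> s0 A0 B0 vA vB.
have r0 i : 0 < s * 2 ^+ i by rewrite mulr_gt0// exprn_gt0.
have Z : (forall i, (i < n)%N -> v i = 0) ->
    (\sum_(i < n) s * 2 ^+ i * v i) ^+ 5 <= 4 ^+ 5 * A ^+ 3 * B.
  move=> v0; rewrite big1 => [|i _]; last by rewrite v0// mulr0.
  by rewrite expr0n/= !mulr_ge0// exprn_ge0.
move: A0; rewrite le_eqVlt => /orP[/eqP A0|A0].
  by apply: Z => i /vA; rewrite -A0 => vi; apply/eqP; rewrite eq_le andbC.
move: B0; rewrite le_eqVlt => /orP[/eqP B0|B0].
  apply: Z => i /vB; rewrite -B0 => vi.
  have : v i ^+ 2 <= 0 by move: vi; rewrite pmulr_lle0// exprn_gt0.
  by move=> v2; apply/eqP; rewrite -sqrf_eq0 eq_le v2 sqr_ge0.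
pose t := (B / A ^+ 2) `^ (5^-1).
have q0 : 0 < B / A ^+ 2 by rewrite divr_gt0// exprn_gt0.
have t0 : 0 < t by exact: powR_gt0.
have t5 : t ^+ 5 = B / A ^+ 2.
  by rewrite -powR_mulrn ?(ltW t0)// /t -powRrM mulVf// powRr1// ltW.
pose h (r : R) := if r <= t then r else t ^+ 2 / r.
have H : \sum_(i < n) s * 2 ^+ i * v i <= A * \sum_(i < n) h (s * 2 ^+ i).
  rewrite mulr_sumr; apply: ler_sum => i _.
  have /andP[vi0 viA] := vA i (ltn_ord i).
  rewrite /h; case: ifP => [_|/negbT]; first by rewrite mulrC ler_pM2r.
  rewrite -ltNge; set r := s * 2 ^+ i => tr.
  have rp : 0 < r := r0 i.
  (* The decay available is (t/r)^(5/2); since t/r <= 1 it may be weakened to the integer exponent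
     2, which still gives a summable r (t/r)^2 = t^2 / r. *)
  suff : v i <= A * (t / r) ^+ 2.
    move=> vt; have -> : A * (t ^+ 2 / r) = r * (A * (t / r) ^+ 2).
      by field; rewrite gt_eqF.
    by rewrite ler_pM2l.
  have tr0 : 0 <= t / r by rewrite divr_ge0// ltW.
  have tr1 : t / r <= 1 by rewrite ler_pdivrMr// mul1r ltW.
  have A2 : 0 <= A * (t / r) ^+ 2 by rewrite mulr_ge0 ?sqr_ge0// ltW.
  rewrite -ler_sqr ?nnegrE//.
  have : v i ^+ 2 <= A ^+ 2 * (t / r) ^+ 5.
    rewrite expr_div_n t5 mulrA ler_pdivlMr ?exprn_gt0//.
    apply: le_trans (vB i (ltn_ord i)) _.
    by rewrite le_eqVlt; apply/orP; left; apply/eqP; field; rewrite gt_eqF.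
  move=> /le_trans; apply; rewrite [leRHS]exprMn ler_pM2l ?exprn_gt0//.
  by rewrite -exprM [leLHS]exprSr ler_piMr// exprn_ge0.
have H2 : \sum_(i < n) h (s * 2 ^+ i) <= 4 * t.
  apply: dyadic_telescope => // q; rewrite /h; first by move=> _ ->.
  by move=> tq; rewrite (leNgt q t) tq.
have S0 : 0 <= \sum_(i < n) s * 2 ^+ i * v i.
  by apply: sumr_ge0 => i _; rewrite mulr_ge0 ?(ltW (r0 i))//; have /andP[] := vA i (ltn_ord i).
have : \sum_(i < n) s * 2 ^+ i * v i <= A * (4 * t).
  by apply: le_trans H _; rewrite ler_pM2l.
move=> /(lerXn2r 5); rewrite !nnegrE => /(_ S0 _)/le_trans; apply.
  by rewrite mulr_ge0 ?mulr_ge0 ?(ltW t0) ?(ltW A0).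
rewrite exprMn exprMn t5 le_eqVlt; apply/orP; left; apply/eqP.
by field; rewrite gt_eqF.
Qed.

End dyadic.

(** * Averages over dyadic cubes *)

Section cube.
Context {R : realType}.
Notation mR := (measurableTypeR R).
Notation leb := (@lebesgue_measure R).
Notation X := (R5 mR).
Implicit Types (x y z w : R5 R) (r : R).

(** Balls of the max norm are cubes. The height is r^-5 instead of the inverse volume (2 r)^-5,
    whence the mass 32. *)
Definition cube r w : R := if `|w| < r then (r ^+ 5)^-1 else 0.

Lemma cube_ge0 r w : 0 <= r -> 0 <= cube r w.
Proof. by move=> r0; rewrite /cube; case: ifP => // _; rewrite invr_ge0 exprn_ge0. Qed.

Lemma cube_le r w : 0 <= r -> cube r w <= (r ^+ 5)^-1.
Proof. by move=> r0; rewrite /cube; case: ifP => // _; rewrite invr_ge0 exprn_ge0. Qed.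

Lemma cubeN r w : cube r (- w) = cube r w.
Proof. by rewrite /cube normrN. Qed.

Lemma measurable5_cube r : measurable5 (cube r).
Proof.
rewrite /measurable5 /cube; apply: measurable_fun_ifT => //.
rewrite (_ : (fun w : X => `|w : R5 R| < r) = (fun w : X => (`|w : R5 R| : mR) < cst r w)) //.
apply: measurable_fun_ltr => //.
apply: continuous_measurable5; exact: norm_continuous.
Qed.

Lemma measurable_sub5 : measurable_fun [set: X * X] (fun p : X * X => (p.2 : R5 R) - p.1 : X).
Proof.
have m1 : measurable_fun [set: X * X] (fst : X * X -> X) := measurable_fst.
have m2 : measurable_fun [set: X * X] (snd : X * X -> X) := measurable_snd.
have cf d (A : measurableType d) d' (B : measurableType d') (f : X * X -> A * B) :
    measurable_fun setT f -> measurable_fun setT (fun p => (f p).1).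
  by move=> mf; exact: (measurableT_comp measurable_fst mf).
have cs d (A : measurableType d) d' (B : measurableType d') (f : X * X -> A * B) :
    measurable_fun setT f -> measurable_fun setT (fun p => (f p).2).
  by move=> mf; exact: (measurableT_comp measurable_snd mf).
have mB (f g : X * X -> mR) : measurable_fun setT f -> measurable_fun setT g ->
    measurable_fun setT (fun p => f p - g p : mR) by exact: measurable_funB.
apply: measurable_fun_pair; last by apply: (mB); apply: (cs).
apply: measurable_fun_pair; last by apply: (mB); apply: (cs); apply: (cf).
apply: measurable_fun_pair; last by apply: (mB); apply: (cs); do 2 apply: (cf).
apply: measurable_fun_pair; last by apply: (mB); apply: (cs); do 3 apply: (cf).
by apply: (mB); do 4 apply: (cf).
Qed.

Lemma leb5_ball r : 0 <= r -> (leb5 [set w : X | (`|w : R5 R| < r)%R] = ((2 * r) ^+ 5)%:E)%E.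
Proof.
move=> r0.
have pE d (A : measurableType d) (m : {sigma_finite_measure set A -> \bar R}) (U : set A) (V : set mR) :
    measurable U -> measurable V -> sigma_product m leb (U `*` V) = (m U * leb V)%E.
  by move=> mU mV; exact: product_measure1E.
pose B : set mR := ball (0 : R) r.
have mB : measurable B by exact: measurable_ball.
have lB : leb B = (2 * r)%:E by rewrite /B lebesgue_measure_ball// mulrC mulr_natr.
have -> : [set w : X | `|w : R5 R| < r] = B `*` B `*` B `*` B `*` B.
  apply/seteqP; split=> -[[[[a b] c] d] e]; rewrite /B /= !prod_normE/= !gt_max /ball/= !sub0r !normrN.
    by move=> /andP[/andP[/andP[/andP[-> ->] ->] ->] ->].
  by move=> [[[[-> ->] ->] ->] ->].
have m2 : measurable (B `*` B) by exact: measurableX.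
have m3 : measurable (B `*` B `*` B) by exact: measurableX.
have m4 : measurable (B `*` B `*` B `*` B) by exact: measurableX.
have E2 := pE _ _ leb _ _ mB mB.
have E3 := pE _ _ (sigma_product leb leb) _ _ m2 mB.
have E4 := pE _ _ (sigma_product (sigma_product leb leb) leb) _ _ m3 mB.
apply: (etrans (pE _ _ leb4 _ _ m4 mB)).
apply: (etrans (congr1 (fun u => (u * leb B)%E) E4)).
apply: (etrans (congr1 (fun u => (u * leb B * leb B)%E) E3)).
apply: (etrans (congr1 (fun u => (u * leb B * leb B * leb B)%E) E2)).
apply: (etrans (congr1 (fun u : \bar R => (u * u * u * u * u)%E) lB)).
rewrite -!EFinM; congr EFin; ring.
Qed.

Lemma integral_cube r x : 0 < r -> (\int[leb5]_y (cube r (y - x))%:E = 32%:E)%E.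
Proof.
move=> r0; have r00 := ltW r0.
have mc : measurable_fun setT (EFin \o cube r : X -> \bar R).
  by apply/measurable_EFinP; exact: measurable5_cube.
transitivity (\int[leb5]_y (cube r y)%:E)%E.
  rewrite -((measure_preserving_translate (- x)).2 (EFin \o cube r)) => //.
  - by apply: eq_integral => y _ /=; rewrite addrC.
  - by move=> y /=; rewrite lee_fin cube_ge0.
have mb : measurable [set w : X | `|w : R5 R| < r].
  have oB : open (ball (0 : R5 R) r) by exact: ball_open.
  have := open_preimage_measurable (@separable_measurable_R5 R) oB.
  rewrite (_ : _ @^-1` _ = [set w : X | `|w : R5 R| < r])//.
  by apply/seteqP; split => w; rewrite /= -ball_normE /= sub0r normrN.
rewrite (_ : (fun y : X => (cube r y)%:E) =
   (fun y => ((r ^+ 5)^-1)%:E * (\1_[set w : X | `|w : R5 R| < r] y)%:E)%E).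
  rewrite ge0_integralZl//.
  - have -> : (\int[leb5]_y (\1_[set w : X | (`|w : R5 R| < r)%R] y)%:E = ((2 * r) ^+ 5)%:E)%E.
      by rewrite integral_indic// setIT; exact: leb5_ball.
    by rewrite -EFinM; congr EFin; rewrite exprMn; field; rewrite gt_eqF.
  - by apply/measurable_EFinP; exact: measurable_indic.
  - by rewrite lee_fin invr_ge0 exprn_ge0.
apply/funext => y; rewrite -EFinM; congr EFin; rewrite /cube indicE.
case: ifPn => h; first by rewrite mem_set// mulr1.
by rewrite memNset ?mulr0//=; exact/negP.
Qed.

Definition cube_kernel (s : R) (i : nat) (x y : X) : R := cube (s * 2 ^+ i) ((y : R5 R) - x).

Variable s : R.
Hypothesis s0 : 0 < s.

Let r_gt0 i : 0 < s * 2 ^+ i. Proof. by rewrite mulr_gt0// exprn_gt0. Qed.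

Lemma measurable_cube_kernel i : measurable_fun [set: X * X] (fun p => cube_kernel s i p.1 p.2).
Proof. exact: (measurableT_comp (measurable5_cube _) measurable_sub5). Qed.

Lemma cube_kernel_ge0 i x y : 0 <= cube_kernel s i x y.
Proof. by apply: cube_ge0; exact: ltW. Qed.

Lemma cube_kernel_le i x y : cube_kernel s i x y <= ((s * 2 ^+ i) ^+ 5)^-1.
Proof. by apply: cube_le; exact: ltW. Qed.

Lemma cube_kernelC i x y : cube_kernel s i x y = cube_kernel s i y x.
Proof. by rewrite /cube_kernel -cubeN opprB. Qed.

Lemma integral_cube_kernel i x : (\int[leb5]_y (cube_kernel s i x y)%:E = 32%:E)%E.
Proof. exact: integral_cube. Qed.

(** If both factors are nonzero, then |z - x| is less than the sum of the two radii, hence less than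
    twice the larger one, the radius at j + 1. The height at j is 32 times the height at j + 1, and
    the kernel at scale i integrates to the other 32. *)
Lemma cube_kernel_conv i j x z : (i <= j)%N ->
  (\int[leb5]_y (cube_kernel s i x y * cube_kernel s j y z)%:E <=
   (32 * 32 * cube_kernel s j.+1 x z)%:E)%E.
Proof.
move=> ij.
have mi : measurable_fun setT (cube_kernel s i x).
  exact: (measurableT_comp (measurable_cube_kernel i) (measurable_pair1 (x : X))).
have mj : measurable_fun setT (fun y => cube_kernel s j y z).
  exact: (measurableT_comp (measurable_cube_kernel j) (measurable_pair2 (z : X))).
have c0 : 0 <= 32 * cube_kernel s j.+1 x z by rewrite mulr_ge0// cube_kernel_ge0.
apply: (@le_trans _ _ (\int[leb5]_y ((32 * cube_kernel s j.+1 x z)%:E * (cube_kernel s i x y)%:E))%E).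
  apply: ge0_le_integral => //.
  - by move=> y _; rewrite lee_fin mulr_ge0 ?cube_kernel_ge0.
  - by apply/measurable_EFinP; exact: measurable_funM.
  - by apply: measurable_funeM; exact/measurable_EFinP.
  - move=> y _; rewrite -EFinM lee_fin mulrC.
    rewrite {2 4}/cube_kernel /cube; case: ifPn => xy; last by rewrite !mulr0.
    apply: ler_wpM2r; first by rewrite invr_ge0 exprn_ge0// ltW.
    rewrite /cube_kernel /cube; case: ifPn => yz; last by rewrite c0.
    have xz : `|(z : R5 R) - x| < s * 2 ^+ j.+1.
      have -> : (z : R5 R) - x = (z - y) + (y - x) by rewrite addrA subrK.
      apply: le_lt_trans (ler_normD _ _) _; rewrite exprS mulrCA mulr2n mulrDl !mul1r.
      apply: ltr_leD => //; apply: (le_trans (ltW xy)).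
      by rewrite ler_pM2l// ler_weXn2l// ler1n.
    have E : (s * 2 ^+ j.+1) ^+ 5 = 32 * (s * 2 ^+ j) ^+ 5 by rewrite (exprS 2); ring.
    by rewrite xz E [(32 * _)^-1]invfM mulVKf.
rewrite ge0_integralZl//.
- by rewrite integral_cube_kernel -EFinM lee_fin mulrAC.
- exact/measurable_EFinP.
- by move=> y _; rewrite lee_fin cube_kernel_ge0.
Qed.

End cube.

Section hls.
Context {R : realType}.
Notation mR := (measurableTypeR R).
Notation X := (R5 mR).
Implicit Types (g u : X -> R) (x y : X).

Definition riesz g x := (\int[leb5]_y (g y / enorm5 ((y : R5 R) - x) ^+ 4)%:E)%E.

Definition scale (N : nat) : R := (2 ^+ N)^-1.

(** Cut near 0 and near infinity in the max norm, so that the radii 2^-N 2^i with i <= 2 N suffice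
    to dominate it. *)
Definition trunc (N : nat) (w : R5 R) : R :=
  if (scale N <= `|w|) && (`|w| < 2 ^+ N) then (enorm5 w ^+ 4)^-1 else 0.

Lemma scale_gt0 N : 0 < scale N. Proof. by rewrite invr_gt0 exprn_gt0. Qed.

Let radius N i := scale N * 2 ^+ i.
Let radius_gt0 N i : 0 < radius N i. Proof. by rewrite mulr_gt0 ?scale_gt0 ?exprn_gt0. Qed.

Lemma trunc_ge0 N w : 0 <= trunc N w.
Proof. by rewrite /trunc; case: ifP => // _; rewrite invr_ge0 exprn_ge0 ?enorm5_ge0. Qed.

Lemma measurable5_trunc N : measurable5 (trunc N).
Proof.
have mn : measurable5 (fun w : R5 R => `|w|) by exact: (continuous_measurable5 (@norm_continuous _ (R5 R))).
have ml : measurable_fun [set: X] (fun w : X => scale N <= `|w : R5 R|).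
  exact: (measurable_fun_ler (measurable_cst (scale N : mR)) mn).
have mu : measurable_fun [set: X] (fun w : X => `|w : R5 R| < 2 ^+ N).
  exact: (measurable_fun_ltr mn (measurable_cst (2 ^+ N : mR))).
apply: measurable_fun_ifT => //; last exact: measurable5_enormV.
exact: measurable_and.
Qed.

Lemma trunc_nd N N' w : (N <= N')%N -> trunc N w <= trunc N' w.
Proof.
move=> NN'; rewrite {1}/trunc; case: ifP => [/andP[h1 h2]|_]; last exact: trunc_ge0.
have le2 : 2 ^+ N <= 2 ^+ N' :> R by rewrite ler_weXn2l// ler1n.
rewrite /trunc (le_trans _ h1) ?(lt_le_trans h2)//.
by rewrite /scale lef_pV2 ?posrE ?exprn_gt0.
Qed.

Lemma trunc_near w : \forall N \near \oo, trunc N w = (enorm5 w ^+ 4)^-1.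
Proof.
have [->|w0] := eqVneq w 0.
  (* At the origin both sides are 0, the inverse of 0 being 0; the convergence thus holds at every
     point. *)
  apply: nearW => N; rewrite /trunc normr0 leNgt scale_gt0/=.
  have /eqP -> : enorm5 (0 : R5 R) == 0 by rewrite enorm5_eq0.
  by rewrite expr0n/= invr0.
have w1 : 0 < `|w| by rewrite normr_gt0.
pose M := Num.bound (`|w|^-1 + `|w|).
have MP : `|w|^-1 + `|w| < M%:R.
  by apply: archi_boundP; rewrite addr_ge0// invr_ge0.
have wi : 0 < `|w|^-1 by rewrite invr_gt0.
exists M => // N /= MN.
have N2 : M%:R < 2 ^+ N :> R.
  by rewrite -natrX ltr_nat (leq_ltn_trans MN)// ltn_expl.
rewrite /trunc ifT//; apply/andP; split; last by lra.
rewrite /scale -[leRHS]invrK lef_pV2 ?posrE ?exprn_gt0//; lra.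
Qed.

(** Take the least i with |w| < r_i. It exists below 2 N + 1 because r_(2N) = 2^N, and it is
    positive because |w| >= 2^-N. Minimality gives r_i <= 2 |w|, so |w|^-4 <= 16 r_i^-4, which is 16
    r_i times the height of that cube. *)
Lemma trunc_le_cubes N w :
  trunc N w <= \sum_(i < (N + N).+1) 16 * (radius N i * cube (radius N i) w).
Proof.
have p0 i : 0 <= 16 * (radius N i * cube (radius N i) w).
  have rr := ltW (radius_gt0 N i).
  by apply: mulr_ge0 => //; apply: mulr_ge0 => //; exact: cube_ge0.
rewrite /trunc; case: ifP => [/andP[h1 h2]|_]; last by apply: sumr_ge0 => i _; exact: p0.
have ex : exists i, `|w| < radius N i.
  by exists (N + N)%N; rewrite /radius exprD mulrA mulVf ?mul1r// gt_eqF// exprn_gt0.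
have [i wi imin] := ex_minnP ex.
have iN : (i < (N + N).+1)%N.
  by rewrite ltnS; apply: imin; rewrite /radius exprD mulrA mulVf ?mul1r// gt_eqF// exprn_gt0.
rewrite (bigD1 (Ordinal iN))//=; apply: ler_wpDr; first by apply: sumr_ge0 => j _; exact: p0.
have i0 : i = i.-1.+1.
  by case: i wi {imin iN} => //; rewrite /radius expr0 mulr1 ltNge h1.
have ri : radius N i <= 2 * `|w|.
  rewrite i0 /radius exprS mulrCA ler_pM2l//.
  have [//|h] := leP (scale N * 2 ^+ i.-1) `|w|.
  by have := imin _ h; rewrite {1}i0 ltnn.
rewrite /cube wi; have rp := radius_gt0 N i; set r := radius N i in rp ri *.
have w0 : 0 < `|w| := lt_le_trans (scale_gt0 N) h1.
have e0 : 0 < enorm5 w := lt_le_trans w0 (norm_le_enorm5 w).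
have -> : 16 * (r / r ^+ 5) = ((r / 2) ^+ 4)^-1 by field; rewrite gt_eqF.
rewrite lef_pV2 ?posrE ?exprn_gt0 ?divr_gt0//.
rewrite lerXn2r// ?nnegrE ?divr_ge0 ?(ltW rp) ?(ltW e0)//.
by apply: le_trans (norm_le_enorm5 w); rewrite ler_pdivrMr// mulrC.
Qed.

Let avg N i g x := average leb5 (cube_kernel (scale N)) i g x.
Let maxavg N g x := max_average leb5 (cube_kernel (scale N)) (N + N) 0 g x.

Let k1 N := measurable_cube_kernel (scale N).
Let k2 N := cube_kernel_ge0 (scale_gt0 N).
Let k3 N := cube_kernel_le (scale_gt0 N).
Let k4 N := cube_kernelC (scale N).
Let k5 N := integral_cube_kernel (scale_gt0 N).
Let k6 N := @cube_kernel_conv _ _ (scale_gt0 N).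
Let p32 : 0 < 32 :> R. Proof. by []. Qed.
Let p1024 : 0 < 32 * 32 :> R. Proof. by rewrite mulr_gt0. Qed.

Lemma avg_ge0 N i g x : pos_L2 leb5 g -> 0 <= avg N i g x.
Proof. exact: (average_ge0 (k1 N) (k2 N) (k3 N) (k5 N)). Qed.

Lemma avgE N i g x : pos_L2 leb5 g ->
  (avg N i g x)%:E = (\int[leb5]_y (cube_kernel (scale N) i x y * g y)%:E)%E.
Proof. exact: (averageE (k1 N) (k2 N) (k3 N) (k5 N)). Qed.

Lemma avg_sqr N i g x : pos_L2 leb5 g ->
  ((avg N i g x ^+ 2)%:E <= 32%:E * \int[leb5]_y (cube_kernel (scale N) i x y * g y ^+ 2)%:E)%E.
Proof. exact: (average_sqr p32 (k1 N) (k2 N) (k3 N) (k5 N)). Qed.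

Lemma maxavg_L2 N g : pos_L2 leb5 g ->
  pos_L2 leb5 (maxavg N g) /\
  inner leb5 (maxavg N g) (maxavg N g) <= maximal_const (32 : R) (32 * 32) * inner leb5 g g.
Proof.
exact: (max_average_L2 p32 p1024 (k1 N) (k2 N) (k3 N) (k4 N) (k5 N) (k6 N) (N + N) 0).
Qed.

Lemma avg_le_maxavg N i g x : (i <= N + N)%N -> avg N i g x <= maxavg N g x.
Proof. exact: (average_le_max leb5 (cube_kernel (scale N)) 0%N g x (n := (N + N)%N)). Qed.

(** Jensen followed by the height r^-5 of the kernel: the control of the large radii by the L^2
    norm. *)
Lemma avg_decay N i g x : pos_L2 leb5 g ->
  avg N i g x ^+ 2 * radius N i ^+ 5 <= 32 * inner leb5 g g.
Proof.
move=> Lg; have [mg g0 gi] := Lg; have r0 := radius_gt0 N i.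
have r5 : 0 < radius N i ^+ 5 by rewrite exprn_gt0.
rewrite -ler_pdivlMr// -lee_fin; apply: le_trans (avg_sqr N i x Lg) _.
rewrite -mulrA EFinM; apply: lee_wpmul2l => //.
have mk : measurable_fun setT (cube_kernel (scale N) i x).
  exact: (measurableT_comp (measurable_cube_kernel (scale N) i) (measurable_pair1 x)).
have k0 y : 0 <= cube_kernel (scale N) i x y by apply: cube_kernel_ge0; exact: scale_gt0.
apply: (@le_trans _ _ (\int[leb5]_y ((radius N i ^+ 5)^-1%:E * (g y * g y)%:E))%E).
  apply: ge0_le_integral => //.
  - by move=> y _; rewrite lee_fin mulr_ge0 ?sqr_ge0.
  - by apply/measurable_EFinP; apply: measurable_funM => //; exact: measurable_funX.
  - by apply: measurable_funeM; apply/measurable_EFinP; exact: measurable_funM.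
  - move=> y _; rewrite -EFinM lee_fin -expr2 ler_wpM2r ?sqr_ge0//.
rewrite ge0_integralZl//.
- by rewrite -innerE// -EFinM lee_fin mulrC.
- by apply/measurable_EFinP; exact: measurable_funM.
- by move=> y _; rewrite lee_fin mulr_ge0.
- by rewrite lee_fin invr_ge0 ltW.
Qed.

Let G0 g : pos_L2 leb5 g -> 0 <= inner leb5 g g.
Proof. by move=> Lg; exact: inner_ge0. Qed.

Lemma hedberg N g x B : pos_L2 leb5 g -> 0 <= B ->
  (forall i, (i <= N + N)%N -> avg N i g x <= B) ->
  (\sum_(i < (N + N).+1) radius N i * avg N i g x) ^+ 5 <=
  4 ^+ 5 * B ^+ 3 * (32 * inner leb5 g g).
Proof.
move=> Lg B0 aB.
apply: (@dyadic_sum R (scale N) B _ (fun i => avg N i g x)) => //.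
- exact: scale_gt0.
- by rewrite mulr_ge0// G0.
- by move=> i iN; rewrite avg_ge0//= aB.
- by move=> i iN; exact: avg_decay.
Qed.

Lemma truncated_potential N g x : pos_L2 leb5 g ->
  (\int[leb5]_y (g y * trunc N ((y : R5 R) - x))%:E <=
   (16 * \sum_(i < (N + N).+1) radius N i * avg N i g x)%:E)%E.
Proof.
move=> Lg; have [mg g0 _] := Lg.
have mt : measurable_fun [set: X] (fun y : X => trunc N ((y : R5 R) - x)).
  exact: (measurableT_comp (measurable5_trunc N)
    (measurableT_comp measurable_sub5 (measurable_pair1 x))).
have mk i : measurable_fun [set: X] (cube_kernel (scale N) i x).
  exact: (measurableT_comp (k1 N i) (measurable_pair1 x)).
have rr i : 0 <= 16 * radius N i by rewrite mulr_ge0// ltW.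
pose F (i : 'I_(N + N).+1) (y : X) : \bar R :=
  ((16 * radius N i)%:E * (cube_kernel (scale N) i x y * g y)%:E)%E.
have mF i : measurable_fun setT (F i).
  by apply: measurable_funeM; apply/measurable_EFinP; exact: measurable_funM.
have F0 i y : (0 <= F i y)%E.
  by rewrite /F -EFinM lee_fin mulr_ge0// mulr_ge0//; exact: k2.
apply: (@le_trans _ _ (\int[leb5]_y \sum_(i < (N + N).+1) F i y)%E).
  apply: ge0_le_integral => //.
  - by move=> y _; rewrite lee_fin mulr_ge0// trunc_ge0.
  - by apply/measurable_EFinP; exact: measurable_funM.
  - exact: emeasurable_sum.
  - move=> y _; rewrite /F.
    under eq_bigr do rewrite -EFinM.
    rewrite sumEFin lee_fin.
    rewrite (eq_bigr (fun i : 'I_(N + N).+1 =>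
        g y * (16 * (radius N i * cube (radius N i) ((y : R5 R) - x))))); last first.
      by move=> i _; rewrite /cube_kernel -/(radius N i); ring.
    rewrite -mulr_sumr ler_wpM2l//.
    exact: trunc_le_cubes.
rewrite ge0_integral_sum//.
rewrite mulr_sumr -sumEFin; apply: lee_sum => i _.
rewrite /F ge0_integralZl//.
- by rewrite -avgE// -EFinM lee_fin mulrA.
- by apply/measurable_EFinP; exact: measurable_funM.
- by move=> y _; rewrite lee_fin mulr_ge0//; exact: k2.
- by rewrite lee_fin.
Qed.

Lemma riesz_le g x B : pos_L2 leb5 g ->
  (forall N, (\int[leb5]_y (g y * trunc N ((y : R5 R) - x))%:E <= B)%E) ->
  (riesz g x <= B)%E.
Proof.
move=> Lg gB; have [mg g0 _] := Lg.
have mt N : measurable_fun [set: X] (fun y : X => trunc N ((y : R5 R) - x)).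
  exact: (measurableT_comp (measurable5_trunc N)
    (measurableT_comp measurable_sub5 (measurable_pair1 x))).
pose f N (y : X) := (g y * trunc N ((y : R5 R) - x))%:E.
have mf N : measurable_fun setT (f N) by apply/measurable_EFinP; exact: measurable_funM.
have f0 N y : [set: X] y -> (0 <= f N y)%E by move=> _; rewrite lee_fin mulr_ge0 ?trunc_ge0.
have fnd y : [set: X] y -> {homo f^~ y : n m / (n <= m)%N >-> (n <= m)%E}.
  by move=> _ n m nm; rewrite /f lee_fin ler_wpM2l// trunc_nd.
have cvg := @cvg_monotone_convergence _ _ _ leb5 _ measurableT f mf f0 fnd.
have <- : (\int[leb5]_y (limn (f^~ y)) = riesz g x)%E.
  apply: eq_integral => y _; apply/cvg_lim => //.
  apply: cvg_near_cst; have [M _ MP] := trunc_near ((y : R5 R) - x).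
  by exists M => // n /= /MP E; rewrite /f E.
rewrite -(cvg_lim _ cvg)//; apply: lime_le; last exact: nearW.
by apply/cvg_ex; eexists; exact: cvg.
Qed.

Lemma maxavg_ge0 N g x : pos_L2 leb5 g -> 0 <= maxavg N g x.
Proof. by move=> /(maxavg_L2 N)[[]]. Qed.

(** A larger N refines and extends the grid of radii without moving the old ones: index i at level N
    becomes i + (N' - N). Monotone convergence in [hls] needs this. *)
Lemma maxavg_nd N N' g x : pos_L2 leb5 g -> (N <= N')%N -> maxavg N g x <= maxavg N' g x.
Proof.
move=> Lg NN'.
have H n : (n <= N + N)%N ->
    max_average leb5 (cube_kernel (scale N)) n 0 g x <= maxavg N' g x.
  have E i : (i <= N + N)%N -> avg N i g x <= maxavg N' g x.
    move=> iN; have rE : scale N * 2 ^+ i = scale N' * 2 ^+ (i + (N' - N)).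
      have E : 2 ^+ N' = 2 ^+ (N' - N) * 2 ^+ N :> R by rewrite -exprD subnK.
      by rewrite /scale exprD E; field; rewrite !expf_neq0.
    have -> : avg N i g x = avg N' (i + (N' - N)) g x.
      by rewrite /avg /average /cube_kernel rE.
    by apply: avg_le_maxavg; lia.
  elim: n => [|n IH] nN /=; first exact: (E 0%N).
  by rewrite ge_max IH ?(ltnW nN)//=; exact: (E n.+1).
exact: H.
Qed.

Definition riesz_const : R := 16 ^+ 5 * (4 ^+ 5 * 32).

Lemma riesz_const_gt0 : 0 < riesz_const.
Proof. by rewrite /riesz_const !mulr_gt0// exprn_gt0. Qed.

Lemma truncated_potential_pow N g x B : pos_L2 leb5 g -> 0 <= B -> maxavg N g x <= B ->
  (\int[leb5]_y (g y * trunc N ((y : R5 R) - x))%:E <=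
   ((riesz_const * B ^+ 3 * inner leb5 g g) `^ 5^-1)%:E)%E.
Proof.
move=> Lg B0 aB; apply: le_trans (truncated_potential N x Lg) _; rewrite lee_fin.
have H : (\sum_(i < (N + N).+1) radius N i * avg N i g x) ^+ 5 <=
    4 ^+ 5 * B ^+ 3 * (32 * inner leb5 g g).
  apply: hedberg => // i iN; apply: le_trans aB; exact: avg_le_maxavg.
have S0 : 0 <= \sum_(i < (N + N).+1) radius N i * avg N i g x.
  by apply: sumr_ge0 => i _; apply: mulr_ge0; [exact: ltW|exact: avg_ge0].
set S := \sum_(i < _) _ in H S0 *.
have S16 : 0 <= 16 * S by rewrite mulr_ge0.
have -> : 16 * S = ((16 * S) ^+ 5) `^ 5^-1.
  by rewrite -powR_mulrn// -powRrM mulfV// powRr1.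
apply: ge0_ler_powR; rewrite ?nnegrE ?invr_ge0 ?exprn_ge0//.
  by rewrite !mulr_ge0 ?exprn_ge0 ?G0// ltW// riesz_const_gt0.
rewrite exprMn /riesz_const.
apply: (@le_trans _ _ (16 ^+ 5 * (4 ^+ 5 * B ^+ 3 * (32 * inner leb5 g g)))).
  by rewrite ler_pM2l// exprn_gt0.
by rewrite le_eqVlt; apply/orP; left; apply/eqP; set q := inner _ _ _; ring.
Qed.

Lemma riesz_pow g x B : pos_L2 leb5 g -> 0 <= B -> (forall N, maxavg N g x <= B) ->
  (riesz g x <= ((riesz_const * B ^+ 3 * inner leb5 g g) `^ 5^-1)%:E)%E.
Proof. by move=> Lg B0 aB; apply: riesz_le => // N; exact: truncated_potential_pow. Qed.

(** All averages of g are at most 32 b, so the pointwise Hedberg bound is uniform in x. This also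
    provides the local integrability of |w|^-4 later on, without polar coordinates. *)
Lemma riesz_bounded g b : pos_L2 leb5 g -> (forall y, g y <= b) ->
  exists M, forall x, (riesz g x <= M%:E)%E.
Proof.
move=> Lg gb; have [mg g0 _] := Lg.
have b0 : 0 <= b by apply: le_trans (g0 0) (gb 0).
have aB N i x : avg N i g x <= b * 32.
  have mk : measurable_fun [set: X] (cube_kernel (scale N) i x).
    exact: (measurableT_comp (k1 N i) (measurable_pair1 x)).
  rewrite -lee_fin avgE// EFinM -(k5 N i x) -ge0_integralZl//; last 2 first.
  - exact/measurable_EFinP.
  - by move=> y _; rewrite lee_fin; exact: k2.
  apply: ge0_le_integral => //.
  - by move=> y _; rewrite lee_fin mulr_ge0//; exact: k2.
  - by apply/measurable_EFinP; exact: measurable_funM.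
  - by apply: measurable_funeM; exact/measurable_EFinP.
  - by move=> y _; rewrite -EFinM lee_fin mulrC ler_wpM2r//; exact: k2.
exists ((riesz_const * (b * 32) ^+ 3 * inner leb5 g g) `^ 5^-1) => x.
apply: riesz_pow => //; first by rewrite mulr_ge0.
move=> N; rewrite /maxavg; elim: (N + N)%N => [|n IH] /=; first exact: (aB N 0%N).
by rewrite ge_max IH/=; exact: (aB N n.+1).
Qed.

Definition hls_const : R := riesz_const `^ (2 / 3) * maximal_const (32 : R) (32 * 32).

Lemma hls_const_gt0 : 0 < hls_const.
Proof. by rewrite mulr_gt0 ?powR_gt0 ?riesz_const_gt0 ?maximal_const_gt0. Qed.

(** Raising [riesz_pow] to the power 10/3 turns B^(3/5) into B^2, where B^2 = [F x] is the limit of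
    the squared maximal functions, with integral at most a multiple of G = (g, g). The powers
    G^(2/3) and G combine into G^(5/3). The potential is extended-valued, so the estimate is stated
    for real minorants [u]. *)
Lemma hls g u : pos_L2 leb5 g -> measurable_fun setT (u : X -> mR) -> (forall x, 0 <= u x) ->
  (forall x, ((u x)%:E <= riesz g x)%E) ->
  (\int[leb5]_x (u x `^ (10 / 3))%:E <= (hls_const * inner leb5 g g `^ (5 / 3))%:E)%E.
Proof.
move=> Lg mu u0 uJ; have [mg g0 _] := Lg.
set G := inner leb5 g g; have GG : 0 <= G := G0 Lg.
have LM N : pos_L2 leb5 (maxavg N g) by have [] := maxavg_L2 N Lg.
pose f N (x : X) : \bar R := (maxavg N g x ^+ 2)%:E.
have mf N : measurable_fun setT (f N).
  by have [mM _ _] := LM N; apply/measurable_EFinP; exact: measurable_funX.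
have f0 N x : [set: X] x -> (0 <= f N x)%E by move=> _; rewrite lee_fin sqr_ge0.
have fnd x : [set: X] x -> {homo f^~ x : n m / (n <= m)%N >-> (n <= m)%E}.
  move=> _ n m nm; rewrite /f lee_fin lerXn2r ?nnegrE ?maxavg_ge0//.
  exact: maxavg_nd.
pose F (x : X) := limn (f^~ x).
have cF x : f^~ x @ \oo --> ereal_sup (range (f^~ x)).
  by apply: ereal_nondecreasing_cvgn; exact: (fnd x I).
have FE x : F x = ereal_sup (range (f^~ x)) by exact/cvg_lim.
have mF : measurable_fun setT F.
  apply: (emeasurable_fun_cvg f) => // x _; rewrite FE; exact: cF.
have F0 x : (0 <= F x)%E.
  by rewrite FE; apply: ereal_sup_ge; exists (f 0%N x); [exists 0%N|exact: f0].
have IF : (\int[leb5]_x F x <= (maximal_const (32 : R) (32 * 32) * G)%:E)%E.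
  have cvg := @cvg_monotone_convergence _ _ _ leb5 _ measurableT f mf f0 fnd.
  rewrite -(cvg_lim _ cvg)//; apply: lime_le.
    by apply/cvg_ex; eexists; exact: cvg.
  apply: nearW => N; have [LMN MN] := maxavg_L2 N Lg.
  rewrite -lee_fin innerE// in MN; apply: le_trans MN.
pose c := (riesz_const * G) `^ (2 / 3).
have c0 : 0 <= c := powR_ge0 _ _.
have P x : ((u x `^ (10 / 3))%:E <= c%:E * F x)%E.
  (* For G = 0 the factor [c] is 0 and the right-hand side is 0 even where [F] is infinite; but then
     all truncated potentials vanish, and so does [u]. *)
  have [G00|Gn0] := eqVneq G 0.
    have : ((u x)%:E <= 0)%E.
      apply: le_trans (uJ x) _; apply: riesz_le => // N.
      have := truncated_potential_pow Lg (maxavg_ge0 N x Lg) (lexx _).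
      by rewrite -/G G00 mulr0 powR0 ?invr_eq0.
    rewrite lee_fin => ux0; have -> : u x = 0 by apply/eqP; rewrite eq_le ux0 u0.
    by rewrite powR0 ?mulf_neq0 ?invr_eq0// mule_ge0 ?lee_fin.
  have Gp : 0 < G by rewrite lt_neqAle eq_sym Gn0.
  have cp : 0 < c by rewrite powR_gt0// mulr_gt0// riesz_const_gt0.
  have [Foo|Ffin] := eqVneq (F x) +oo%E.
    by rewrite Foo gt0_muley ?leey// lte_fin.
  have Ff : F x \is a fin_num by rewrite ge0_fin_numE// ltey.
  rewrite -(fineK Ff) -EFinM lee_fin; set m := fine (F x).
  have m0 : 0 <= m by exact: fine_ge0.
  pose B := Num.sqrt m.
  have B0 : 0 <= B := sqrtr_ge0 _.
  have MB N : maxavg N g x <= B.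
    rewrite -[leLHS]ger0_norm ?maxavg_ge0// -sqrtr_sqr ler_wsqrtr//.
    rewrite -lee_fin /m fineK// FE; apply: ereal_sup_ubound; by exists N.
  have := le_trans (uJ x) (riesz_pow Lg B0 MB); rewrite lee_fin -/G => H.
  have : u x `^ (10 / 3) <= ((riesz_const * B ^+ 3 * G) `^ 5^-1) `^ (10 / 3).
    by apply: ge0_ler_powR; rewrite ?nnegrE ?powR_ge0// divr_ge0.
  move=> /le_trans; apply.
  rewrite -powRrM (_ : 5^-1 * (10 / 3) = 2 / 3); last by field.
  rewrite mulrAC powRM ?mulr_ge0 ?exprn_ge0 ?(ltW riesz_const_gt0)// -/c.
  rewrite ler_pM2l// -powR_mulrn// -powRrM (_ : 3%:R * (2 / 3) = 2%:R); last by field.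
  by rewrite powR_mulrn// sqr_sqrtr.
apply: (@le_trans _ _ (\int[leb5]_x (c%:E * F x))%E).
  apply: ge0_le_integral => //.
  - by move=> x _; rewrite lee_fin powR_ge0.
  - apply/measurable_EFinP; exact: (measurableT_comp (measurable_powR (10 / 3)) mu).
  - exact: measurable_funeM.
rewrite ge0_integralZl//.
apply: le_trans (lee_wpmul2l _ IF) _; first by rewrite lee_fin.
rewrite -EFinM lee_fin /c /hls_const powRM ?(ltW riesz_const_gt0)//.
rewrite le_eqVlt; apply/orP; left; apply/eqP.
have -> : G `^ (5 / 3) = G `^ (2 / 3) * G.
  have [->|Gn0] := eqVneq G 0; first by rewrite powR0 ?mulr0// mulf_neq0 ?invr_eq0.
  rewrite (_ : 5 / 3 = 2 / 3 + 1); last by field.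
  by rewrite powRD ?powRr1//; apply/implyP.
by ring.
Qed.

End hls.

(** * The Poisson kernel integrals *)

Section power_integrals.
Context {R : realType}.
Notation mR := (measurableTypeR R).
Notation leb := (@lebesgue_measure R).
Implicit Types a l p s t : R.

Definition has_primitive p a l := exists F : R -> R,
  [/\ F 0 = 0, (forall t, is_derive t 1 F ((a + t ^+ 2) `^ (- p)))
    & F x @[x --> +oo] --> l].

Lemma addsqr_gt0 a t : 0 < a -> 0 < a + t ^+ 2.
Proof. by move=> a0; rewrite ltr_pwDl// sqr_ge0. Qed.

Lemma is_derive_addsqr_powR a s t : 0 < a ->
  is_derive t 1 (fun t : R => (a + t ^+ 2) `^ s) (2 * s * t * (a + t ^+ 2) `^ (s - 1)).
Proof.
move=> a0; have q0 := addsqr_gt0 t a0.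
have d1 : is_derive t 1 (fun t : R => a + t ^+ 2) (2 * t).
  by apply: is_derive_eq; rewrite /GRing.scale/=; ring.
have d2 := is_derive1_powR s q0.
rewrite (_ : 2 * s * t * _ = s * (a + t ^+ 2) `^ (s - 1) * (2 * t)); last by ring.
exact: (@is_derive1_comp _ (fun x => x `^ s) (fun t => a + t ^+ 2) t _ _ d2 d1).
Qed.

Lemma powRN_half_sqr (x : R) : 0 <= x -> (x `^ (- (1 / 2))) ^+ 2 = x^-1.
Proof.
by move=> x0; rewrite -powR_mulrn ?powR_ge0// -powRrM mulNr divfK// powR_inv1.
Qed.

(** The derivative of t (a + t^2)^(-p) is (1 - 2 p) (a + t^2)^(-p) + 2 p a (a + t^2)^(-p-1). For p
    >= 1 the boundary term t (a + t^2)^(-p) tends to 0. *)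
Lemma primitive_step p a l : 0 < a -> 1 <= p -> has_primitive p a l ->
  has_primitive (p + 1) a ((2 * p - 1) / (2 * p * a) * l).
Proof.
move=> a0 p1 [F [F00 dF Fl]].
have p0 : 0 < p by lra.
pose H t := (t * (a + t ^+ 2) `^ (- p) + (2 * p - 1) * F t) / (2 * p * a).
exists H; split.
- by rewrite /H F00 mul0r mulr0 addr0 mul0r.
- move=> t; have q0 := addsqr_gt0 t a0.
  have d1 := is_derive_addsqr_powR (- p) t a0.
  have d2 : is_derive t 1 (fun t => t * (a + t ^+ 2) `^ (- p))
      ((a + t ^+ 2) `^ (- p) - 2 * p * t ^+ 2 * (a + t ^+ 2) `^ (- p - 1)).
    apply: (is_derive_eq (is_deriveM (is_derive_id t 1) d1)).
    by rewrite /GRing.scale/=; ring.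
  rewrite /H; under eq_fun do rewrite mulrC.
  have d3 := is_deriveZ (2 * p * a)^-1 (is_deriveD d2 (is_deriveZ (2 * p - 1) (dF t))).
  apply: (is_derive_eq d3); rewrite /GRing.scale/=.
  have E : (a + t ^+ 2) `^ (- p) = (a + t ^+ 2) * (a + t ^+ 2) `^ (- p - 1).
    rewrite -{2}[a + t ^+ 2](powRr1 (ltW q0)) -powRD; last by apply/implyP => _; rewrite gt_eqF.
    by congr (_ `^ _); ring.
  rewrite E (_ : - (p + 1) = - p - 1); last by ring.
  set z := _ `^ _; field.
  by rewrite !gt_eqF.
- have Z : t * (a + t ^+ 2) `^ (- p) @[t --> +oo] --> (0 : R).
    apply: (@squeeze_cvgr _ _ _ _ (cst 0) (fun t : R => t^-1)).
    + near=> t.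
      have t1 : 1 <= t by near: t; exact: nbhs_pinfty_ge.
      have t0 : 0 < t by exact: lt_le_trans t1.
      rewrite /= mulr_ge0 ?powR_ge0 ?(ltW t0)//=.
      rewrite -[leRHS](_ : t * (t ^+ 2)^-1 = _); last by field; rewrite gt_eqF.
      rewrite ler_pM2l// powRN lef_pV2 ?posrE ?powR_gt0 ?exprn_gt0 ?addsqr_gt0//.
      apply: (@le_trans _ _ (a + t ^+ 2)); first by rewrite lerDr ltW.
      have h1 : 1 <= a + t ^+ 2.
        by rewrite -[leLHS]add0r lerD ?(ltW a0)// expr2 -[leLHS]mulr1 ler_pM.
      rewrite -{1}[a + t ^+ 2]powRr1; last by rewrite (le_trans _ h1).
      by rewrite ler_powR.
    + exact: cvg_cst.
    + apply: (iffRL (@gtr0_cvgV0 R _ (+oo%R) _ (fun t : R => t) _)); first exact: nbhs_pinfty_gt.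
      exact: cvg_id.
  rewrite (_ : _ * l = (0 + (2 * p - 1) * l) * (2 * p * a)^-1); last by ring.
  exact: (cvgM (cvgD Z (cvgM (cvg_cst (2 * p - 1)) Fl)) (cvg_cst (2 * p * a)^-1)).
Unshelve. all: by end_near. Qed.

Lemma primitive_one a : 0 < a -> has_primitive 1 a (pi / 2 * a `^ (- (1 / 2))).
Proof.
move=> a0; set k := a `^ (- (1 / 2)).
have k0 : 0 < k by exact: powR_gt0.
have k2 : k ^+ 2 = a^-1 by exact: powRN_half_sqr (ltW a0).
exists (fun t => k * atan (k * t)); split.
- by rewrite mulr0 atan0 mulr0.
- move=> t; have d1 : is_derive t 1 (fun t : R => k * t) k.
    by apply: is_derive_eq; rewrite /GRing.scale/=; ring.
  have d2 := is_derive1_comp (is_derive1_atan (k * t)) d1.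
  apply: (is_derive_eq (is_deriveZ k d2)); rewrite /GRing.scale/=.
  rewrite powRN powRr1 ?(ltW (addsqr_gt0 t a0))// exprMn k2.
  rewrite mulrCA -expr2 k2; field.
  by rewrite (gt_eqF a0) gt_eqF// addsqr_gt0.
- have A : atan (k * t) @[t --> +oo] --> pi / 2.
    apply: (cvg_comp _ _ _ (@cvgy_atan R)).
    exact: (gt0_cvgMry k0 cvg_id).
  rewrite mulrC; exact: (cvgM (cvg_cst k) A).
Qed.

Lemma primitive_three_half a : 0 < a -> has_primitive (3 / 2) a a^-1.
Proof.
move=> a0.
exists (fun t => a^-1 * (t * (a + t ^+ 2) `^ (- (1 / 2)))); split.
- by rewrite mul0r mulr0.
- move=> t; have q0 := addsqr_gt0 t a0.
  have d1 := is_derive_addsqr_powR (- (1 / 2)) t a0.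
  have d2 := is_deriveZ a^-1 (is_deriveM (is_derive_id t 1) d1).
  apply: (is_derive_eq d2); rewrite /GRing.scale/=.
  have E : (a + t ^+ 2) `^ (- (1 / 2)) = (a + t ^+ 2) * (a + t ^+ 2) `^ (- (3 / 2)).
    rewrite -{2}[a + t ^+ 2](powRr1 (ltW q0)) -powRD; last by apply/implyP => _; rewrite gt_eqF.
    by congr (_ `^ _); field.
  rewrite E (_ : - (1 / 2) - 1 = - (3 / 2)); last by field.
  by set z := _ `^ _; field; rewrite gt_eqF.
- have Z : t * (a + t ^+ 2) `^ (- (1 / 2)) @[t --> +oo] --> (1 : R).
    (* With x = t / sqrt(a + t^2) in [0, 1], x >= x^2 = t^2 / (a + t^2) >= 1 - a / t as soon as t >=
       1; this avoids a limit of square roots. *)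
    apply: (@squeeze_cvgr _ _ _ _ (fun t : R => 1 - a * t^-1) (cst 1)).
    + near=> t.
      have t1 : 1 <= t by near: t; exact: nbhs_pinfty_ge.
      have t0 : 0 < t by exact: lt_le_trans t1.
      have q0 := addsqr_gt0 t a0.
      set x := t * _.
      have x0 : 0 <= x by rewrite mulr_ge0 ?powR_ge0// ltW.
      have x2 : x ^+ 2 * (a + t ^+ 2) = t ^+ 2.
        by rewrite /x exprMn powRN_half_sqr ?(ltW q0)// mulfVK// gt_eqF.
      have x1 : x <= 1.
        rewrite -(@ler_pXn2r _ 2)// ?nnegrE// expr1n.
        by rewrite -(ler_pM2r q0) x2 mul1r lerDr ltW.
      rewrite x1 andbT.
      have tt : t * t^-1 = 1 by rewrite mulfV// gt_eqF.
      have : x ^+ 2 <= x by rewrite expr2 ler_piMl.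
      apply: le_trans.
      rewrite -(ler_pM2r q0) x2.
      set i := t^-1 in tt *; have i0 : 0 < i by rewrite invr_gt0.
      have i1 : i <= 1 by rewrite invf_le1.
      have : (1 - a * i) * (a + t ^+ 2) = a + t ^+ 2 - a * a * i - a * t.
        by transitivity (a + t ^+ 2 - a * a * i - a * t * (t * i)); [ring|rewrite tt mulr1].
      move=> ->; have : 0 <= a * a * i by rewrite !mulr_ge0 ?(ltW a0)// ltW.
      have : a <= a * t by rewrite ler_pMr.
      by lra.
    + have V : t^-1 @[t --> +oo] --> (0 : R).
        apply: (iffRL (@gtr0_cvgV0 R _ (+oo%R) _ (fun t : R => t) _)); first exact: nbhs_pinfty_gt.
        exact: cvg_id.
      have := cvgB (cvg_cst (1 : R)) (cvgM (cvg_cst a) V).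
      by rewrite mulr0 subr0; apply.
    + exact: cvg_cst.
  by have := cvgM (cvg_cst a^-1) Z; rewrite mulr1; apply.
Unshelve. all: by end_near. Qed.

Lemma continuous_addsqr_powR a s : 0 < a -> continuous (fun t : R => (a + t ^+ 2) `^ s).
Proof.
move=> a0 t; apply: differentiable_continuous; apply/derivable1_diffP.
by have [] := is_derive_addsqr_powR s t a0.
Qed.

Lemma integral_addsqr_powR p a l : 0 < a -> has_primitive p a l ->
  (\int[leb]_t ((a + t ^+ 2) `^ (- p))%:E = (2 * l)%:E)%E.
Proof.
move=> a0 [F [F00 dF Fl]].
rewrite (@ge0_symfun_integralT R (fun t => (a + t ^+ 2) `^ (- p))); last 3 first.
- by move=> t; exact: powR_ge0.
- exact: continuous_addsqr_powR.
- by move=> t /=; rewrite sqrrN.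
rewrite EFinM; congr (_ * _)%E.
have h1 t : 0 <= t -> 0 <= (a + t ^+ 2) `^ (- p) by move=> _; exact: powR_ge0.
have h2 : {within `[0%R, +oo[, continuous (fun t : R => (a + t ^+ 2) `^ (- p))}.
  by apply: continuous_subspaceT; exact: continuous_addsqr_powR.
have h3 t : 0 < t -> derivable F t 1 by move=> _; have [] := dF t.
have h4 : F x @[x --> 0^'+] --> F 0.
  apply: cvg_at_right_filter; apply: differentiable_continuous; apply/derivable1_diffP.
  by have [] := dF 0.
have h5 : {in `]0, +oo[, F^`()%classic =1 (fun t : R => (a + t ^+ 2) `^ (- p))}.
  by move=> t _; rewrite derive1E; have [] := dF t.
by rewrite -set_itvcy (ge0_continuous_FTC2y h1 h2 Fl h3 h4 h5) F00 sube0.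
Qed.

(** Homogeneous in [a]: integrating out one coordinate leaves a power again, with exponent lowered
    by 1/2, so that five one-dimensional integrals can be chained. *)
Definition power_integral p c := forall a, 0 < a ->
  (\int[leb]_t ((a + t ^+ 2) `^ (- p))%:E = (c * a `^ (- (p - 1 / 2)))%:E)%E.

Definition power_primitive p c := forall a, 0 < a ->
  has_primitive p a (c / 2 * a `^ (- (p - 1 / 2))).

Lemma power_primitive_integral p c : power_primitive p c -> power_integral p c.
Proof.
move=> H a a0; rewrite (integral_addsqr_powR a0 (H a a0)); congr EFin.
by rewrite mulrA mulrCA divff ?mulr1.
Qed.

Lemma power_primitive_step p c : 1 <= p -> power_primitive p c ->
  power_primitive (p + 1) ((2 * p - 1) / (2 * p) * c).
Proof.
move=> p1 H a a0; have := primitive_step a0 p1 (H a a0).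
congr has_primitive.
have -> : a `^ (- (p - 1 / 2)) = a * a `^ (- (p + 1 - 1 / 2)).
  rewrite -{2}[a](powRr1 (ltW a0)) -powRD; last by apply/implyP => _; rewrite gt_eqF.
  by congr (_ `^ _); ring.
set z := _ `^ _; field; rewrite (gt_eqF a0)/=; lra.
Qed.

Lemma power_primitive_one : power_primitive 1 pi.
Proof.
move=> a a0; have := primitive_one a0; congr has_primitive.
by congr (_ * _ `^ _); field.
Qed.

Lemma power_primitive_three_half : power_primitive (3 / 2) 2.
Proof.
move=> a a0; have := primitive_three_half a0; congr has_primitive.
rewrite (_ : 3 / 2 - 1 / 2 = 1); last by field.
by rewrite divff// mul1r powR_inv1 ?ltW.
Qed.

Lemma integral_layer d (T : measurableType d) (m : {sigma_finite_measure set T -> \bar R})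
    (q : T -> R) p c : 0 <= c -> power_integral p c ->
  measurable_fun setT (q : T -> mR) -> (forall x, 0 < q x) ->
  (\int[sigma_product m leb]_x ((q x.1 + x.2 ^+ 2) `^ (- p))%:E =
   c%:E * \int[m]_x (q x `^ (- (p - 1 / 2)))%:E)%E.
Proof.
move=> c0 H mq q0.
have mf : measurable_fun setT (fun x : T * mR => ((q x.1 + x.2 ^+ 2) `^ (- p))%:E).
  apply/measurable_EFinP.
  apply: (measurableT_comp (measurable_powR (- p))).
  apply: measurable_funD; first exact: (measurableT_comp mq measurable_fst).
  by apply: measurable_funX; exact: measurable_snd.
have f0 (x : T * mR) : (0 <= ((q x.1 + x.2 ^+ 2) `^ (- p))%:E)%E by rewrite lee_fin powR_ge0.
apply: (etrans (tonelli_fst mf f0)).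
rewrite -ge0_integralZl//.
- by apply: eq_integral => x _ /=; rewrite H// EFinM.
- by apply/measurable_EFinP; exact: (measurableT_comp (measurable_powR _) mq).
- by move=> x _; rewrite lee_fin powR_ge0.
Qed.

Lemma integral_sqn_powR e p (c1 c2 c3 c4 c5 : R) : 0 < e ->
  0 <= c1 -> 0 <= c2 -> 0 <= c3 -> 0 <= c4 -> 0 <= c5 ->
  power_integral p c1 -> power_integral (p - 1 / 2) c2 ->
  power_integral (p - 1 / 2 - 1 / 2) c3 ->
  power_integral (p - 1 / 2 - 1 / 2 - 1 / 2) c4 ->
  power_integral (p - 1 / 2 - 1 / 2 - 1 / 2 - 1 / 2) c5 ->
  (\int[leb5]_w ((e + sqn w) `^ (- p))%:E =
   (c1 * (c2 * (c3 * (c4 * (c5 * e `^ (- (p - 5 / 2)))))))%:E)%E.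
Proof.
move=> e0 c10 c20 c30 c40 c50 H1 H2 H3 H4 H5.
pose q1 (a : mR) := e + a ^+ 2.
pose q2 (x : mR * mR) := q1 x.1 + x.2 ^+ 2.
pose q3 (x : mR * mR * mR) := q2 x.1 + x.2 ^+ 2.
pose q4 (x : R4 mR) := q3 x.1 + x.2 ^+ 2.
have mS d (T : measurableType d) (q : T -> R) : measurable_fun setT (q : T -> mR) ->
    measurable_fun setT (fun x : T * mR => q x.1 + x.2 ^+ 2 : mR).
  move=> mq; apply: measurable_funD; first exact: (measurableT_comp mq measurable_fst).
  by apply: measurable_funX; exact: measurable_snd.
have m1 : measurable_fun setT (q1 : mR -> mR).
  by apply: measurable_funD => //; exact: measurable_funX.
have m2 := mS _ _ _ m1; have m3 := mS _ _ _ m2; have m4 := mS _ _ _ m3.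
have p1 a : 0 < q1 a by exact: addsqr_gt0.
have p2 x : 0 < q2 x by exact: addsqr_gt0.
have p3 x : 0 < q3 x by exact: addsqr_gt0.
have p4 x : 0 < q4 x by exact: addsqr_gt0.
transitivity (\int[leb5]_w ((q4 w.1 + w.2 ^+ 2) `^ (- p))%:E)%E.
  by apply: eq_integral => w _; rewrite /q4 /q3 /q2 /q1 /sqn !addrA.
apply: (etrans (integral_layer leb4 c10 H1 m4 p4)).
rewrite EFinM; congr (_ * _)%E.
apply: (etrans (integral_layer (sigma_product (sigma_product leb leb) leb) c20 H2 m3 p3)).
rewrite EFinM; congr (_ * _)%E.
apply: (etrans (integral_layer (sigma_product leb leb) c30 H3 m2 p2)).
rewrite EFinM; congr (_ * _)%E.
apply: (etrans (integral_layer leb c40 H4 m1 p1)).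
rewrite EFinM; congr (_ * _)%E.
rewrite /q1 H5//; congr ((_ * _ `^ _)%:E); by field.
Qed.

(** The one-dimensional constants 16/15, 3 pi/8, 4/3, pi/2 and 2 multiply to 8 pi^2/15. This is what
    matches the normalisation of [newtonian5]. *)
Lemma integral_poisson_kernel e : 0 < e ->
  (\int[leb5]_w ((e + sqn w) `^ (- (7 / 2)))%:E = (8 * (pi : R) ^+ 2 / 15 * e^-1)%:E)%E.
Proof.
move=> e0; have pi0 := pi_ge0 R.
have e32 := power_primitive_three_half.
have e52 := power_primitive_step (_ : 1 <= 3 / 2) e32.
have e72 := power_primitive_step (_ : 1 <= 3 / 2 + 1) (e52 _).
have e2 := power_primitive_step (lexx 1) power_primitive_one.
have e3 := power_primitive_step (_ : 1 <= 1 + 1) e2.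
have h1 : 1 <= 3 / 2 :> R by lra.
have h2 : 1 <= 3 / 2 + 1 :> R by lra.
have h3 : 1 <= 1 + 1 :> R by lra.
have i72 : power_integral (7 / 2) (16 / 15).
  have := power_primitive_integral (e72 h2 h1).
  by congr power_integral; field.
have i3 : power_integral (7 / 2 - 1 / 2) (3 * pi / 8).
  have := power_primitive_integral (e3 h3).
  by congr power_integral; field.
have i52 : power_integral (7 / 2 - 1 / 2 - 1 / 2) (4 / 3).
  have := power_primitive_integral (e52 h1).
  by congr power_integral; field.
have i2 : power_integral (7 / 2 - 1 / 2 - 1 / 2 - 1 / 2) (pi / 2).
  have := power_primitive_integral e2.
  by congr power_integral; field.
have i32 : power_integral (7 / 2 - 1 / 2 - 1 / 2 - 1 / 2 - 1 / 2) 2.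
  have := power_primitive_integral e32.
  by congr power_integral; field.
have c1 : 0 <= 16 / 15 :> R by rewrite divr_ge0.
have c2 : 0 <= 3 * pi / 8 :> R by rewrite divr_ge0// mulr_ge0.
have c3 : 0 <= 4 / 3 :> R by rewrite divr_ge0.
have c4 : 0 <= pi / 2 :> R by rewrite divr_ge0.
have c5 : 0 <= 2 :> R by [].
apply: (etrans (integral_sqn_powR e0 c1 c2 c3 c4 c5 i72 i3 i52 i2 i32)).
congr EFin; rewrite (_ : - (7 / 2 - 5 / 2) = -1); last by field.
by rewrite powR_inv1 ?(ltW e0)//; field; rewrite gt_eqF.
Qed.

(** The error weight of the approximate identity: a Lipschitz factor lowers the exponent 7/2 to 3.
    Only the dependence on [e] matters. *)
Lemma integral_poisson_tail : exists2 C : R, 0 <= C & forall e, 0 < e ->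
  (\int[leb5]_w ((e + sqn w) `^ (- 3))%:E = (C * e `^ (- (1 / 2)))%:E)%E.
Proof.
have pi0 := pi_ge0 R.
have h1 : 1 <= 3 / 2 :> R by lra.
have h3 : 1 <= 1 + 1 :> R by lra.
have e32 := power_primitive_three_half.
have e52 := power_primitive_step h1 e32.
have e1 := power_primitive_one.
have e2 := power_primitive_step (lexx 1) e1.
have e3 := power_primitive_step h3 e2.
have i3 : power_integral 3 (3 * pi / 8).
  have := power_primitive_integral e3.
  by congr power_integral; field.
have i52 : power_integral (3 - 1 / 2) (4 / 3).
  have := power_primitive_integral e52.
  by congr power_integral; field.
have i2 : power_integral (3 - 1 / 2 - 1 / 2) (pi / 2).
  have := power_primitive_integral e2.
  by congr power_integral; field.
have i32 : power_integral (3 - 1 / 2 - 1 / 2 - 1 / 2) 2.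
  have := power_primitive_integral e32.
  by congr power_integral; field.
have i1 : power_integral (3 - 1 / 2 - 1 / 2 - 1 / 2 - 1 / 2) pi.
  have := power_primitive_integral e1.
  by congr power_integral; field.
exists (3 * pi / 8 * (4 / 3 * (pi / 2 * (2 * pi)))).
  by rewrite !mulr_ge0// invr_ge0.
have c2 : 0 <= 3 * pi / 8 :> R by rewrite divr_ge0// mulr_ge0.
have c3 : 0 <= 4 / 3 :> R by rewrite divr_ge0.
have c4 : 0 <= pi / 2 :> R by rewrite divr_ge0.
have c5 : 0 <= 2 :> R by [].
move=> e e0; apply: (etrans (integral_sqn_powR e0 c2 c3 c4 c5 pi0 i3 i52 i2 i32 i1)).
congr EFin; rewrite (_ : - (3 - 5 / 2) = - (1 / 2)); last by field.
by ring.
Qed.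

End power_integrals.

(** * Smooth functions *)

(** A quadratic bound on increments is a little-o of v. It is applied with C = 0 to functions equal
    near a point, and to a potential minus its linear part. *)
Lemma quadratic_differentiable {R : realType} (V : normedModType R) (f : V -> R) x C (e : R) :
  0 < e -> (forall v, `|v| < e -> `|f (x + v) - f x| <= C * `|v| ^+ 2) ->
  differentiable f x /\ forall v, 'D_v f x = 0.
Proof.
move=> e0 H.
have E : f \o shift x = cst (f x) + \0 +o_ 0 id.
  apply/eqaddoE; rewrite funeqE => h /=.
  rewrite littleoE.
    instantiate (1 := fun h => f (h + x) - f x).
    by change (f (h + x) = f x + 0 + (f (h + x) - f x)); ring.
  move=> _/posnumP[d].
  have C0 : 0 < `|C| + 1 by rewrite ltr_wpDl.
  have r0 : 0 < Num.min e (d%:num / (`|C| + 1)) by rewrite lt_min e0 divr_gt0.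
  near=> v.
  have : `|v| < Num.min e (d%:num / (`|C| + 1)).
    by near: v; apply: nbhs0_lt.
  rewrite lt_min => /andP[ve vd].
  rewrite /= [v + x]addrC; apply: le_trans (H v ve) _.
  rewrite expr2 mulrA ler_wpM2r//.
  apply: (@le_trans _ _ ((`|C| + 1) * `|v|)).
    by rewrite ler_wpM2r// (le_trans (ler_norm C))// lerDl.
  by rewrite mulrC -ler_pdivlMr// ltW.
have dE : 'd f x = \0 :> (V -> R).
  by apply: diff_unique E; exact: cst_continuous.
have df : differentiable f x.
  by apply/diff_locallyP; rewrite dE; split => //; exact: cst_continuous.
by split => // v; rewrite deriveE// dE.
Unshelve. all: by end_near. Qed.

Section smooth.
Context {R : realType}.
Implicit Types (f g : R5 R -> R) (A B : set (R5 R)) (x v : R5 R).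

Lemma eq_on_differentiable A f g x : open A -> A x -> (forall y, A y -> f y = g y) ->
  differentiable f x -> differentiable g x.
Proof.
move=> oA Ax fg df.
have -> : g = f + (fun y => g y - f y).
  by apply/funext => y; rewrite [RHS](_ : _ = f y + (g y - f y))// addrC subrK.
apply: differentiableD => //.
have /nbhs_ballP[e /= e0 eA] : nbhs x A by apply: open_nbhs_nbhs.
apply: (quadratic_differentiable (C := 0) e0 _).1 => v ve.
rewrite mul0r !fg ?subrr ?normr0//; apply: eA.
by rewrite -ball_normE /= opprD addNKr normrN.
Qed.

Lemma eq_on_derive A f g x v : open A -> A x -> (forall y, A y -> f y = g y) ->
  'D_v f x = 'D_v g x.
Proof.
move=> oA Ax fg; apply: near_eq_derive.
by apply: filterS fg _; apply: open_nbhs_nbhs.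
Qed.

Lemma smooth_on_differentiable A f x : smooth_on A f -> A x -> differentiable f x.
Proof. by move=> sf Ax; exact: (sf [::] x Ax). Qed.

Lemma smooth_on_derive A f v : smooth_on A f -> smooth_on A (fun x => 'D_v f x).
Proof. by move=> sf vs x Ax; have := sf (rcons vs v) x Ax; rewrite foldr_rcons. Qed.

Lemma smooth_on_subset A B f : B `<=` A -> smooth_on A f -> smooth_on B f.
Proof. by move=> BA sf vs x /BA; exact: sf. Qed.

(* Coinduction principle: a class of functions differentiable on [A] and stable, up to
   equality on [A], under directional derivatives consists of smooth functions. *)
Lemma smooth_on_class A (S : (R5 R -> R) -> Prop) : open A ->
  (forall f, S f -> forall x, A x -> differentiable f x) ->
  (forall f v, S f -> exists2 g, S g & forall x, A x -> 'D_v f x = g x) ->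
  forall f, S f -> smooth_on A f.
Proof.
move=> oA Sd SD f Sf vs.
suff [g Sg fg] : exists2 g, S g &
    forall x, A x -> foldr (fun v g => fun w : R5 R => 'D_v g w) f vs x = g x.
  move=> x Ax; apply: (eq_on_differentiable oA Ax _ (Sd _ Sg x Ax)) => y Ay.
  by rewrite fg.
elim: vs => [|v vs [g Sg fg]] /=; first by exists f.
have [h Sh gh] := SD g v Sg; exists h => // x Ax.
by rewrite -gh//; exact: eq_on_derive oA Ax fg.
Qed.

Lemma eq_smooth_on A f g : open A -> (forall x, A x -> f x = g x) ->
  smooth_on A f -> smooth_on A g.
Proof.
move=> oA fg sf.
apply: (@smooth_on_class A (fun g => exists2 f, smooth_on A f & forall x, A x -> f x = g x)).
- exact: oA.
- move=> h [k sk kh] x Ax; apply: (eq_on_differentiable oA Ax kh).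
  exact: smooth_on_differentiable sk Ax.
- move=> h v [k sk kh]; exists (fun x => 'D_v k x).
    by exists (fun x => 'D_v k x) => //; exact: smooth_on_derive.
  by move=> x Ax; apply: eq_on_derive oA Ax _ => y Ay; rewrite kh.
- by exists f.
Qed.

Lemma smooth_onB A f g : open A -> smooth_on A f -> smooth_on A g ->
  smooth_on A (fun x => f x - g x).
Proof.
move=> oA sf sg.
apply: (@smooth_on_class A (fun h => exists f g, [/\ smooth_on A f, smooth_on A g &
   h = fun x => f x - g x])) => //.
- move=> _ [h [k [sh sk ->]]] x Ax.
  by apply: differentiableB; [exact: smooth_on_differentiable sh Ax|exact: smooth_on_differentiable sk Ax].
- move=> _ v [h [k [sh sk ->]]]; exists (fun x => 'D_v h x - 'D_v k x).
    by exists (fun x => 'D_v h x), (fun x => 'D_v k x); split => //; exact: smooth_on_derive.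
  move=> x Ax; apply: deriveB; apply: diff_derivable.
    exact: smooth_on_differentiable sh Ax.
  exact: smooth_on_differentiable sk Ax.
- by exists f, g.
Qed.

(** Products are not stable under derivatives, but finite sums of products are. Such a sum is coded
    by a list of pairs, and by Leibniz each pair (p, q) is replaced by (Dp, q) and (p, Dq). *)
Lemma smooth_onM A f g : open A -> smooth_on A f -> smooth_on A g ->
  smooth_on A (fun x => f x * g x).
Proof.
move=> oA sf sg.
pose val (l : seq ((R5 R -> R) * (R5 R -> R))) x : R := \sum_(p <- l) p.1 x * p.2 x.
pose ok (l : seq ((R5 R -> R) * (R5 R -> R))) :=
  forall i, (i < size l)%N -> smooth_on A (nth (f, g) l i).1 /\ smooth_on A (nth (f, g) l i).2.
have okS p l : ok (p :: l) -> [/\ smooth_on A p.1, smooth_on A p.2 & ok l].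
  by move=> H; have [h1 h2] := H 0%N isT; split => // i il; exact: (H i.+1).
have valS p l : val (p :: l) = (p.1 * p.2) + val l.
  by apply/funext => x; rewrite /val big_cons.
have val0 : val [::] = cst 0 by apply/funext => x; rewrite /val big_nil.
have dval l x : ok l -> A x -> differentiable (val l) x.
  move=> + Ax; elim: l => [_|p l IH /okS[h1 h2 h3]].
    by rewrite val0; exact: differentiable_cst.
  rewrite valS; apply: differentiableD; last exact: IH.
  by apply: differentiableM; [exact: smooth_on_differentiable h1 Ax|exact: smooth_on_differentiable h2 Ax].
apply: (@smooth_on_class A (fun h => exists2 l, ok l & h = val l)) => //.
- by move=> _ [l okl ->] x; exact: dval.
- move=> _ v [l okl ->].
  suff [l' okl' H] : exists2 l', ok l' & forall x, A x -> 'D_v (val l) x = val l' x.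
    by exists (val l') => //; exists l'.
  elim: l okl => [_|p l IH /okS[h1 h2 h3]].
    by exists [::] => // x Ax; rewrite val0 derive_cst.
  have [l' okl' Hl'] := IH h3.
  exists [:: ((fun x => 'D_v p.1 x), p.2), (p.1, (fun x => 'D_v p.2 x)) & l'].
    move=> [|[|i]] //= il; last exact: okl'.
      by split => //; exact: smooth_on_derive.
    by split => //; exact: smooth_on_derive.
  move=> x Ax; rewrite valS /val !big_cons -/(val l' x) -Hl'//=.
  have d1 := diff_derivable (v := v) (smooth_on_differentiable h1 Ax).
  have d2 := diff_derivable (v := v) (smooth_on_differentiable h2 Ax).
  rewrite (deriveD (derivableM d1 d2) (diff_derivable (dval _ _ h3 Ax))) (deriveM d1 d2).
  by rewrite /GRing.scale/=; ring.
- exists [:: (f, g)]; first by move=> [|].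
  by apply/funext => x; rewrite /val big_cons big_nil addr0.
Qed.

End smooth.

(** * Test functions: Lipschitz and Taylor bounds uniform in the base point *)

Section test_functions.
Context {R : realType}.
Implicit Types (f g : R5 R -> R) (A B K : set (R5 R)) (x v w : R5 R).

Definition test_function f :=
  smooth_on setT f /\ exists2 K : set (R5 R), compact K & supported_in K f.

Lemma test_differentiable f x : test_function f -> differentiable f x.
Proof. by move=> [sf _]; exact: smooth_on_differentiable sf I. Qed.

Lemma test_continuous f : test_function f -> continuous f.
Proof. by move=> tf x; exact: differentiable_continuous (test_differentiable x tf). Qed.

Lemma test_measurable5 f : test_function f -> measurable5 f.
Proof. by move=> tf; exact: continuous_measurable5 (test_continuous tf). Qed.

Lemma test_derive f v : test_function f -> test_function (fun x => 'D_v f x).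
Proof.
move=> [sf [K cK sK]]; split; first exact: smooth_on_derive.
exists K => // x nKx.
have oK : open (~` K).
  by apply: closed_openC; apply: compact_closed => //; exact: norm_hausdorff.
rewrite (@eq_on_derive _ (~` K) f (cst 0))//; exact: derive_cst.
Qed.

Lemma test_bounded f : test_function f -> exists M, forall x, `|f x| <= M.
Proof.
move=> tf; have [_ [K cK sK]] := tf.
have cf : {within K, continuous f} by apply: continuous_subspaceT; exact: test_continuous.
have /compact_bounded[M [_ HM]] := continuous_compact cf cK.
exists (`|M| + 1) => x.
have M1 : M < `|M| + 1 by rewrite (le_lt_trans (ler_norm M))// ltrDl.
have [Kx|nKx] := pselect (K x); first by apply: (HM _ M1); exists x.
by rewrite sK// normr0 addr_ge0.
Qed.

Lemma test_support f : test_function f -> exists2 r, 0 <= r & forall x, r < `|x| -> f x = 0.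
Proof.
move=> [_ [K /compact_bounded[M [_ HM]] sK]].
exists (`|M| + 1); first by rewrite addr_ge0.
move=> x xM; apply: sK => Kx.
have M1 : M < `|M| + 1 by rewrite (le_lt_trans (ler_norm M))// ltrDl.
by have /= := HM _ M1 x Kx; rewrite leNgt xM.
Qed.

Definition coord (i : 'I_5) (w : R5 R) : R :=
  nth 0 [:: w.1.1.1.1; w.1.1.1.2; w.1.1.2; w.1.2; w.2] i.

Definition axis (i : 'I_5) : R5 R := nth 0 (@axes R) i.

Lemma coord_axis v : v = \sum_(i < 5) coord i v *: axis i.
Proof.
rewrite !big_ord_recl big_ord0 /coord/axis/=.
case: v => [[[[a b] c] d] e] /=.
rewrite [RHS](_ : _ = (a * 1 + (b * 0 + (c * 0 + (d * 0 + (e * 0 + 0)))),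
   a * 0 + (b * 1 + (c * 0 + (d * 0 + (e * 0 + 0)))),
   a * 0 + (b * 0 + (c * 1 + (d * 0 + (e * 0 + 0)))),
   a * 0 + (b * 0 + (c * 0 + (d * 1 + (e * 0 + 0)))),
   a * 0 + (b * 0 + (c * 0 + (d * 0 + (e * 1 + 0))))))//.
by rewrite !mulr0 !mulr1 !addr0 !add0r.
Qed.

Lemma coord_le v i : `|coord i v| <= `|v|.
Proof.
rewrite /coord; case: v => [[[[a b] c] d] e] /=; rewrite !prod_normE/= !le_max.
by case: i => [[|[|[|[|[|//]]]]]] //= _; rewrite lexx ?orbT.
Qed.

Lemma derive_coord f x v : differentiable f x ->
  'D_v f x = \sum_(i < 5) coord i v * 'D_(axis i) f x.
Proof.
move=> df; rewrite deriveE// {1}(coord_axis v) linear_sum.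
by apply: eq_bigr => i _; rewrite linearZ/= -deriveE.
Qed.

Lemma is_derive_line f x v t : differentiable f (x + t *: v) ->
  is_derive t 1 (fun s : R => f (x + s *: v)) ('D_v f (x + t *: v)).
Proof.
move=> df.
have E : (fun h : R => h^-1 *: (f (x + (h *: (1 : R) + t) *: v) - f (x + t *: v))) =
         (fun h : R => h^-1 *: (f (h *: v + (x + t *: v)) - f (x + t *: v))).
  apply/funext => h; congr (_ *: (f _ - _)).
  by rewrite [h *: (1 : R)]mulr1 scalerDl addrCA.
have := diff_derivable (v := v) df; rewrite /derivable -E => d.
by split; [exact: d|rewrite /derive -E].
Qed.

Lemma test_mvt f x v : test_function f ->
  exists t : R, f (x + v) - f x = 'D_v f (x + t *: v).
Proof.
move=> tf.
have dl t := is_derive_line (v := v) (test_differentiable (x + t *: v) tf).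
have cl : {within `[(0 : R), 1], continuous (fun s : R => f (x + s *: v))}.
  apply: continuous_subspaceT => t; apply: differentiable_continuous; apply/derivable1_diffP.
  by have [] := dl t.
have [t _ Ht] := MVT_segment ler01 (fun t _ => dl t) cl.
by exists t; move: Ht; rewrite scale1r scale0r addr0 subr0 mulr1.
Qed.

Lemma test_lipschitz f : test_function f ->
  exists2 L, 0 <= L & forall x v, `|f (x + v) - f x| <= L * `|v|.
Proof.
move=> tf.
have H i : exists M, forall x, `|'D_(axis i) f x| <= M.
  by apply: test_bounded; exact: test_derive.
have [M HM] := choice H.
exists (\sum_(i < 5) `|M i|); first by apply: sumr_ge0.
move=> x v; have [t ->] := test_mvt x v tf.
rewrite derive_coord; last exact: test_differentiable.
rewrite mulr_suml; apply: le_trans (ler_norm_sum _ _ _) _; apply: ler_sum => i _.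
rewrite normrM mulrC; apply: ler_pM => //; last exact: coord_le.
exact: le_trans (HM i _) (ler_norm _).
Qed.

(** The mean value theorem for s |-> f (x + s v) - s D_v f x, combined with the Lipschitz bounds of
    the five partial derivatives. *)
Lemma test_taylor f : test_function f ->
  exists2 C, 0 <= C & forall x v, `|f (x + v) - f x - 'D_v f x| <= C * `|v| ^+ 2.
Proof.
move=> tf.
have H i : exists L, 0 <= L /\ forall x v, `|'D_(axis i) f (x + v) - 'D_(axis i) f x| <= L * `|v|.
  by have [L L0 HL] := test_lipschitz (test_derive (axis i) tf); exists L.
have [L HL] := choice H.
exists (\sum_(i < 5) L i); first by apply: sumr_ge0 => i _; have [] := HL i.
move=> x v.
pose dl t := is_derive_line (v := v) (test_differentiable (x + t *: v) tf).
have dl' (t : R) : is_derive t 1 (fun s : R => f (x + s *: v) - s * 'D_v f x)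
    ('D_v f (x + t *: v) - 'D_v f x).
  have d2 : is_derive t 1 (fun s : R => s * 'D_v f x) ('D_v f x).
    by apply: is_derive_eq; rewrite /GRing.scale/=; ring.
  exact: is_deriveB (dl t) d2.
have cl : {within `[(0 : R), 1], continuous (fun s : R => f (x + s *: v) - s * 'D_v f x)}.
  apply: continuous_subspaceT => t; apply: differentiable_continuous; apply/derivable1_diffP.
  by have [] := dl' t.
have [t] := MVT_segment ler01 (fun t _ => dl' t) cl.
rewrite in_itv/= => /andP[t0 t1].
rewrite scale1r scale0r addr0 mul1r mul0r !subr0 mulr1 => E.
have -> : f (x + v) - f x - 'D_v f x = f (x + v) - 'D_v f x - f x by ring.
rewrite E !derive_coord; try exact: test_differentiable.
rewrite -sumrB mulr_suml; apply: le_trans (ler_norm_sum _ _ _) _; apply: ler_sum => i _.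
have [L0 HLi] := HL i.
rewrite -mulrBr normrM expr2 mulrCA.
apply: ler_pM => //; first exact: coord_le.
apply: le_trans (HLi _ _) _; rewrite ler_wpM2l// normrZ ger0_norm// ler_piMl//.
Qed.

End test_functions.

(** * The Newtonian potential *)

Section potential.
Context {R : realType}.
Notation mR := (measurableTypeR R).
Notation X := (R5 mR).
Implicit Types (f g : R5 R -> R) (x v w : R5 R).

Definition potential k f x := \int[leb5]_w (f (x + w) / enorm5 w ^+ k).

Definition ball_one (r : R) (w : R5 R) : R := if `|w| < r then 1 else 0.

(** Bounded, measurable, of bounded support: unlike test functions, this class is stable under
    absolute values, which the kernel |w|^-4 is applied to. [admissibleE] normalises the signs of B
    and r. *)
Definition admissible f := measurable5 f /\
  exists B r, forall x, `|f x| <= (if `|x| < r then B else 0).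

Lemma ball_indicator_L2 r : 0 < r ->
  pos_L2 leb5 (fun w : X => ball_one r w).
Proof.
move=> r0.
have -> : ball_one r = (fun w : X => r ^+ 5 * cube r w).
  apply/funext => w; rewrite /ball_one /cube; case: ifP => _; last by rewrite mulr0.
  by rewrite divff// gt_eqF// exprn_gt0.
apply: pos_L2Z; first by rewrite exprn_ge0// ltW.
have := kernel_pos_L2 (measurable_cube_kernel r) (cube_kernel_ge0 r0) (cube_kernel_le r0)
  (integral_cube_kernel r0) 0 0.
rewrite /cube_kernel expr0 mulr1.
by under [X in pos_L2 _ X]eq_fun do rewrite subr0.
Qed.

Lemma integral_ball_indicator r : 0 < r ->
  (\int[leb5]_w (ball_one r w)%:E < +oo)%E.
Proof.
move=> r0; have [_ _] := ball_indicator_L2 r0; congr (_ < _)%E.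
by apply: eq_integral => w _; rewrite /ball_one; case: ifP; rewrite ?expr1n ?expr0n.
Qed.

Lemma kernel4_bounded r : 0 < r -> exists M, forall x,
  (\int[leb5]_w (ball_one r (x + w) / enorm5 w ^+ 4)%:E <= M%:E)%E.
Proof.
move=> r0; have Lg := ball_indicator_L2 r0.
have [M HM] : exists M, forall x, (riesz (fun w : X => ball_one r w) x <= M%:E)%E.
  by apply: (riesz_bounded (b := 1) Lg) => y; rewrite /ball_one; case: ifP.
exists M => x; apply: le_trans (HM x).
have mg : measurable5 (fun w => ball_one r w) by have [] := Lg.
have mk : measurable5 (fun y => ball_one r (y : R5 R) / enorm5 (y - x) ^+ 4).
  apply: measurable5M => //.
  rewrite (_ : (fun w => _) = (fun w => (enorm5 (- x + w) ^+ 4)^-1)).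
    exact: (measurable5_translate _ (measurable5_enormV 4)).
  by apply/funext => w; rewrite addrC.
rewrite /riesz le_eqVlt; apply/orP; left; apply/eqP.
have me : measurable_fun setT (fun y : X => (ball_one r (y : R5 R) / enorm5 ((y : R5 R) - x) ^+ 4)%:E).
  exact/measurable_EFinP.
apply: (etrans _ (measure_preserving_integral (measure_preserving_translate x) me)).
by apply: eq_integral => w _; rewrite [x + w]addrC addrK.
Qed.

(** Reduces the local integrability of |w|^-3 to that of |w|^-4. *)
Lemma enorm5V3_le w : (enorm5 w ^+ 3)^-1 <= (enorm5 w ^+ 4)^-1 + 1.
Proof.
have [e0|] := eqVneq (enorm5 w) 0; first by rewrite e0 !expr0n/= invr0 add0r.
move=> e0; have {}e0 : 0 < enorm5 w by rewrite lt_neqAle eq_sym e0 enorm5_ge0.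
have [e1|e1] := leP (enorm5 w) 1.
  rewrite ler_wpDr// lef_pV2 ?posrE ?exprn_gt0//.
  by rewrite exprS ler_piMl// exprn_ge0// ltW.
by rewrite ler_wpDl ?invr_ge0 ?exprn_ge0 ?(ltW e0)// invf_le1 ?exprn_gt0// exprn_ege1// ltW.
Qed.

Lemma kernel3_bounded r : 0 < r -> exists M, forall x,
  (\int[leb5]_w (ball_one r (x + w) / enorm5 w ^+ 3)%:E <= M%:E)%E.
Proof.
move=> r0; have [M HM] := kernel4_bounded r0.
have Vfin := integral_ball_indicator r0.
have mg : measurable5 (fun w => ball_one r w) by have [] := ball_indicator_L2 r0.
have g0 w : 0 <= ball_one r w :> R by rewrite /ball_one; case: ifP.
have V0 : (0 <= \int[leb5]_w (ball_one r w)%:E)%E.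
  by apply: integral_ge0 => w _; rewrite lee_fin.
exists (M + fine (\int[leb5]_w (ball_one r w)%:E)%E) => x.
have mgx : measurable5 (fun w => ball_one r (x + w)).
  exact: (measurable5_translate x mg).
have k0 n w : 0 <= (enorm5 w ^+ n)^-1 by rewrite invr_ge0 exprn_ge0// enorm5_ge0.
have m4 := measurable5M mgx (measurable5_enormV 4).
have m3 := measurable5M mgx (measurable5_enormV 3).
apply: (@le_trans _ _ (\int[leb5]_w
   ((ball_one r (x + w) / enorm5 w ^+ 4)%:E + (ball_one r (x + w))%:E))%E).
  apply: ge0_le_integral => //.
  - by move=> w _; rewrite lee_fin mulr_ge0.
  - exact/measurable_EFinP.
  - by apply: emeasurable_funD; exact/measurable_EFinP.
  - move=> w _; rewrite -EFinD lee_fin -[X in _ <= _ + X]mulr1 -mulrDr.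
    by apply: ler_wpM2l => //; exact: enorm5V3_le.
rewrite ge0_integralD//; first last.
- exact/measurable_EFinP.
- by move=> w _; rewrite lee_fin.
- exact/measurable_EFinP.
- by move=> w _; rewrite lee_fin mulr_ge0.
rewrite EFinD fineK ?ge0_fin_numE//; apply: leeD; first exact: HM.
have me : measurable_fun setT (fun w : X => (ball_one r w)%:E).
  exact/measurable_EFinP.
have := measure_preserving_integral (measure_preserving_translate x) me.
by move=> ->.
Qed.

Lemma admissible_measurable5 f k x : admissible f ->
  measurable5 (fun w => f (x + w) / enorm5 w ^+ k).
Proof.
move=> [mf _]; apply: measurable5M; last exact: measurable5_enormV.
exact: measurable5_translate.
Qed.

Lemma admissible_bound B r f : 0 < r -> measurable5 f ->
  (forall x, `|f x| <= (if `|x| < r then B else 0)) -> 0 <= B ->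
  forall k x, (\int[leb5]_w `|f (x + w) / enorm5 w ^+ k|%:E <=
    B%:E * \int[leb5]_w (ball_one r (x + w) / enorm5 w ^+ k)%:E)%E.
Proof.
move=> r0 mf fB B0 k x.
have mg : measurable5 (fun w => ball_one r w) by have [] := ball_indicator_L2 r0.
have mgx : measurable5 (fun w => ball_one r (x + w)).
  exact: (measurable5_translate x mg).
have k0 n w : 0 <= (enorm5 w ^+ n)^-1 by rewrite invr_ge0 exprn_ge0// enorm5_ge0.
have g0 w : 0 <= ball_one r w :> R by rewrite /ball_one; case: ifP.
have mk := measurable5M mgx (measurable5_enormV k).
have ma : measurable5 (fun w => `|f (x + w) / enorm5 w ^+ k|).
  apply: measurable5_norm; apply: measurable5M; last exact: measurable5_enormV.
  exact: measurable5_translate.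
rewrite -ge0_integralZl//; last 2 first.
- exact/measurable_EFinP.
- by move=> w _; rewrite lee_fin mulr_ge0.
apply: ge0_le_integral => //.
- exact/measurable_EFinP.
- by apply: measurable_funeM; exact/measurable_EFinP.
- move=> w _; rewrite -EFinM lee_fin normrM (ger0_norm (k0 k w)) mulrA.
  apply: ler_wpM2r => //; apply: le_trans (fB _) _.
  by rewrite /ball_one; case: ifP => _; rewrite ?mulr1 ?mulr0.
Qed.

Lemma admissibleE f : admissible f -> exists B r, [/\ 0 <= B, 0 < r &
  forall x, `|f x| <= (if `|x| < r then B else 0)].
Proof.
move=> [mf [B [r fB]]]; exists (`|B|), (`|r| + 1); split => //.
move=> x; apply: le_trans (fB x) _; case: ifP => [xr|_].
  by rewrite ifT ?ler_norm// (lt_le_trans xr)// (le_trans (ler_norm r))// lerDl.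
by case: ifP.
Qed.

Lemma admissible_integrable f k x : (k = 3%N) \/ (k = 4%N) -> admissible f ->
  leb5.-integrable setT (fun w : X => (f (x + w) / enorm5 w ^+ k)%:E).
Proof.
move=> k34 af; have [B [r [B0 r0 fB]]] := admissibleE af; have [mf _] := af.
apply/integrableP; split; first by apply/measurable_EFinP; exact: admissible_measurable5.
apply: le_lt_trans (admissible_bound r0 mf fB B0 k x) _.
have [M HM] : exists M, forall x,
  (\int[leb5]_w (ball_one r (x + w) / enorm5 w ^+ k)%:E <= M%:E)%E.
  by case: k34 => ->; [exact: kernel3_bounded|exact: kernel4_bounded].
apply: (@le_lt_trans _ _ (B%:E * M%:E)%E); last by rewrite -EFinM ltry.
by apply: lee_wpmul2l => //; rewrite lee_fin.
Qed.

(** [M] depends on the radius of the support only and the bound is linear in B; with B = C |v|^2 it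
    controls the potential of a Taylor remainder. *)
Lemma admissible_potential_le r : 0 < r -> exists M, 0 <= M /\ forall f B x, measurable5 f ->
  0 <= B -> (forall x, `|f x| <= (if `|x| < r then B else 0)) ->
  `|potential 3 f x| <= B * M.
Proof.
move=> r0; have [M HM] := kernel3_bounded r0.
have M0 : 0 <= M.
  rewrite -lee_fin; apply: le_trans (HM 0); apply: integral_ge0 => w _.
  by rewrite lee_fin mulr_ge0 ?invr_ge0 ?exprn_ge0 ?enorm5_ge0// /ball_one; case: ifP.
exists M; split => // f B x mf B0 fB.
have af : admissible f by split => //; exists B, r.
have I := admissible_integrable x (or_introl erefl) af.
apply: (le_trans (le_normr_Rintegral _ I)) => //.
rewrite -lee_fin /Rintegral fineK.
  apply: le_trans (admissible_bound r0 mf fB B0 3 x) _.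
  by rewrite EFinM; apply: lee_wpmul2l => //; rewrite lee_fin.
by apply: integrable_fin_num => //; exact: (integrable_norm I).
Qed.

Lemma potentialB k f g x : (k = 3%N) \/ (k = 4%N) -> admissible f -> admissible g ->
  potential k (fun w => f w - g w) x = potential k f x - potential k g x.
Proof.
move=> k34 af ag; rewrite /potential -RintegralB//; try exact: admissible_integrable.
by apply: eq_Rintegral => w _; rewrite mulrBl.
Qed.

Lemma admissible_test f : test_function f -> admissible f.
Proof.
move=> tf; split; first exact: test_measurable5.
have [M HM] := test_bounded tf; have [r r0 Hr] := test_support tf.
exists M, (r + 1) => x; case: ifPn => // h.
by rewrite Hr ?normr0// (lt_le_trans _ (_ : r + 1 <= _))// ?ltrDl// leNgt.
Qed.

End potential.

Section potential_smooth.
Context {R : realType}.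
Notation mR := (measurableTypeR R).
Notation X := (R5 mR).
Implicit Types (f g : R5 R -> R) (x v w : R5 R).

Lemma Rintegral_sum_ord d (T : measurableType d) (mu : {measure set T -> \bar R}) n
    (F : 'I_n -> T -> R) :
  (forall i, mu.-integrable setT (EFin \o F i)) ->
  mu.-integrable setT (EFin \o (fun t => \sum_(i < n) F i t)) /\
  \int[mu]_t (\sum_(i < n) F i t) = \sum_(i < n) \int[mu]_t F i t.
Proof.
elim: n F => [|n IH] F IF.
  rewrite big_ord0 (_ : (fun t => _) = (fun=> 0)); last by apply/funext => t; rewrite big_ord0.
  by split; [exact: integrable0|rewrite Rintegral_cst// mul0r].
have -> : (fun t => \sum_(i < n.+1) F i t) =
    (fun t => F ord0 t + \sum_(i < n) F (lift ord0 i) t).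
  by apply/funext => t; rewrite big_ord_recl.
have [I1 I2] := IH (fun i => F (lift ord0 i)) (fun i => IF _).
split; last by rewrite RintegralD// I2 big_ord_recl.
have -> : EFin \o (fun t => F ord0 t + \sum_(i < n) F (lift ord0 i) t) =
    ((EFin \o F ord0) \+ (EFin \o (fun t => \sum_(i < n) F (lift ord0 i) t)%R))%E.
  by apply/funext => t; rewrite /= EFinD.
exact: integrableD.
Qed.

Lemma coord_is_linear i : linear (@coord R i).
Proof.
move=> a u w; rewrite /coord; case: u => [[[[u1 u2] u3] u4] u5]; case: w => [[[[w1 w2] w3] w4] w5].
by case: i => [[|[|[|[|[|//]]]]]].
Qed.

HB.instance Definition _ i := GRing.isLinear.Build R (R5 R) R _ (@coord R i) (coord_is_linear i).

Lemma coord_differentiable i x : differentiable (@coord R i) x.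
Proof.
apply: linear_differentiable => y; apply/cvgrPdist_lt => e e0.
have /nbhs_ballP : exists2 d : R, 0 < d & ball y d `<=` [set t | `|coord i y - coord i t| < e].
  exists e => // t; rewrite -ball_normE /= => yt.
  by rewrite -linearB; apply: le_lt_trans (coord_le _ _) yt.
by [].
Qed.

Lemma affine_derive (c : 'I_5 -> R) x :
  differentiable (fun w => \sum_(i < 5) coord i w * c i) x /\
  forall v, 'D_v (fun w => \sum_(i < 5) coord i w * c i) x = \sum_(i < 5) coord i v * c i.
Proof.
have dc i : differentiable (fun w => coord i w * c i) x.
  by apply: differentiableM; [exact: coord_differentiable|exact: differentiable_cst].
have E : (fun w => \sum_(i < 5) coord i w * c i) = \sum_(i < 5) (fun w => coord i w * c i).
  by apply/funext => w; rewrite fct_sumE.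
rewrite E; split; first exact: differentiable_sum.
move=> v; rewrite derive_sum => [|i]; last exact: diff_derivable.
apply: eq_bigr => i _; rewrite deriveMr; last exact/diff_derivable/coord_differentiable.
rewrite deriveE ?diff_lin//; last exact: coord_differentiable.
  by rewrite mulrC.
by move=> y; exact: differentiable_continuous (coord_differentiable i y).
Qed.

Lemma admissible_shift f v : admissible f -> admissible (fun y => f (y + v)).
Proof.
move=> af; have [mf _] := af; have [B [r [B0 r0 fB]]] := admissibleE af; split.
  have -> : (fun y => f (y + v)) = (fun y => f (v + y)) by apply/funext => y; rewrite addrC.
  exact: measurable5_translate.
exists B, (r + `|v|) => y; apply: le_trans (fB _) _; case: ifP => [yv|_]; last by case: ifP.
rewrite ifT// -[y](addrK v); apply: le_lt_trans (ler_normB _ _) _.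
by rewrite ltrD2r.
Qed.

Lemma derive_support f v r x : (forall y, r < `|y| -> f y = 0) -> r < `|x| -> 'D_v f x = 0.
Proof.
move=> fr rx.
rewrite (@eq_on_derive _ [set y | r < `|y|] f (cst 0))//; first exact: derive_cst.
apply: (@open_comp _ _ (fun y : R5 R => `|y|) [set t | r < t]); last exact: open_gt.
by move=> y _; exact: (@norm_continuous _ (R5 R) y).
Qed.

(** The remainder f(y + v) - f(y) - D_v f(y) is O(|v|^2) uniformly in y and supported in a fixed
    ball. Hence the increment of the potential differs from a linear function of v by O(|v|^2). *)
Lemma potential_derive f x : test_function f ->
  differentiable (potential 3 f) x /\
  forall v, 'D_v (potential 3 f) x = potential 3 (fun y => 'D_v f y) x.
Proof.
move=> tf; have af := admissible_test tf.
have k3 : (3 = 3)%N \/ (3 = 4)%N by left.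
have aD v : admissible (fun y => 'D_v f y) by apply: admissible_test; exact: test_derive.
pose c (i : 'I_5) := potential 3 (fun y => 'D_(axis i) f y) x.
have Dc v : potential 3 (fun y => 'D_v f y) x = \sum_(i < 5) coord i v * c i.
  rewrite /potential.
  transitivity (\int[leb5]_w \sum_(i < 5) (coord i v * ('D_(axis i) f (x + w) / enorm5 w ^+ 3))).
    apply: eq_Rintegral => w _; rewrite derive_coord; last exact: test_differentiable.
    by rewrite mulr_suml; apply: eq_bigr => i _; rewrite mulrA.
  have I i := admissible_integrable x k3 (aD (axis i)).
  have Z i : leb5.-integrable setT
      (EFin \o (fun w : X => coord i v * ('D_(axis i) f (x + w) / enorm5 w ^+ 3))).
    have -> : EFin \o (fun w : X => coord i v * ('D_(axis i) f (x + w) / enorm5 w ^+ 3)) =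
        (fun w => (coord i v)%:E * ('D_(axis i) f (x + w) / enorm5 w ^+ 3)%:E)%E.
      by apply/funext => w; rewrite /= EFinM.
    exact: integrableZl.
  have RZ i : \int[leb5]_w (coord i v * ('D_(axis i) f (x + w) / enorm5 w ^+ 3)) = coord i v * c i.
    by apply: RintegralZl => //; exact: I.
  apply: (etrans (Rintegral_sum_ord (fun i => Z i)).2).
  by apply: eq_bigr => i _; exact: RZ.
have [r r0 Hr] := test_support tf.
have [C C0 HC] := test_taylor tf.
(* For |v| < 1 the three terms of the remainder all vanish outside the ball of radius r + 2. *)
have r2 : 0 < r + 2 by rewrite ltr_wpDl.
have [M [M0 HM]] := admissible_potential_le r2.
have key v : `|v| < 1 ->
    `|potential 3 f (x + v) - potential 3 f x - \sum_(i < 5) coord i v * c i| <= C * M * `|v| ^+ 2.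
  move=> v1.
  have -> : potential 3 f (x + v) = potential 3 (fun y => f (y + v)) x.
    by apply: eq_Rintegral => w _; rewrite addrAC.
  have asv := admissible_shift v af.
  have aB : admissible (fun y => f (y + v) - f y).
    have [m1 _] := asv; have [m2 _] := af; split; first exact: measurable5B.
    have [B1 [r1 [B10 r10 H1]]] := admissibleE asv; have [B2 [r3 [B20 r20 H2]]] := admissibleE af.
    exists (B1 + B2), (r1 + r3) => y; apply: le_trans (ler_normB _ _) _.
    apply: le_trans (lerD (H1 y) (H2 y)) _.
    case: (ltP `|y| (r1 + r3)) => h; first by apply: lerD; case: ifP.
    have -> : (`|y| < r1) = false by apply/negbTE; rewrite -leNgt (le_trans _ h)// lerDl ltW.
    have -> : (`|y| < r3) = false by apply/negbTE; rewrite -leNgt (le_trans _ h)// lerDr ltW.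
    by rewrite addr0.
  rewrite -Dc -(potentialB _ k3 asv af) -(potentialB _ k3 aB (aD v)).
  apply: le_trans (HM (fun y => f (y + v) - f y - 'D_v f y) (C * `|v| ^+ 2) x _ _ _) _.
  - have [m1 _] := aB; have [m2 _] := aD v; exact: measurable5B.
  - by rewrite mulr_ge0// sqr_ge0.
  - move=> y; case: ifPn => [_|]; first exact: HC.
    rewrite -leNgt => ry.
    have yr : r < `|y| by rewrite (lt_le_trans _ ry)// ltrDl.
    have yv : r < `|y + v|.
      have : `|y| <= `|y + v| + `|v| by rewrite -{1}[y](addrK v) ler_normB.
      move: v1 ry; set a := `|y|; set b := `|v|; set d := `|y + v|; lra.
    by rewrite (Hr _ yv) (Hr _ yr) (derive_support v Hr yr) !subr0 normr0.
  - by rewrite mulrAC.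
pose l w := \sum_(i < 5) coord i w * c i.
have lD u w : l (u + w) = l u + l w.
  by rewrite /l -big_split; apply: eq_bigr => i _; rewrite linearD mulrDl.
pose G w := potential 3 f w - l w.
have [dG DG] : differentiable G x /\ forall v, 'D_v G x = 0.
  apply: (quadratic_differentiable (C := C * M) ltr01) => v v1.
  apply: le_trans (key v v1); rewrite /G lD -/(l v); set a := potential _ _ _; set b := potential _ _ _.
  by rewrite (_ : _ - _ = a - b - l v)//; ring.
have [dl Dl] := affine_derive c x.
have E : potential 3 f = G + l.
  by apply/funext => w; rewrite [RHS](_ : _ = potential 3 f w - l w + l w)// subrK.
rewrite E; split; first exact: differentiableD.
move=> v; rewrite deriveD; [|exact: diff_derivable|exact: diff_derivable].
by rewrite DG add0r Dl Dc.
Qed.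

Lemma newtonian5_test f : test_function f ->
  newtonian5 f = (fun x => (8 * pi ^+ 2)^-1 * potential 3 f x).
Proof. by move=> tf; apply/funext => x; rewrite newtonian5E//; exact: test_measurable5. Qed.

Lemma newtonian5_differentiable f x : test_function f -> differentiable (newtonian5 f) x.
Proof.
move=> tf; rewrite newtonian5_test//; have [dP _] := potential_derive x tf.
exact: differentiableZ.
Qed.

Lemma newtonian5_derive f x v : test_function f ->
  'D_v (newtonian5 f) x = newtonian5 (fun y => 'D_v f y) x.
Proof.
move=> tf; have [dP DP] := potential_derive x tf.
rewrite (newtonian5_test tf) (newtonian5_test (test_derive v tf)) -DP.
exact: (deriveZ (8 * pi ^+ 2)^-1 (diff_derivable dP)).
Qed.

Lemma newtonian5_smooth f : test_function f -> smooth_on setT (newtonian5 f).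
Proof.
move=> tf.
apply: (@smooth_on_class R setT (fun h => exists2 f, test_function f & h = newtonian5 f)).
- exact: openT.
- by move=> _ [h th ->] x _; exact: newtonian5_differentiable.
- move=> _ v [h th ->]; exists (newtonian5 (fun y => 'D_v h y)).
    by exists (fun y => 'D_v h y) => //; exact: test_derive.
  by move=> x _; rewrite newtonian5_derive.
- by exists f.
Qed.

End potential_smooth.

(** * Integration by parts against regular kernels *)

Section integration_by_parts.
Context {R : realType}.
Notation mR := (measurableTypeR R).
Notation leb := (@lebesgue_measure R).
Notation X := (R5 mR).
Implicit Types (f g : R5 R -> R) (x v w e : R5 R).

Lemma integral_derivative_compact (phi dphi : R -> R) (r : R) :
  (forall t : R, is_derive t (1 : R) phi (dphi t)) -> continuous dphi ->
  (forall t : R, r < `|t| -> phi t = 0) -> (forall t : R, r < `|t| -> dphi t = 0) ->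
  leb.-integrable setT (EFin \o dphi) /\ (\int[leb]_t (dphi t)%:E = 0)%E.
Proof.
move=> dp cd p0 d0.
pose a := `|r| + 1.
have ra : r < a by rewrite /a (le_lt_trans (ler_norm r))// ltrDl.
have a0 : 0 < a by rewrite /a ltr_wpDl.
have out t : t \notin `[- a, a] -> dphi t = 0.
  rewrite in_itv/= -ler_norml -ltNge => at_; apply: d0; exact: lt_trans at_.
have E : EFin \o dphi = (EFin \o dphi) \_ `[- a, a].
  apply/funext => t; rewrite patchE; case: ifPn => // ta.
  by rewrite /= out//; apply: contra ta => ta; apply/mem_set.
have I : leb.-integrable `[- a, a] (EFin \o dphi).
  apply: continuous_compact_integrable; first exact: segment_compact.
  exact: continuous_subspaceT.
have aa : - a < a by rewrite gtrN.
have cp : continuous phi.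
  move=> t; apply: differentiable_continuous; apply/derivable1_diffP; by have [] := dp t.
split.
  by rewrite E; apply/(integrable_mkcond _ _).1.
transitivity (\int[leb]_(t in `[(- a)%R, a]) (dphi t)%:E)%E.
  by rewrite [RHS]integral_mkcond; apply: eq_integral => t _; exact: (congr1 (fun k => k t) E).
rewrite (@continuous_FTC2 _ dphi phi)//.
- by rewrite !p0 ?subee// ?normrN ger0_norm// ltW.
- exact: continuous_subspaceT.
- split; first by move=> t _; have [] := dp t.
    by apply: cvg_at_right_filter; exact: cp.
  by apply: cvg_at_left_filter; exact: cp.
- by move=> t _; rewrite derive1E; have [] := dp t.
Qed.

Lemma integral_pos_neg d (T : measurableType d) (mu : {measure set T -> \bar R}) (h : T -> R) :
  mu.-integrable setT (EFin \o h) -> (\int[mu]_t (h t)%:E = 0)%E ->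
  (\int[mu]_t ((EFin \o h)^\+ t) = \int[mu]_t ((EFin \o h)^\- t))%E.
Proof.
move=> I; rewrite integralE => H.
have f1 : (\int[mu]_t ((EFin \o h)^\+ t))%E \is a fin_num.
  rewrite ge0_fin_numE; first exact: integral_funepos_lt_pinfty.
  exact: integral_ge0.
have f2 : (\int[mu]_t ((EFin \o h)^\- t))%E \is a fin_num.
  rewrite ge0_fin_numE; first exact: integral_funeneg_lt_pinfty.
  exact: integral_ge0.
move: H f1 f2; set a := integral _ _ _; set b := integral _ _ _.
change ((a - b = 0)%E -> a \is a fin_num -> b \is a fin_num -> a = b).
case: a b => [a| |] [b| |]//; rewrite -EFinB => -[/eqP]; rewrite subr_eq0 => /eqP -> //.
Qed.

(** Derivatives of compactly supported functions have integral 0, for one direction at a time. Only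
    lines parallel to [e] occur, so the statement can be proved along the last axis and
    transported. *)
Definition null_along (e : R5 R) := forall (F F' : R5 R -> R) (r : R),
  measurable5 F' ->
  (forall x t, is_derive t (1 : R) (fun s : R => F (x + s *: e)) (F' (x + t *: e))) ->
  (forall x, continuous (fun s : R => F' (x + s *: e))) ->
  (forall x, r < `|x| -> F x = 0) -> (forall x, r < `|x| -> F' x = 0) ->
  \int[leb5]_w F' w = 0.

Lemma null_along_last : null_along (0, 0, 0, 0, 1).
Proof.
move=> F F' r mF' dF cF' F0 F'0.
have line (y : R4 R) (t : R) : (y, 0) + t *: ((0, 0, 0, 0, 1) : R5 R) = (y, t).
  case: y => [[[a b] c] d].
  rewrite [LHS](_ : _ = (a + t * 0, b + t * 0, c + t * 0, d + t * 0, 0 + t * 1))//.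
  by rewrite !mulr0 !addr0 add0r mulr1.
have H (y : R4 R) : leb.-integrable setT (EFin \o (fun t => F' (y, t))) /\
    (\int[leb]_t (F' (y, t))%:E = 0)%E.
  have nr t : r < `|t| -> r < `|(y, t)|.
    by move=> /lt_le_trans; apply; rewrite prod_normE/= le_max lexx orbT.
  apply: (@integral_derivative_compact (fun t => F (y, t)) _ r).
  - move=> t; have := dF (y, 0) t; rewrite line.
    by under [X in is_derive _ _ X]eq_fun do rewrite line.
  - by have := cF' (y, 0); under eq_fun do rewrite line.
  - by move=> t rt; apply: F0; exact: nr.
  - by move=> t rt; apply: F'0; exact: nr.
have me : measurable_fun [set: X] (EFin \o F' : X -> \bar R) by exact/measurable_EFinP.
(* On each fibre the positive and negative parts have equal integrals, and Tonelli integrates both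
   equalities over the remaining coordinates. *)
have PN : (\int[leb5]_w (EFin \o (F' : X -> R))^\+ w = \int[leb5]_w (EFin \o (F' : X -> R))^\- w)%E.
  have mp := measurable_funepos me; have mn := measurable_funeneg me.
  apply: (etrans (tonelli_fst mp (fun w => funepos_ge0 _ w))).
  apply: (etrans _ (esym (tonelli_fst mn (fun w => funeneg_ge0 _ w)))).
  apply: eq_integral => y _.
  have [I Z] := H y; have PN := integral_pos_neg I Z.
  by apply: (etrans (etrans _ PN)); apply: eq_integral => t _; rewrite ?funeposE ?funenegE.
rewrite /Rintegral integralE.
set a := (X in fine (X - _)); set b := (X in fine (_ - X)).
have -> : a = b by exact: PN.
(* Should both parts be infinite, their difference is infinite and [fine] sends it to 0. *)
by case: b => //= z; rewrite subrr.
Qed.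

(** Adjacent transpositions preserve Lebesgue measure and the max norm, so they carry the last axis
    to each of the others. *)
Lemma null_along_image (s : R5 R -> R5 R) e e' :
  measure_preserving leb5 (s : X -> X) ->
  (forall x t, s (x + t *: e) = s x + t *: e') ->
  (forall x, `|s x| = `|x|) -> null_along e -> null_along e'.
Proof.
move=> ms sl sn ne F F' r mF' dF cF' F0 F'0.
rewrite -(Rintegral_measure_preserving ms mF').
apply: (ne (F \o s) _ r).
- exact: measurable5_preserving.
- move=> x t; rewrite sl.
  rewrite (_ : (fun u : R => (F \o s) (x + u *: e)) = (fun u => F (s x + u *: e'))) //.
  by apply/funext => u; rewrite /= sl.
- move=> x; rewrite (_ : (fun u : R => F' (s (x + u *: e))) = (fun u => F' (s x + u *: e'))) //.
  by apply/funext => u; rewrite sl.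
- by move=> x rx; apply: F0; rewrite sn.
- by move=> x rx; apply: F'0; rewrite sn.
Qed.

Lemma null_along_axis i : null_along (@axis R i).
Proof.
have n5 := null_along_last.
have n4 : null_along (0, 0, 0, 1, 0).
  apply: (null_along_image measure_preserving_swap45 _ _ n5).
    by move=> [[[[a b] c] d] e] t.
  by move=> [[[[a b] c] d] e]; rewrite !prod_normE/= maxAC.
have n3 : null_along (0, 0, 1, 0, 0).
  apply: (null_along_image measure_preserving_swap34 _ _ n4).
    by move=> [[[[a b] c] d] e] t.
  by move=> [[[[a b] c] d] e]; rewrite !prod_normE/= (maxAC _ `|d|).
have n2 : null_along (0, 1, 0, 0, 0).
  apply: (null_along_image measure_preserving_swap23 _ _ n3).
    by move=> [[[[a b] c] d] e] t.
  by move=> [[[[a b] c] d] e]; rewrite !prod_normE/= (maxAC _ `|c|).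
have n1 : null_along (1, 0, 0, 0, 0).
  apply: (null_along_image measure_preserving_swap12 _ _ n2).
    by move=> [[[[a b] c] d] e] t.
  by move=> [[[[a b] c] d] e]; rewrite !prod_normE/= (maxC `|b|).
by case: i => [[|[|[|[|[|//]]]]]].
Qed.

Lemma admissible_compact f : continuous f ->
  (exists2 K : set (R5 R), compact K & supported_in K f) -> admissible f.
Proof.
move=> cf [K cK sK]; split; first exact: continuous_measurable5.
have cKf : {within K, continuous f} by exact: continuous_subspaceT.
have /compact_bounded[M [_ HM]] := continuous_compact cKf cK.
have /compact_bounded[r [_ Hr]] := cK.
have M1 : M < `|M| + 1 by rewrite (le_lt_trans (ler_norm M))// ltrDl.
have r1 : r < `|r| + 1 by rewrite (le_lt_trans (ler_norm r))// ltrDl.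
exists (`|M| + 1), (`|r| + 2) => x; case: ifPn => [_|xr].
  have [Kx|nKx] := pselect (K x); first by apply: (HM _ M1); exists x.
  by rewrite sK// normr0 addr_ge0.
rewrite sK ?normr0// => Kx; have /= := Hr _ r1 x Kx; apply/negP; rewrite -ltNge.
by rewrite (lt_le_trans _ (_ : `|r| + 2 <= _))// ?ltrD2l ?ltr1n// leNgt.
Qed.

Lemma admissible_summable f : admissible f -> leb5.-integrable setT (fun w : X => (f w)%:E).
Proof.
move=> af; have [B [r [B0 r0 fB]]] := admissibleE af; have [mf _] := af.
apply/integrableP; split; first exact/measurable_EFinP.
apply: (@le_lt_trans _ _ (B%:E * \int[leb5]_w (ball_one r w)%:E)%E); last first.
  rewrite lte_mul_pinfty// ?lee_fin//; exact: integral_ball_indicator.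
have [mb b0 _] := ball_indicator_L2 r0.
rewrite -ge0_integralZl//; first last.
- by move=> w _; rewrite lee_fin.
- exact/measurable_EFinP.
apply: ge0_le_integral => //.
- by apply/measurable_EFinP; exact: measurable5_norm.
- by apply: measurable_funeM; exact/measurable_EFinP.
- move=> w _; rewrite -EFinM lee_fin (le_trans (fB w))// /ball_one.
  by case: ifP; rewrite ?mulr1 ?mulr0.
Qed.

Lemma translate_compact_support f x (K : R5 R -> R) :
  (exists2 A : set (R5 R), compact A & supported_in A f) ->
  exists2 A : set (R5 R), compact A & supported_in A (fun w => f (x + w) * K w).
Proof.
move=> [A cA sA]; exists [set y - x | y in A].
  apply: continuous_compact => //; apply: continuous_subspaceT => y.
  by apply: cvgB; [exact: cvg_id|exact: cvg_cst].
move=> w nw; rewrite sA ?mul0r// => Axw; apply: nw; exists (x + w) => //.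
by rewrite addrAC subrr add0r.
Qed.

Lemma admissible_test_mul f x (K : R5 R -> R) : test_function f -> continuous K ->
  admissible (fun w => f (x + w) * K w).
Proof.
move=> tf cK; apply: admissible_compact; last first.
  by apply: translate_compact_support; have [] := tf.
move=> w; apply: cvgM; last exact: cK.
apply: (@cvg_comp _ _ _ (fun w : R5 R => x + w) f).
  by apply: cvgD; [exact: cvg_cst|exact: cvg_id].
exact: test_continuous.
Qed.

Lemma admissible_off f : admissible f -> exists r, forall x, r < `|x| -> f x = 0.
Proof.
move=> /admissibleE[B [r [_ _ H]]]; exists r => x rx; have := H x.
by rewrite ltNge (ltW rx)/= normr_le0 => /eqP.
Qed.

(** No boundary term appears, whatever the growth of [K], because the product has the compact
    support of the translated [f]. *)
Lemma ibp_kernel i f (K K' : R5 R -> R) x : test_function f ->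
  continuous K -> continuous K' ->
  (forall w t, is_derive t (1 : R) (fun s : R => K (w + s *: axis i)) (K' (w + t *: axis i))) ->
  \int[leb5]_w ('D_(axis i) f (x + w) * K w) = - \int[leb5]_w (f (x + w) * K' w).
Proof.
move=> tf cK cK' dK; have tdf := test_derive (axis i) tf.
have a1 := admissible_test_mul x tdf cK; have a2 := admissible_test_mul x tf cK'.
have a0 := admissible_test_mul x tf cK.
have [r0 H0] := admissible_off a0; have [r1 H1] := admissible_off a1.
have [r2 H2] := admissible_off a2.
pose r := Num.max r0 (Num.max r1 r2).
have := @null_along_axis i (fun w => f (x + w) * K w)
  (fun w => 'D_(axis i) f (x + w) * K w + f (x + w) * K' w) r.
rewrite RintegralD//; try exact: admissible_summable.
move=> H; apply/eqP; rewrite -addr_eq0; apply/eqP; apply: H.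
- by apply: measurable5D; [have [] := a1|have [] := a2].
- move=> w t.
  have d1 : is_derive t (1 : R) (fun s : R => f (x + (w + s *: axis i)))
      ('D_(axis i) f (x + (w + t *: axis i))).
    rewrite addrA; under eq_fun do rewrite addrA.
    by apply: is_derive_line; exact: test_differentiable.
  apply: (is_derive_eq (is_deriveM d1 (dK w t))).
  by rewrite /GRing.scale/= addrC [X in X + _]mulrC.
- move=> w t.
  have cl : {for t, continuous (fun s : R => w + s *: axis i)}.
    by apply: cvgD; [exact: cvg_cst|apply: cvgZr_tmp; exact: cvg_id].
  have cx : {for t, continuous (fun s : R => x + (w + s *: axis i))}.
    by apply: cvgD; [exact: cvg_cst|].
  have along (z : R -> R5 R) (g : R5 R -> R) : {for t, continuous z} -> continuous g ->
      {for t, continuous (fun s : R => g (z s))}.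
    by move=> cz cg; exact: (continuous_comp cz (cg (z t))).
  apply: cvgD; apply: cvgM.
  + exact: (along _ _ cx (test_continuous tdf)).
  + exact: (along _ _ cl cK).
  + exact: (along _ _ cx (test_continuous tf)).
  + exact: (along _ _ cl cK').
- by move=> w rw; apply: H0; rewrite (le_lt_trans _ rw)// /r le_max lexx.
- move=> w rw; rewrite H1 ?H2 ?addr0//; apply: (le_lt_trans _ rw).
    by rewrite /r !le_max lexx !orbT.
  by rewrite /r !le_max lexx !orbT.
Qed.

Definition bump_power (e p : R) w : R := (e + sqn w) `^ p.

Lemma sqn_axis i w (t : R) : sqn (w + t *: axis i) = (sqn w - coord i w ^+ 2) + (coord i w + t) ^+ 2.
Proof.
case: w => [[[[a b] c] d] e].
by case: i => [[|[|[|[|[|//]]]]]] ?; rewrite /sqn /coord /axis /= /GRing.scale/=; ring.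
Qed.

Lemma coord_sqr_le i w : coord i w ^+ 2 <= sqn w.
Proof.
case: w => [[[[a b] c] d] e].
have p (u : R) := sqr_ge0 u.
case: i => [[|[|[|[|[|//]]]]]] ?; rewrite /sqn /coord /=;
 by move: (p a) (p b) (p c) (p d) (p e); lra.
Qed.

Lemma coord_shift i w (t : R) : coord i (w + t *: axis i) = coord i w + t.
Proof.
case: w => [[[[a b] c] d] e].
by case: i => [[|[|[|[|[|//]]]]]] ?; rewrite /coord /axis /= /GRing.scale/= mulr1.
Qed.

Lemma continuous_bump_power (e p : R) : 0 < e -> continuous (bump_power e p).
Proof.
move=> e0.
rewrite (_ : bump_power e p = (fun t => (e + t ^+ 2) `^ p) \o (@enorm5 R)).
  by move=> w; apply: continuous_comp; [exact: cont_enorm5|exact: continuous_addsqr_powR].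
by apply/funext => w; rewrite /bump_power /= enorm5_sqr.
Qed.

(** Along an axis, e + |w|^2 is a positive constant plus the square of the moving coordinate, which
    is the one-variable case [is_derive_addsqr_powR]. *)
Lemma bump_power_line (e p : R) i w (t : R) : 0 < e ->
  is_derive t (1 : R) (fun s : R => bump_power e p (w + s *: axis i))
    (2 * p * coord i (w + t *: axis i) * bump_power e (p - 1) (w + t *: axis i)).
Proof.
move=> e0; have b0 : 0 < e + (sqn w - coord i w ^+ 2).
  by rewrite ltr_pwDl// subr_ge0 coord_sqr_le.
rewrite (_ : (fun s : R => _) =
    (fun u : R => (e + (sqn w - coord i w ^+ 2) + u ^+ 2) `^ p) \o (fun s => coord i w + s)).
  have d1 := is_derive_addsqr_powR p (coord i w + t) b0.
  have d2 : is_derive t (1 : R) (fun s : R => coord i w + s) 1.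
    apply: (is_derive_eq (is_deriveD (is_derive_cst (coord i w : R) t 1) (is_derive_id t (1 : R)))).
    by rewrite add0r.
  apply: (is_derive_eq (is_derive1_comp d1 d2)).
  by rewrite mulr1 /bump_power coord_shift sqn_axis -addrA.
by apply/funext => s; rewrite /bump_power /= sqn_axis addrA.
Qed.

End integration_by_parts.

(** * The derivative bound and the Poisson equation *)

Section poisson_equation.
Context {R : realType}.
Notation mR := (measurableTypeR R).
Notation X := (R5 mR).
Implicit Types (f g : R5 R -> R) (x v w : R5 R) (e : R).

(** The domination is almost everywhere because the inverse of 0 is 0: at the origin the bound of
    [kernel3_smooth] would read e^-3 <= 0. *)
Lemma norm_Rintegral_ae_le d (T : measurableType d) (mu : {measure set T -> \bar R})
    (f g : T -> R) :
  mu.-integrable setT (EFin \o f) -> mu.-integrable setT (EFin \o g) -> (forall t, 0 <= g t) ->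
  {ae mu, forall t, `|f t| <= g t} -> `|\int[mu]_t f t| <= \int[mu]_t g t.
Proof.
move=> If Ig g0 fg; apply: (le_trans (le_normr_Rintegral _ If)) => //.
have IN : mu.-integrable setT (EFin \o (fun t => `|f t|)) := integrable_norm If.
rewrite -lee_fin /Rintegral !fineK; try exact: integrable_fin_num.
apply: ae_ge0_le_integral => //.
- exact: measurable_int IN.
- by move=> t _; rewrite lee_fin.
- exact: measurable_int Ig.
by apply: filterS fg => t H _; rewrite lee_fin.
Qed.

Lemma measurable5_preimage f (A : set mR) : measurable5 f -> measurable A ->
  measurable ((f : X -> mR) @^-1` A).
Proof. by move=> mf mA; rewrite -[_ @^-1` _]setTI; exact: (mf measurableT _ mA). Qed.

Lemma measurable_point0 : measurable [set 0 : X].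
Proof.
rewrite (_ : [set 0 : X] = (@enorm5 R : X -> mR) @^-1` [set 0]).
  exact: (measurable5_preimage (continuous_measurable5 (@cont_enorm5 R)) (measurable_set1 _)).
apply/seteqP; split => w /=; first by move=> ->; apply/eqP; rewrite enorm5_eq0.
by move=> /eqP; rewrite enorm5_eq0 => /eqP.
Qed.

Lemma leb5_point : leb5 [set 0 : X] = 0%E.
Proof.
have m0 := measurable_point0.
apply/eqP; rewrite eq_le measure_ge0 andbT; apply/lee_addgt0Pr => e e0; rewrite add0e.
pose r := Num.min 1 (e / 64) / 2.
have rm : 0 < Num.min 1 (e / 64) by rewrite lt_min ltr01/= divr_gt0.
have r0 : 0 < r by rewrite divr_gt0.
have mb : measurable [set w : X | `|w : R5 R| < r].
  rewrite (_ : [set w : X | _] = (fun w : X => `|w : R5 R| : mR) @^-1` [set y : R | y < r])//.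
  apply: measurable5_preimage.
    by apply: continuous_measurable5 => w; exact: norm_continuous.
  by rewrite -set_itvNyo; exact: measurable_itv.
apply: (@le_trans _ _ (leb5 [set w : X | `|w : R5 R| < r])).
  by apply: le_measure; rewrite ?inE//; move=> w /= ->; rewrite normr0.
rewrite (leb5_ball (ltW r0)) lee_fin (_ : 2 * r = Num.min 1 (e / 64)); last by rewrite /r; field.
apply: (@le_trans _ _ (Num.min 1 (e / 64))).
  have m1 : Num.min 1 (e / 64) <= 1 by rewrite ge_min lexx.
  have rm0 := ltW rm; rewrite exprS; apply: ler_piMr => //; exact: exprn_ile1.
by rewrite ge_min; apply/orP; right; rewrite ler_pdivrMr// ler_peMr ?ler1n// ltW.
Qed.

Definition smooth_norm e w := Num.sqrt (e ^+ 2 + sqn w).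

Lemma smooth_norm_gt0 e w : 0 < e -> 0 < smooth_norm e w.
Proof. by move=> e0; rewrite sqrtr_gt0 ltr_pwDl ?sqn_ge0// exprn_gt0. Qed.

Lemma smooth_norm_sqr e w : smooth_norm e w ^+ 2 = e ^+ 2 + sqn w.
Proof. by rewrite sqr_sqrtr// addr_ge0 ?sqn_ge0 ?sqr_ge0. Qed.

Lemma enorm5_le_smooth_norm e w : 0 < e -> enorm5 w <= smooth_norm e w.
Proof. by move=> e0; rewrite enorm5E ler_wsqrtr// lerDr sqr_ge0. Qed.

Lemma smooth_norm_le e w : 0 < e -> smooth_norm e w <= enorm5 w + e.
Proof.
move=> e0; have n0 := @enorm5_ge0 R w.
rewrite -(ler_pXn2r (_ : (0 < 2)%N))// ?nnegrE ?sqrtr_ge0 ?addr_ge0 ?(ltW e0)//.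
rewrite smooth_norm_sqr -enorm5_sqr; have := mulr_ge0 n0 (ltW e0); nra.
Qed.

Lemma bump_powerE e k w : 0 < e ->
  bump_power (e ^+ 2) (- (k%:R / 2)) w = (smooth_norm e w ^+ k)^-1.
Proof.
move=> e0; have q0 : 0 <= e ^+ 2 + sqn w by rewrite addr_ge0 ?sqn_ge0 ?sqr_ge0.
rewrite /bump_power powRN; congr (_^-1).
by rewrite mulrC powRrM powR12_sqrt// powR_mulrn ?sqrtr_ge0.
Qed.

Lemma coord_le_smooth_norm e i w : 0 < e -> `|coord i w| <= smooth_norm e w.
Proof.
move=> e0; rewrite -sqrtr_sqr ler_wsqrtr//.
by rewrite (le_trans (coord_sqr_le i w))// lerDr sqr_ge0.
Qed.

(** With n = |w| and s the smooth norm, factor s^3 - n^3. Then s - n <= e, and s^2 + s n + n^2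
    multiplied by n is at most 3 s^3. *)
Lemma kernel3_smooth e w : 0 < e -> w != 0 ->
  `|(enorm5 w ^+ 3)^-1 - (smooth_norm e w ^+ 3)^-1| <= 3 * e * (enorm5 w ^+ 4)^-1.
Proof.
move=> e0 w0; have n0 : 0 < enorm5 w by rewrite lt_neqAle enorm5_ge0 andbT eq_sym enorm5_eq0.
have s0 := smooth_norm_gt0 w e0; have ns := enorm5_le_smooth_norm w e0.
have sn := smooth_norm_le w e0.
move: n0 s0 ns sn; set n := enorm5 w; set s := smooth_norm e w => n0 s0 ns sn.
have n0' := ltW n0; have s0' := ltW s0.
have h3 : n ^+ 3 <= s ^+ 3 by rewrite ler_pXn2r// nnegrE.
have h2 : n ^+ 2 <= s ^+ 2 by rewrite ler_pXn2r// nnegrE.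
have h1 : s * n <= s ^+ 2 by rewrite expr2 ler_pM2l.
rewrite ger0_norm; last by rewrite subr_ge0 lef_pV2// posrE exprn_gt0.
rewrite (_ : _ - _ = (s - n) * (s ^+ 2 + s * n + n ^+ 2) * (s ^+ 3)^-1 * (n ^+ 3)^-1); last first.
  by field; rewrite !gt_eqF.
rewrite (_ : 3 * e * _ = e * (3 * s ^+ 3) * (s ^+ 3)^-1 / n * (n ^+ 3)^-1); last first.
  by field; rewrite !gt_eqF.
rewrite ler_pM2r ?invr_gt0 ?exprn_gt0// ler_pdivlMr//.
rewrite [X in X <= _]mulrAC ler_pM2r ?invr_gt0 ?exprn_gt0// -mulrA.
apply: ler_pM; rewrite ?subr_ge0//.
- by rewrite mulr_ge0 ?addr_ge0 ?sqr_ge0 ?mulr_ge0.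
- by rewrite lerBlDr addrC.
- rewrite exprS mulrCA mulrC; apply: ler_pM => //; last by lra.
  by rewrite ?addr_ge0 ?sqr_ge0 ?mulr_ge0.
Qed.

Let k3 : (3 = 3)%N \/ (3 = 4)%N. Proof. by left. Qed.
Let k4 : (4 = 3)%N \/ (4 = 4)%N. Proof. by right. Qed.

Lemma admissible_norm f : admissible f -> admissible (fun x => `|f x|).
Proof.
move=> [mf [B [r H]]]; split; first exact: measurable5_norm.
by exists B, r => x; rewrite normr_id.
Qed.

Lemma admissible_smooth_norm k f x e : test_function f -> 0 < e ->
  admissible (fun w => f (x + w) * (smooth_norm e w ^+ k)^-1).
Proof.
move=> tf e0; rewrite (_ : (fun w => _) =
    fun w => f (x + w) * bump_power (e ^+ 2) (- (k%:R / 2)) w).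
  by apply: admissible_test_mul => //; apply: continuous_bump_power; rewrite exprn_gt0.
by apply/funext => w; rewrite bump_powerE.
Qed.

Lemma potential_approx f x e : test_function f -> 0 < e ->
  `|potential 3 f x - \int[leb5]_w (f (x + w) * (smooth_norm e w ^+ 3)^-1)|
  <= 3 * e * potential 4 (fun y => `|f y|) x.
Proof.
move=> tf e0; have af := admissible_test tf.
have I1 := admissible_integrable x k3 af.
have I4 := admissible_integrable x k4 (admissible_norm af).
have I2 := admissible_summable (admissible_smooth_norm 3 x tf e0).
rewrite /potential -RintegralB// -RintegralZl//.
apply: norm_Rintegral_ae_le.
- by have := integrableB measurableT I1 I2; apply: eq_integrable.
- by have := integrableZl measurableT (3 * e) I4; apply: eq_integrable.
- by move=> w; rewrite !mulr_ge0 ?invr_ge0 ?exprn_ge0 ?enorm5_ge0// ltW.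
exists [set 0 : X]; split.
- exact: measurable_point0.
- exact: leb5_point.
move=> w /= H; apply/eqP; apply: contrapT => /negP w0; apply: H.
rewrite -mulrBr normrM mulrCA; apply: ler_wpM2l => //.
exact: kernel3_smooth.
Qed.

Lemma continuous_smooth_normV k e : 0 < e -> continuous (fun w => (smooth_norm e w ^+ k)^-1).
Proof.
move=> e0; rewrite (_ : (fun w => _) = bump_power (e ^+ 2) (- (k%:R / 2))).
  by apply: continuous_bump_power; rewrite exprn_gt0.
by apply/funext => w; rewrite bump_powerE.
Qed.

Lemma smooth_norm_line k e i w (t : R) : 0 < e ->
  is_derive t (1 : R) (fun s : R => (smooth_norm e (w + s *: axis i) ^+ k)^-1)
    (- (k%:R * coord i (w + t *: axis i) * (smooth_norm e (w + t *: axis i) ^+ k.+2)^-1)).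
Proof.
move=> e0; rewrite (_ : (fun s : R => _) =
    fun s => bump_power (e ^+ 2) (- (k%:R / 2)) (w + s *: axis i)); last first.
  by apply/funext => u; rewrite bump_powerE.
have e2 : 0 < e ^+ 2 by rewrite exprn_gt0.
apply: (is_derive_eq (bump_power_line (- (k%:R / 2)) i w t e2)).
rewrite -bump_powerE// (_ : - (k%:R / 2) - 1 = - (k.+2%:R / 2)); last by rewrite -!natr1; field.
by field.
Qed.

Lemma continuous_coord i : continuous (@coord R i).
Proof. by move=> w; apply: differentiable_continuous; exact: coord_differentiable. Qed.

Lemma ibp_smooth_norm i f x e : test_function f -> 0 < e ->
  \int[leb5]_w ('D_(axis i) f (x + w) * (smooth_norm e w ^+ 3)^-1) =
  \int[leb5]_w (f (x + w) * (3 * coord i w * (smooth_norm e w ^+ 5)^-1)).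
Proof.
move=> tf e0.
have cK' : continuous (fun w => - (3 * coord i w * (smooth_norm e w ^+ 5)^-1)).
  move=> w; apply: cvgN; apply: cvgM; last exact: continuous_smooth_normV.
  by apply: cvgM; [exact: cvg_cst|exact: continuous_coord].
have H := ibp_kernel x tf (@continuous_smooth_normV 3 e e0) cK' (fun w t => @smooth_norm_line 3 e i w t e0).
rewrite {}H.
rewrite -mulN1r -RintegralZl//; last by apply: admissible_summable; exact: admissible_test_mul.
by apply: eq_Rintegral => w _; rewrite mulN1r -mulrN opprK.
Qed.

Lemma ibp_smooth_norm2 i f x e : test_function f -> 0 < e ->
  \int[leb5]_w ('D_(axis i) f (x + w) * (3 * coord i w * (smooth_norm e w ^+ 5)^-1)) =
  \int[leb5]_w (f (x + w) * (15 * coord i w ^+ 2 * (smooth_norm e w ^+ 7)^-1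
                             - 3 * (smooth_norm e w ^+ 5)^-1)).
Proof.
move=> tf e0.
pose K' w := 3 * (smooth_norm e w ^+ 5)^-1 - 15 * coord i w ^+ 2 * (smooth_norm e w ^+ 7)^-1.
have cK' : continuous K'.
  move=> w; apply: cvgB.
    by apply: cvgM; [exact: cvg_cst|exact: continuous_smooth_normV].
  apply: cvgM; last exact: continuous_smooth_normV.
  apply: cvgM; first exact: cvg_cst.
  exact: (cvg_comp _ _ (@continuous_coord i w) (@exprn_continuous _ 2 (coord i w))).
have cK : continuous (fun w => 3 * coord i w * (smooth_norm e w ^+ 5)^-1).
  move=> w; apply: cvgM; last exact: continuous_smooth_normV.
  by apply: cvgM; [exact: cvg_cst|exact: continuous_coord].
have dK w (t : R) : is_derive t (1 : R) (fun s : R =>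
    3 * coord i (w + s *: axis i) * (smooth_norm e (w + s *: axis i) ^+ 5)^-1) (K' (w + t *: axis i)).
  have d1 : is_derive t (1 : R) (fun s : R => 3 * coord i (w + s *: axis i)) 3.
    rewrite (_ : (fun s : R => _) = (fun s : R => 3 * coord i w + 3 * s)); last first.
      by apply/funext => s; rewrite coord_shift mulrDr.
    apply: (is_derive_eq (is_deriveD (is_derive_cst (3 * coord i w : R) t 1)
      (is_deriveZ (3 : R) (is_derive_id t (1 : R))))).
    by rewrite add0r /GRing.scale/= mulr1.
  apply: (is_derive_eq (is_deriveM d1 (@smooth_norm_line 5 e i w t e0))).
  by rewrite /K' /GRing.scale/=; ring.
apply: (etrans (ibp_kernel x tf cK cK' dK)).
rewrite -mulN1r -RintegralZl//; last by apply: admissible_summable; exact: admissible_test_mul.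
by apply: eq_Rintegral => w _; rewrite mulN1r -mulrN opprB.
Qed.

(** In the main term the derivative is moved to the regularized kernel, where 3 |w_5| s^-5 <= 3 s^-4
    <= 3 |w|^-4; in the error term it stays on f, and the factor e removes it in the limit. *)
Lemma potential_dz f x : test_function f ->
  `|potential 3 (dz f) x| <= 3 * potential 4 (fun y => `|f y|) x.
Proof.
move=> tf; have af := admissible_test tf.
have tdf : test_function (dz f) by exact: test_derive.
pose S := potential 4 (fun y => `|dz f y|) x.
have S0 : 0 <= S.
  by apply: Rintegral_ge0 => w _; rewrite mulr_ge0 ?invr_ge0 ?exprn_ge0 ?enorm5_ge0.
have I4 := admissible_integrable x k4 (admissible_norm af).
have main e : 0 < e -> `|potential 3 (dz f) x| <= 3 * potential 4 (fun y => `|f y|) x + e * (3 * S).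
  move=> e0; pose J := \int[leb5]_w (dz f (x + w) * (smooth_norm e w ^+ 3)^-1).
  rewrite -[potential 3 _ _](subrK J).
  apply: (le_trans (ler_normD _ _)); rewrite addrC; apply: lerD; last first.
    by apply: (le_trans (potential_approx x tdf e0)); rewrite -/S mulrAC mulrC mulrA.
  rewrite /J (ibp_smooth_norm ord_max)// /potential -RintegralZl//.
  apply: norm_Rintegral_ae_le.
  - apply: admissible_summable; apply: admissible_test_mul => //.
    move=> w; apply: cvgM; last exact: continuous_smooth_normV.
    by apply: cvgM; [exact: cvg_cst|exact: continuous_coord].
  - by have := integrableZl measurableT 3 I4; apply: eq_integrable.
  - by move=> w; rewrite !mulr_ge0 ?invr_ge0 ?exprn_ge0 ?enorm5_ge0.
  apply: aeW => w; rewrite !normrM [X in _ * (X * _ * _)]ger0_norm// -!mulrA mulrCA.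
  rewrite ler_pM2l// ler_wpM2l//.
  (* At the origin the right-hand side is 0, and so is the coordinate on the left. *)
  have [->|w0] := eqVneq w 0.
    by rewrite /coord /= normr0 mul0r invr_ge0 exprn_ge0 ?enorm5_ge0.
  have n0 : 0 < enorm5 w by rewrite lt_neqAle enorm5_ge0 andbT eq_sym enorm5_eq0.
  have s0 := smooth_norm_gt0 w e0; have ns := enorm5_le_smooth_norm w e0.
  apply: (@le_trans _ _ (smooth_norm e w ^+ 4)^-1).
    rewrite [X in _ * X]ger0_norm ?invr_ge0 ?exprn_ge0 ?(ltW s0)// ler_pdivrMr ?exprn_gt0//.
    rewrite (_ : _^-1 * _ = smooth_norm e w); first exact: coord_le_smooth_norm.
    by field; rewrite gt_eqF.
  by rewrite lef_pV2 ?posrE ?exprn_gt0// ler_pXn2r// nnegrE ltW.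
apply/ler_addgt0Pr => e e0; have d0 : 0 < 3 * S + 1 by rewrite ltr_wpDl ?mulr_ge0.
apply: (le_trans (main _ (divr_gt0 e0 d0))); rewrite lerD2l mulrAC ler_pdivrMr//.
by rewrite ler_pM2l// lerDl.
Qed.

Lemma integral_smooth_norm7 e : 0 < e ->
  (\int[leb5]_w ((smooth_norm e w ^+ 7)^-1)%:E = (8 * (pi : R) ^+ 2 / 15 * (e ^+ 2)^-1)%:E)%E.
Proof.
move=> e0; have e2 : 0 < e ^+ 2 by rewrite exprn_gt0.
rewrite -(integral_poisson_kernel e2); apply: eq_integral => w _.
by rewrite -bump_powerE.
Qed.

Lemma integral_smooth_norm6 : exists2 C : R, 0 <= C & forall e, 0 < e ->
  (\int[leb5]_w ((smooth_norm e w ^+ 6)^-1)%:E = (C / e)%:E)%E.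
Proof.
have [C C0 HC] := @integral_poisson_tail R; exists C => // e e0.
have e2 : 0 < e ^+ 2 by rewrite exprn_gt0.
have -> : e^-1 = (e ^+ 2) `^ (- (1 / 2)).
  by rewrite mul1r powRN powR12_sqrt ?sqrtr_sqr ?ger0_norm// ltW.
rewrite -(HC _ e2); apply: eq_integral => w _.
rewrite -bump_powerE// /bump_power; congr (_ `^ _)%:E.
by congr (- _); field.
Qed.

Lemma summable_smooth_norm k e : (k = 6%N) \/ (k = 7%N) -> 0 < e ->
  leb5.-integrable setT (fun w : X => ((smooth_norm e w ^+ k)^-1)%:E).
Proof.
move=> k67 e0; apply/integrableP; split.
  by apply/measurable_EFinP; apply: continuous_measurable5; exact: continuous_smooth_normV.
under eq_integral => w _ do
  rewrite /= ger0_norm ?invr_ge0 ?exprn_ge0 ?(ltW (smooth_norm_gt0 w e0))//.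
case: k67 => ->; last by rewrite integral_smooth_norm7// ltry.
by have [C _ HC] := integral_smooth_norm6; rewrite HC// ltry.
Qed.

(** The kernel 15 e^2 s^-7 has total mass 8 pi^2. Since |f(x + w) - f(x)| <= L s, the error is 15
    e^2 L times the integral C / e of s^-6. *)
Lemma approximate_identity f x : test_function f -> exists2 M, 0 <= M & forall e, 0 < e ->
  `|15 * e ^+ 2 * \int[leb5]_w (f (x + w) * (smooth_norm e w ^+ 7)^-1) - 8 * pi ^+ 2 * f x|
  <= e * M.
Proof.
move=> tf; have [L L0 HL] := test_lipschitz tf; have [C C0 HC] := integral_smooth_norm6.
exists (15 * L * C); first by rewrite !mulr_ge0.
move=> e e0; have e2 : 0 < e ^+ 2 by rewrite exprn_gt0.
have I7 := summable_smooth_norm (or_intror erefl) e0.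
have I6 := summable_smooth_norm (or_introl erefl) e0.
have If := admissible_summable (admissible_smooth_norm 7 x tf e0).
have -> : 8 * pi ^+ 2 * f x = 15 * e ^+ 2 * (f x * \int[leb5]_w (smooth_norm e w ^+ 7)^-1).
  by rewrite /Rintegral integral_smooth_norm7//=; field; rewrite gt_eqF.
rewrite -mulrBr -[f x * _]RintegralZl// -RintegralB//; last first.
  by have := integrableZl measurableT (f x) I7; apply: eq_integrable.
have e15 : 0 < 15 * e ^+ 2 by exact: mulr_gt0.
rewrite normrM (ger0_norm (ltW e15)).
rewrite [leRHS](_ : _ = 15 * e ^+ 2 * (L * \int[leb5]_w (smooth_norm e w ^+ 6)^-1)); last first.
  by rewrite /Rintegral HC//=; field; rewrite gt_eqF.
rewrite (ler_pM2l e15) -[L * _]RintegralZl//.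
apply: norm_Rintegral_ae_le.
- have J := integrableB measurableT If (integrableZl measurableT (f x) I7).
  by move: J; apply: eq_integrable.
- by have := integrableZl measurableT L I6; apply: eq_integrable.
- by move=> w; rewrite mulr_ge0 ?invr_ge0 ?exprn_ge0 ?(ltW (smooth_norm_gt0 w e0)).
apply: aeW => w; have s0 := smooth_norm_gt0 w e0.
rewrite -mulrBl normrM [X in _ * X]ger0_norm ?invr_ge0 ?exprn_ge0 ?(ltW s0)//.
have -> : L * (smooth_norm e w ^+ 6)^-1 = L * smooth_norm e w * (smooth_norm e w ^+ 7)^-1.
  by field; rewrite gt_eqF.
rewrite ler_pM2r ?invr_gt0 ?exprn_gt0//; apply: (le_trans (HL x w)); rewrite ler_wpM2l//.
exact: (le_trans (norm_le_enorm5 w) (enorm5_le_smooth_norm w e0)).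
Qed.

Lemma laplacian5_axis f x :
  laplacian5 f x = \sum_(i < 5) 'D_(axis i) (fun w => 'D_(axis i) f w) x.
Proof. by rewrite /laplacian5 (big_nth 0) big_mkord. Qed.

Lemma sum_coord_sqr w : \sum_(i < 5) coord i w ^+ 2 = sqn w.
Proof.
rewrite !big_ord_recr big_ord0 /= add0r; case: w => [[[[a b] c] d] z].
by rewrite /coord /sqn.
Qed.

(** Summed over the five axes, the kernels give 15 |w|^2 s^-7 - 15 s^-5. With s^2 = e^2 + |w|^2 only
    -15 e^2 s^-7 survives: the cancellation is special to the exponent 3 in dimension 5. *)
Lemma integral_laplacian_smooth_norm f x e : test_function f -> 0 < e ->
  \sum_(i < 5) \int[leb5]_w ('D_(axis i) (fun y => 'D_(axis i) f y) (x + w)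
                             * (smooth_norm e w ^+ 3)^-1)
  = - (15 * e ^+ 2 * \int[leb5]_w (f (x + w) * (smooth_norm e w ^+ 7)^-1)).
Proof.
move=> tf e0.
have If := admissible_summable (admissible_smooth_norm 7 x tf e0).
transitivity (\sum_(i < 5) \int[leb5]_w (f (x + w) * (15 * coord i w ^+ 2
    * (smooth_norm e w ^+ 7)^-1 - 3 * (smooth_norm e w ^+ 5)^-1))).
  apply: eq_bigr => i _; rewrite ibp_smooth_norm//; last exact: test_derive.
  by rewrite ibp_smooth_norm2.
have IF i : leb5.-integrable setT (EFin \o (fun w : X => f (x + w) * (15 * coord i w ^+ 2
    * (smooth_norm e w ^+ 7)^-1 - 3 * (smooth_norm e w ^+ 5)^-1))).
  apply: admissible_summable; apply: admissible_test_mul => // w.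
  apply: cvgB.
    apply: cvgM; last exact: continuous_smooth_normV.
    apply: cvgM; first exact: cvg_cst.
    exact: (cvg_comp _ _ (@continuous_coord i w) (@exprn_continuous _ 2 (coord i w))).
  by apply: cvgM; [exact: cvg_cst|exact: continuous_smooth_normV].
have [_ <-] := Rintegral_sum_ord IF.
rewrite -mulNr -RintegralZl//; apply: eq_Rintegral => w _.
rewrite -mulr_sumr big_split/= -mulr_suml -mulr_sumr sum_coord_sqr sumr_const card_ord.
have s0 := smooth_norm_gt0 w e0.
have -> : sqn w = smooth_norm e w ^+ 2 - e ^+ 2 by rewrite smooth_norm_sqr addrAC subrr add0r.
by field; rewrite gt_eqF.
Qed.

Lemma potential_sum_ord n (F : 'I_n -> R5 R -> R) x : (forall i, admissible (F i)) ->
  potential 3 (fun y => \sum_(i < n) F i y) x = \sum_(i < n) potential 3 (F i) x.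
Proof.
move=> aF; have [_ <-] := @Rintegral_sum_ord R _ X leb5 n (fun i w => F i (x + w) / enorm5 w ^+ 3)
  (fun i => admissible_integrable x k3 (aF i)).
by apply: eq_Rintegral => w _; rewrite mulr_suml.
Qed.

Lemma potential_laplacian5 f x : test_function f ->
  potential 3 (laplacian5 f) x = - (8 * pi ^+ 2 * f x).
Proof.
move=> tf; pose g i := fun y => 'D_(axis i) (fun w => 'D_(axis i) f w) y.
have tg i : test_function (g i) by apply: test_derive; exact: test_derive.
rewrite (_ : laplacian5 f = fun y => \sum_(i < 5) g i y); last first.
  by apply/funext => y; rewrite laplacian5_axis.
rewrite potential_sum_ord; last by move=> i; exact: admissible_test.
have [M M0 HM] := approximate_identity x tf.
pose S := \sum_(i < 5) potential 4 (fun y => `|g i y|) x.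
have S0 : 0 <= S.
  apply: sumr_ge0 => i _.
  by apply: Rintegral_ge0 => w _; rewrite mulr_ge0 ?invr_ge0 ?exprn_ge0 ?enorm5_ge0.
have main e : 0 < e -> `|\sum_(i < 5) potential 3 (g i) x + 8 * pi ^+ 2 * f x| <= e * (3 * S + M).
  move=> e0; pose B := \sum_(i < 5) \int[leb5]_w (g i (x + w) * (smooth_norm e w ^+ 3)^-1).
  have EB : B = - (15 * e ^+ 2 * \int[leb5]_w (f (x + w) * (smooth_norm e w ^+ 7)^-1)).
    exact: integral_laplacian_smooth_norm.
  rewrite (_ : _ + _ = (\sum_(i < 5) potential 3 (g i) x - B) + (B + 8 * pi ^+ 2 * f x)); last by ring.
  apply: (le_trans (ler_normD _ _)); rewrite mulrDr; apply: lerD.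
    rewrite /B -sumrB /S mulrA mulr_sumr; apply: (le_trans (ler_norm_sum _ _ _)).
    apply: ler_sum => i _; apply: (le_trans (potential_approx x (tg i) e0)).
    by rewrite [e * 3]mulrC.
  by rewrite EB -normrN opprD opprK; exact: HM.
apply/eqP; rewrite -addr_eq0 -normr_le0; apply/ler_addgt0Pr => e e0.
have d0 : 0 < 3 * S + M + 1 by rewrite ltr_wpDl ?addr_ge0 ?mulr_ge0.
apply: (le_trans (main _ (divr_gt0 e0 d0))); rewrite add0r mulrAC ler_pdivrMr//.
by rewrite ler_pM2l// lerDl.
Qed.

Lemma newtonian5_poisson f x : test_function f -> - laplacian5 (newtonian5 f) x = f x.
Proof.
move=> tf.
have tl i : test_function (fun y => 'D_(axis i) (fun w => 'D_(axis i) f w) y).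
  by apply: test_derive; exact: test_derive.
have lE : laplacian5 f = fun y => \sum_(i < 5) 'D_(axis i) (fun w => 'D_(axis i) f w) y.
  by apply/funext => y; exact: laplacian5_axis.
have H : laplacian5 (newtonian5 f) x = (8 * pi ^+ 2)^-1 * potential 3 (laplacian5 f) x.
  rewrite laplacian5_axis lE potential_sum_ord; last by move=> i; exact: admissible_test.
  rewrite mulr_sumr; apply: eq_bigr => i _.
  rewrite -[RHS](congr1 (fun k => k x) (newtonian5_test (tl i))).
  rewrite -newtonian5_derive; last exact: test_derive.
  by congr ('D_(axis i) _ x); apply/funext => y; exact: newtonian5_derive.
rewrite H potential_laplacian5// mulrN opprK mulrA mulVf ?mul1r//.
by rewrite mulf_neq0// expf_neq0// gt_eqF// pi_gt0.
Qed.

End poisson_equation.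

(** * Radial functions *)

Section rotations.
Context {R : realType}.
Notation mR := (measurableTypeR R).
Notation X := (R5 mR).
Implicit Types (f F : R5 R -> R) (x v w : R5 R).

Definition isometry5 (s : R5 R -> R5 R) :=
  [/\ measure_preserving leb5 (s : X -> X), (forall x y, s (x + y) = s x + s y),
      (forall x, (s x).2 = x.2) & (forall x, enorm4 (s x).1 = enorm4 x.1)].

Lemma newtonian5_isometry s f x : isometry5 s -> measurable5 f -> radial f ->
  newtonian5 f (s x) = newtonian5 f x.
Proof.
move=> [ms sD s2 s4] mf rf; rewrite !newtonian5E//; congr (_ * _).
have mg : measurable5 (fun w => f (s x + w) / enorm5 w ^+ 3).
  apply: measurable5M; first exact: measurable5_translate.
  exact: measurable5_enormV.
rewrite -(Rintegral_measure_preserving ms mg); apply: eq_Rintegral => w _.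
congr (_ / _ ^+ 3); last by rewrite /enorm5 s2 s4.
rewrite -sD; have := s2 (x + w); have := s4 (x + w).
case: (s (x + w)) => [y z]; case: (x + w) => [y' z'] /= H ->; exact: rf.
Qed.

Lemma isometry5_swap12 : isometry5 swap12.
Proof.
split; first exact: measure_preserving_swap12.
- by move=> [[[[? ?] ?] ?] ?] [[[[? ?] ?] ?] ?].
- by move=> [[[[? ?] ?] ?] ?].
- by move=> [[[[a b] c] d] z]; congr Num.sqrt; ring.
Qed.

Lemma isometry5_swap23 : isometry5 swap23.
Proof.
split; first exact: measure_preserving_swap23.
- by move=> [[[[? ?] ?] ?] ?] [[[[? ?] ?] ?] ?].
- by move=> [[[[? ?] ?] ?] ?].
- by move=> [[[[a b] c] d] z]; congr Num.sqrt; ring.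
Qed.

Lemma isometry5_swap34 : isometry5 swap34.
Proof.
split; first exact: measure_preserving_swap34.
- by move=> [[[[? ?] ?] ?] ?] [[[[? ?] ?] ?] ?].
- by move=> [[[[? ?] ?] ?] ?].
- by move=> [[[[a b] c] d] z]; congr Num.sqrt; ring.
Qed.

Definition rotation34 (c s : R) (x : R5 R) : R5 R :=
  let: (a, b, p, q, z) := x in (a, b, c * p - s * q, s * p + c * q, z).

(* A rotation with nonzero sine is a product of three shears. *)
Lemma isometry5_rotation34 c s : c ^+ 2 + s ^+ 2 = 1 -> s != 0 -> isometry5 (rotation34 c s).
Proof.
move=> cs s0; split.
- pose up k := (swap34 \o shear34 k \o swap34 : X -> X).
  have mup k : measure_preserving leb5 (up k).
    apply: measure_preserving_comp; last exact: measure_preserving_swap34.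
    apply: measure_preserving_comp; first exact: measure_preserving_swap34.
    exact: measure_preserving_shear34.
  (* The coefficient (c - 1) / s is minus the tangent of half the angle of rotation. *)
  apply: (eq_measure_preserving _ (measure_preserving_comp (mup ((c - 1) / s))
    (measure_preserving_comp (measure_preserving_shear34 s) (mup ((c - 1) / s))))).
  move=> [[[[a b] p] q] z]; rewrite /up /=.
  have c2 : c ^+ 2 = 1 - s ^+ 2 by rewrite -cs addrK.
  congr (_, _, _, _, _); first last.
    by field.
  rewrite (_ : p + _ + _ = c * p + (c ^+ 2 - 1) / s * q); last by field.
  by rewrite c2; field.
- move=> [[[[? ?] ?] ?] ?] [[[[? ?] ?] ?] ?].
  by congr (_, _, _, _, _); rewrite /=; ring.
- by move=> [[[[? ?] ?] ?] ?].
- move=> [[[[a b] p] q] z]; congr Num.sqrt.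
  rewrite (_ : _ + _ = a ^+ 2 + b ^+ 2 + (c ^+ 2 + s ^+ 2) * (p ^+ 2 + q ^+ 2)); last by ring.
  by rewrite cs; ring.
Qed.

Lemma isometry_invariant_radial F :
  (forall s x, isometry5 s -> F (s x) = F x) -> radial F.
Proof.
move=> inv.
(* The rotation of cosine p / r and sine - q / r sends (p, q) to (r, 0); its factorization into
   shears requires a nonzero sine, hence q != 0. *)
have rot0 a b p q z : q != 0 -> F (a, b, p, q, z) = F (a, b, Num.sqrt (p ^+ 2 + q ^+ 2), 0, z).
  move=> q0; set r := Num.sqrt _.
  have h : 0 < p ^+ 2 + q ^+ 2 by rewrite ltr_wpDl ?sqr_ge0// lt_neqAle sqr_ge0 eq_sym sqrf_eq0 q0.
  have r0 : r != 0 by rewrite sqrtr_eq0 -ltNge.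
  have r2 : r ^+ 2 = p ^+ 2 + q ^+ 2 by rewrite sqr_sqrtr// ltW.
  have cs : (p / r) ^+ 2 + (- q / r) ^+ 2 = 1.
    by rewrite !exprMn sqrrN -mulrDl -r2 exprVn mulfV// expf_neq0.
  have s0 : - q / r != 0 by rewrite mulf_neq0// ?oppr_eq0// invr_eq0.
  rewrite -(inv _ _ (isometry5_rotation34 cs s0)); congr (F (_, _, _, _, _)).
    rewrite (_ : _ - _ = (p ^+ 2 + q ^+ 2) / r); last by field.
    by rewrite -r2; field.
  by field.
have s34 a b p q z : F (a, b, p, q, z) = F (a, b, q, p, z).
  by rewrite -(inv _ _ isometry5_swap34).
have s23 a b p q z : F (a, b, p, q, z) = F (a, p, b, q, z).
  by rewrite -(inv _ _ isometry5_swap23).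
have s12 a b p q z : F (a, b, p, q, z) = F (b, a, p, q, z).
  by rewrite -(inv _ _ isometry5_swap12).
have rot a b p q z : F (a, b, p, q, z) = F (a, b, Num.sqrt (p ^+ 2 + q ^+ 2), 0, z).
  (* For q = 0 the sign of p must still be removed: swapping p into the fourth slot makes a rotation
     with nonzero sine available. *)
  have [->|q0] := eqVneq q 0; last exact: rot0.
  have [->|p0] := eqVneq p 0; first by rewrite expr0n/= addr0 sqrtr0.
  by rewrite s34 rot0// addrC.
have canon y z : F (y, z) = F (0, 0, enorm4 y, 0, z).
  case: y => [[[a b] p] q].
  (* Three planar rotations gather all four coordinates, the second absorbing b and the third a,
     into the third slot. *)
  rewrite rot s34 s23 rot s34 s12 s23 rot.
  have sq (u v : R) : Num.sqrt (u ^+ 2 + v ^+ 2) ^+ 2 = u ^+ 2 + v ^+ 2.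
    by rewrite sqr_sqrtr// addr_ge0 ?sqr_ge0.
  by rewrite !sq /enorm4 !addrA.
by move=> y y' z e; rewrite canon e -canon.
Qed.

Lemma newtonian5_radial f : measurable5 f -> radial f -> radial (newtonian5 f).
Proof.
by move=> mf rf; apply: isometry_invariant_radial => s x hs; exact: newtonian5_isometry.
Qed.

Lemma dz_radial f : radial f -> radial (dz f).
Proof.
move=> rf y y' z e; rewrite /dz /derive.
have line (u : R4 R) (h : R) : h *: ((0, 0, 0, 0, 1) : R5 R) + (u, z) = (u, h + z).
  case: u => [[[a b] c] d].
  rewrite [LHS](_ : _ = (h * 0 + a, h * 0 + b, h * 0 + c, h * 0 + d, h * 1 + z))//.
  by rewrite !mulr0 !add0r mulr1.
suff E : (fun h : R => h^-1 *: (f (h *: ((0, 0, 0, 0, 1) : R5 R) + (y, z)) - f (y, z))) =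
         (fun h : R => h^-1 *: (f (h *: ((0, 0, 0, 0, 1) : R5 R) + (y', z)) - f (y', z))).
  by rewrite E.
by apply/funext => h; rewrite !line (rf _ _ _ e) (rf _ _ (h + z) e).
Qed.

End rotations.

Section scaling.
Local Open Scope ereal_scope.
Context {R : realType}.
Notation mR := (measurableTypeR R).
Notation leb := (@lebesgue_measure R).

Definition measure_scaling d (T : measurableType d) (mu : {measure set T -> \bar R})
    (phi : T -> T) (c : R) :=
  measurable_fun setT phi /\
  forall f : T -> \bar R, measurable_fun setT f -> (forall x, 0 <= f x) ->
    \int[mu]_x f (phi x) = c%:E * \int[mu]_x f x.

Lemma measure_scaling_leb (a : R) : (0 < a)%R ->
  measure_scaling leb (fun t : mR => (a * t)%R : mR) a^-1.
Proof.
move=> a0; split; last by move=> f mf f0; exact: lebesgue_integral_scale.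
by apply: measurable_funM => //; exact: measurable_cst.
Qed.

Lemma measure_scaling_prod d1 (T1 : measurableType d1) d2 (T2 : measurableType d2)
    (m1 : {sigma_finite_measure set T1 -> \bar R})
    (m2 : {sigma_finite_measure set T2 -> \bar R}) phi psi (c1 c2 : R) : (0 <= c1)%R ->
  measure_scaling m1 phi c1 -> measure_scaling m2 psi c2 ->
  measure_scaling (sigma_product m1 m2) (fun p => (phi p.1, psi p.2)) (c1 * c2)%R.
Proof.
move=> c10 [mphi h1] [mpsi h2].
have m12 : measurable_fun [set: T1 * T2] (fun p : T1 * T2 => (phi p.1, psi p.2)).
  apply: measurable_fun_pair.
    exact: (measurableT_comp mphi measurable_fst).
  exact: (measurableT_comp mpsi measurable_snd).
split=> // f mf f0.
apply: (etrans (tonelli_snd (measurableT_comp mf m12) (fun x => f0 _))).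
pose F := fubini_G m1 f.
have mF : measurable_fun setT F.
  exact: (@measurable_fun_fubini_tonelli_G _ _ _ _ R m1 f mf f0).
have F0 y : 0 <= F y by exact: integral_ge0.
transitivity (\int[m2]_y (c1%:E * F (psi y))).
  apply: eq_integral => y _.
  by apply: (h1 (fun x => f (x, psi y))) => //; exact: measurableT_comp.
rewrite ge0_integralZl ?lee_fin//; last exact: measurableT_comp.
by rewrite h2// EFinM -muleA; congr (_ * (_ * _)); exact: (esym (tonelli_snd mf f0)).
Qed.

End scaling.

(** * Polar coordinates in y: Lebesgue measure and [mu5] *)

Section polar.
Context {R : realType}.
Notation mR := (measurableTypeR R).
Notation leb := (@lebesgue_measure R).
Notation X := (R5 mR).
Notation Y := (R4 mR).
Implicit Types (y : R4 R) (r a : R).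

Lemma enorm5_slice y : enorm5 (y, 0) = enorm4 y :> R.
Proof. by rewrite /enorm5 /= expr0n/= addr0 sqrtr_sqr ger0_norm// enorm4_ge0. Qed.

Lemma measurable_slice : measurable_fun [set: Y] (fun y : Y => (y, 0) : X).
Proof. by apply: measurable_fun_pair => //; exact: measurable_cst. Qed.

Lemma measurable_enorm4 : measurable_fun [set: Y] (@enorm4 R : Y -> mR).
Proof.
have := measurableT_comp (continuous_measurable5 (@cont_enorm5 R)) measurable_slice.
by rewrite (_ : _ \o _ = (@enorm4 R : Y -> mR))//; apply/funext => y; exact: enorm5_slice.
Qed.

Lemma measurable_enorm4_lt r : measurable [set y : Y | enorm4 (y : R4 R) < r].
Proof.
rewrite (_ : [set y : Y | _] = (@enorm4 R : Y -> mR) @^-1` [set t : R | t < r])//.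
rewrite -[_ @^-1` _]setTI; apply: measurable_enorm4 => //.
by rewrite -set_itvNyo; exact: measurable_itv.
Qed.

Lemma measurable_norm4_lt r : measurable [set y : Y | `|y : R4 R| < r].
Proof.
have m5 : measurable_fun [set: X] (fun w : X => `|w : R5 R| : mR).
  by apply: continuous_measurable5 => w; exact: norm_continuous.
rewrite (_ : [set y : Y | _] = (fun y : Y => `|(y, 0) : R5 R| : mR) @^-1` [set t : R | t < r]).
  rewrite -[_ @^-1` _]setTI; apply: (measurableT_comp m5 measurable_slice) => //.
  by rewrite -set_itvNyo; exact: measurable_itv.
have E (y : R4 R) : `|(y, 0) : R5 R| = `|y| by rewrite prod_normE/= normr0 max_l.
by apply/seteqP; split => y /=; rewrite E.
Qed.

Lemma norm_pair_lt y (z : R) r : (`|(y, z) : R5 R| < r) = (`|y| < r) && (`|z| < r).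
Proof. by rewrite prod_normE; exact: gt_max. Qed.

Lemma leb5_rectangle (A : set Y) (B : set mR) : measurable A -> measurable B ->
  leb5 (A `*` B : set X) = (leb4 A * leb B)%E.
Proof. by move=> mA mB; exact: product_measure1E. Qed.

Lemma leb4_ball r : 0 < r -> (leb4 [set y : Y | (`|y : R4 R| < r)%R] = ((2 * r) ^+ 4)%:E)%E.
Proof.
move=> r0; have mA := measurable_norm4_lt r.
have mB : measurable (ball (0 : R) r : set mR) by exact: measurable_ball.
have := leb5_ball (ltW r0).
rewrite (_ : [set w : X | _] = [set y : Y | `|y : R4 R| < r] `*` (ball (0 : R) r : set mR)); last first.
  apply/seteqP; split => -[y z]; rewrite /= /ball/= sub0r normrN norm_pair_lt.
    by move=> /andP.
  by move=> h; apply/andP.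
rewrite (leb5_rectangle mA mB).
have -> : leb (ball (0 : R) r) = (2 * r)%:E by rewrite lebesgue_measure_ball ?ltW// mulrC mulr_natr.
have r2 : 0 < 2 * r by rewrite mulr_gt0.
case: (leb4 _) => [a| |].
- by rewrite -EFinM => -[]; rewrite exprSr => /(mulIf (lt0r_neq0 r2)) ->.
- by rewrite gt0_mulye ?lte_fin.
- by rewrite gt0_mulNye ?lte_fin.
Qed.

Lemma enorm4_le y : enorm4 y <= 2 * `|y|.
Proof.
case: y => [[[a b] c] d]; set m := `|_|.
have m0 : 0 <= m by exact: normr_ge0.
have [ha hb hc hd] : [/\ `|a| <= m, `|b| <= m, `|c| <= m & `|d| <= m].
  by rewrite /m !prod_normE/= !le_max !lexx !orbT.
rewrite -(ler_pXn2r (_ : (0 < 2)%N))// ?nnegrE ?enorm4_ge0 ?mulr_ge0//.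
have sq (t : R) : `|t| <= m -> t ^+ 2 <= m ^+ 2.
  by move=> tm; rewrite -real_normK ?num_real// ler_pXn2r// nnegrE.
by rewrite enorm4_sqr; move: (sq _ ha) (sq _ hb) (sq _ hc) (sq _ hd); lra.
Qed.

(** Left unevaluated: positivity and finiteness, obtained by comparison with cubes, are enough for a
    constant independent of the source. *)
Definition unit_ball4 : \bar R := leb4 [set y : Y | (enorm4 (y : R4 R) < 1)%R].

Lemma unit_ball4_bounds : (0 < unit_ball4 < +oo)%E.
Proof.
apply/andP; split.
  apply: (@lt_le_trans _ _ (leb4 [set y : Y | (`|y : R4 R| < 2^-1)%R])).
    by rewrite leb4_ball ?invr_gt0// divff// lte_fin exprn_gt0.
  apply: le_measure; rewrite ?inE; [exact: measurable_norm4_lt|exact: measurable_enorm4_lt|].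
  move=> y /= h; apply: (le_lt_trans (enorm4_le y)).
  by rewrite mulrC -ltr_pdivlMr// mul1r.
apply: (@le_lt_trans _ _ (leb4 [set y : Y | (`|y : R4 R| < 1)%R])); last by rewrite leb4_ball// ltry.
apply: le_measure; rewrite ?inE; [exact: measurable_enorm4_lt|exact: measurable_norm4_lt|].
move=> y /=; rewrite -enorm5_slice => /(le_lt_trans (norm_le_enorm5 _)).
by rewrite norm_pair_lt => /andP[].
Qed.

Definition dilation4 a y : R4 R := (a * y.1.1.1, a * y.1.1.2, a * y.1.2, a * y.2).

Lemma enorm4_dilation a y : 0 <= a -> enorm4 (dilation4 a y) = a * enorm4 y.
Proof.
case: y => [[[p q] s] t] a0; rewrite /enorm4 /dilation4 /= !exprMn -!mulrDr.
by rewrite sqrtrM ?sqr_ge0// sqrtr_sqr ger0_norm.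
Qed.

Lemma measure_scaling_leb4 a : 0 < a -> measure_scaling leb4 (dilation4 a : Y -> Y) (a^-1 ^+ 4).
Proof.
move=> a0; have h := measure_scaling_leb a0.
have ai : 0 <= a^-1 by rewrite invr_ge0 ltW.
have h2 := measure_scaling_prod ai h h.
have h3 := measure_scaling_prod (mulr_ge0 ai ai) h2 h.
have := measure_scaling_prod (mulr_ge0 (mulr_ge0 ai ai) ai) h3 h.
by rewrite -expr2 -!exprSr.
Qed.

Lemma leb4_enorm4_ball r : 0 < r ->
  (leb4 [set y : Y | (enorm4 (y : R4 R) < r)%R] = (r ^+ 4)%:E * unit_ball4)%E.
Proof.
move=> r0; have ri : 0 < r^-1 by rewrite invr_gt0.
have mI : measurable_fun [set: Y] (fun y => (\1_[set y : Y | enorm4 (y : R4 R) < 1] y)%:E : \bar R).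
  by apply/measurable_EFinP; apply: measurable_indic; exact: measurable_enorm4_lt.
have [_ h] := measure_scaling_leb4 ri.
have := h _ mI (fun y => _); rewrite invrK => H.
have I (A : set Y) : measurable A -> leb4 A = (\int[leb4]_y (\1_A y)%:E)%E.
  by move=> mA; rewrite (integral_indic leb4 measurableT mA) setIT.
rewrite /unit_ball4 (I _ (measurable_enorm4_lt 1)) (I _ (measurable_enorm4_lt r)).
rewrite -H; last by move=> y; rewrite lee_fin.
apply: eq_integral => y _; congr EFin; rewrite !indicE; congr (nat_of_bool _)%:R.
have e : (enorm4 (dilation4 r^-1 y) < 1) = (enorm4 y < r).
  by rewrite enorm4_dilation ?(ltW ri)// mulrC ltr_pdivrMr// mul1r.
by apply/idP/idP => /set_mem H1; apply/mem_set; move: H1; rewrite /mkset e.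
Qed.

Definition radial4 : set mR -> \bar R := push_measure measurable_enorm4 leb4.

HB.instance Definition _ := Measure.on radial4.

Lemma radial4_ray r : radial4 `]-oo, r[%classic =
  (if (0 < r)%R then (r ^+ 4)%:E * unit_ball4 else 0)%E.
Proof.
have -> : radial4 `]-oo, r[%classic = leb4 [set y : Y | (enorm4 (y : R4 R) < r)%R].
  rewrite /radial4 push_measureE; apply: (congr1 (fun U : set Y => leb4 U)).
  by apply/seteqP; split => y /=; rewrite in_itv.
case: ifPn => [|r0]; first exact: leb4_enorm4_ball.
rewrite (_ : [set _ | _] = set0) ?measure0// -subset0 => y /=.
by apply/negP; rewrite -leNgt (le_trans _ (enorm4_ge0 y))// leNgt.
Qed.

Let radial4_ray_fin r : (radial4 `]-oo, r[%classic < +oo)%E.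
Proof.
rewrite radial4_ray; case: ifP => // _; have /andP[_ w] := unit_ball4_bounds.
by rewrite lte_mul_pinfty// lee_fin exprn_even_ge0.
Qed.

Let rays_cover : \bigcup_n `]-oo, (n%:R : R)[%classic = [set: R].
Proof.
rewrite -subTset => x _; exists (Num.bound `|x|) => //=.
by rewrite in_itv/=; apply: (le_lt_trans (ler_norm x)); exact: archi_boundP.
Qed.

Let radial4_sigma_finite : sigma_finite setT radial4.
Proof.
exists (fun n => `]-oo, (n%:R : R)[%classic); first by rewrite rays_cover.
by move=> n; split; [exact: measurable_itv|exact: radial4_ray_fin].
Qed.

HB.instance Definition _ := Measure_isSigmaFinite.Build _ _ _ radial4 radial4_sigma_finite.

Definition cubic (r : R) : R := Num.max 0 r ^+ 3.

Lemma cubic_ge0 r : 0 <= cubic r.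
Proof. by rewrite exprn_ge0// le_max lexx. Qed.

Lemma measurable_cubic : measurable_fun setT (cubic : mR -> mR).
Proof. by apply: measurable_funX; apply: measurable_maxr => //; exact: measurable_cst. Qed.

Lemma mu5_rectangle (A B : set mR) : measurable A -> measurable B ->
  mu5 (A `*` B) = (\int[leb]_(r in A) (cubic r)%:E * leb B)%E.
Proof.
move=> mA mB; rewrite /mu5 integral_mkcond.
have mAB : measurable (A `*` B) by exact: measurableX.
have md : measurable_fun setT (fun p : mR * mR => (cubic p.1)%:E).
  by apply/measurable_EFinP; exact: (measurableT_comp measurable_cubic measurable_fst).
rewrite fubini_tonelli1//; first last.
- move=> p; rewrite patchE; case: ifP => // _; rewrite lee_fin; exact: cubic_ge0.
- by apply/(measurable_restrictT _ mAB); exact: measurable_funTS.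
pose g : mR -> \bar R := (EFin \o cubic) \_ A.
have g0 r : (0 <= g r)%E by rewrite /g patchE; case: ifP => // _; rewrite lee_fin; exact: cubic_ge0.
have mg : measurable_fun setT g.
  apply/(measurable_restrictT _ mA); apply: measurable_funTS.
  by apply/measurable_EFinP; exact: measurable_cubic.
have mI : measurable_fun setT (fun z : mR => (\1_B z)%:E : \bar R).
  by apply/measurable_EFinP; exact: measurable_indic.
have I0 (z : mR) : setT z -> (0 <= (\1_B z)%:E :> \bar R)%E by rewrite lee_fin.
transitivity (\int[leb]_r (g r * leb B))%E.
  apply: eq_integral => r _; rewrite /fubini_F.
  transitivity (\int[leb]_z (g r * (\1_B z)%:E))%E.
    apply: eq_integral => z _; rewrite /g !patchE indicE in_setX.
    by case: (r \in A); case: (z \in B); rewrite /= ?mule1 ?mule0 ?mul0e.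
  rewrite (ge0_integralZl leb measurableT mI I0 (g0 r)).
  by congr (_ * _)%E; rewrite integral_indic// setIT.
rewrite (ge0_integralZr leb measurableT mg (fun r _ => g0 r) (measure_ge0 leb B)).
by rewrite [in RHS]integral_mkcond.
Qed.

Lemma integral_cubic_ray r : (\int[leb]_(t in `]-oo, r[) (cubic t)%:E =
  if (0 < r)%R then (r ^+ 4 / 4)%:E else 0)%E.
Proof.
have Z t : t <= 0 -> cubic t = 0 by move=> t0; rewrite /cubic max_l// expr0n.
case: ifPn => [r0|r0]; last first.
  apply: integral0_eq => t /=; rewrite in_itv/= => tr; rewrite Z//.
  by rewrite (le_trans (ltW tr))// leNgt.
have E : (fun t : R => (cubic t)%:E) \_ `]-oo, r[ = (fun t : R => (t ^+ 3)%:E) \_ `[0, r[.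
  apply/funext => t; rewrite !patchE !mem_setE !in_itv/=.
  have [t0|t0] := leP 0 t; last by rewrite Z ?(ltW t0)//; case: ifP.
  by rewrite /= /cubic max_r.
rewrite integral_mkcond E -integral_mkcond.
have cX (n : nat) : continuous (fun t : R => t ^+ n) by move=> t; exact: exprn_continuous.
rewrite (@integral_itv_bndo_bndc _ (BLeft 0) r); last first.
  apply/measurable_EFinP; apply: measurable_funTS; exact: continuous_measurable_fun.
have dX t : is_derive t (1 : R) (fun t : R => t ^+ 4 / 4) (t ^+ 3).
  by apply: is_derive_eq; rewrite /GRing.scale/=; field.
have cp : continuous (fun t : R => t ^+ 4 / 4).
  by move=> t; apply: differentiable_continuous; apply/derivable1_diffP; have [] := dX t.
apply: (etrans (@continuous_FTC2 R (fun t => t ^+ 3) (fun t => t ^+ 4 / 4) 0 r r0 _ _ _)).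
- by apply: continuous_subspaceT.
- split; first by move=> t _; have [] := dX t.
    by apply: cvg_at_right_filter; exact: cp.
  by apply: cvg_at_left_filter; exact: cp.
- by move=> t _; rewrite derive1E; have [] := dX t.
- by rewrite expr0n/= mul0r sube0.
Qed.

(** The rays ]-oo, r[ form a generating class stable under intersection. On them both sides equal
    r^4 times [unit_ball4] for r > 0, by dilation on one side and by the primitive t^4 / 4 on the
    other. *)
Lemma radial4E (A : set mR) : measurable A ->
  radial4 A = (4%:E * unit_ball4 * \int[leb]_(r in A) (cubic r)%:E)%E.
Proof.
have /andP[w0 w1] := unit_ball4_bounds.
have wE : unit_ball4 = (fine unit_ball4)%:E.
  by rewrite fineK// ge0_fin_numE// ltW.
have k0 : 0 <= 4 * fine unit_ball4 by rewrite mulr_ge0// fine_ge0// ltW.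
have mI : measurable (`[0, 1]%classic : set mR) by exact: measurable_itv.
have mTI : measurable ([set: mR] `*` (`[0, 1]%classic : set mR)) by exact: measurableX.
(* The measure with density [cubic] is obtained from [mu5]: restrict it to the strip 0 <= z <= 1, of
   width one, and project to the first coordinate. *)
pose m := mscale (NngNum k0) (push_measure measurable_fst (mrestr mu5 mTI)).
have mE (B : set mR) : measurable B -> m B = (4%:E * unit_ball4 * \int[leb]_(r in B) (cubic r)%:E)%E.
  move=> mB; rewrite /m /mscale/= wE -EFinM; congr (_ * _)%E.
  rewrite /pushforward /mrestr (_ : _ `&` _ = B `*` `[0, 1]%classic); last first.
    by apply/seteqP; split => -[r z] /=; [move=> [? []]|move=> [? ?]].
  rewrite mu5_rectangle// lebesgue_measure_itv/= lte_fin ltr01 oppr0 adde0 mule1//.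
move=> mA; rewrite -(mE _ mA).
have setI_rays : setI_closed (@RGenInftyO.G R).
  move=> _ _ [x ->] [y ->]; exists (Num.min x y).
  by apply/seteqP; split => t /=; rewrite !in_itv/= lt_min; [move=> [-> ->]|move=> /andP[]].
have on_rays B : RGenInftyO.G B -> radial4 B = m B.
  move=> [r ->]; apply: (etrans _ (esym (mE _ (measurable_itv _)))).
  apply: (etrans (radial4_ray r)); rewrite integral_cubic_ray.
  case: ifP => _; last by rewrite mule0.
  by rewrite wE -!EFinM; congr EFin; field.
have gen n : RGenInftyO.G `]-oo, (n%:R : R)[%classic by exists n%:R.
exact: (@measure_unique _ R mR (@RGenInftyO.G R) _ (RGenInftyO.measurableE R) setI_rays
  gen rays_cover (radial4 : {measure set mR -> \bar R}) m on_rays (fun n => radial4_ray_fin _) A mA).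
Qed.

Lemma measurable_polar : measurable_fun [set: X] (fun w : X => (enorm4 (w.1 : R4 R), w.2) : mR * mR).
Proof.
apply: measurable_fun_pair; last exact: measurable_snd.
exact: (measurableT_comp measurable_enorm4 measurable_fst).
Qed.

Definition polar_const : R := 4 * fine unit_ball4.

Lemma polar_const_gt0 : 0 < polar_const.
Proof.
by have /andP[w0 w1] := unit_ball4_bounds; rewrite mulr_gt0// fine_gt0// w0.
Qed.

(** Both the push-forward of [leb5] and the multiple of [mu5] agree with the product of [radial4]
    and Lebesgue measure on rectangles, hence everywhere by uniqueness of product measures. *)
Lemma integral_polar (f : mR * mR -> \bar R) : measurable_fun setT f -> (forall p, 0 <= f p)%E ->
  (\int[leb5]_w f (enorm4 (w.1 : R4 R), w.2) = polar_const%:E * \int[mu5]_p f p)%E.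
Proof.
move=> mf f0; have k0 := ltW polar_const_gt0.
have /andP[w0 w1] := unit_ball4_bounds.
have wE : unit_ball4 = (fine unit_ball4)%:E by rewrite fineK// ge0_fin_numE// ltW.
rewrite (ge0_integral_push measurable_polar leb5 mf f0).
rewrite -(ge0_integral_mscale mu5 measurableT (NngNum k0) mf)//.
apply: eq_measure_integral => A mA _.
have P (m' : {measure set (mR * mR) -> \bar R}) : (forall U V, measurable U -> measurable V ->
    m' (U `*` V) = (radial4 U * leb V)%E) -> m' A = (radial4 \x leb)%E A.
  by move=> h; apply/esym; exact: product_measure_unique.
rewrite (P (push_measure measurable_polar leb5)); last first.
  move=> U V mU mV; rewrite push_measureE.
  rewrite (_ : _ @^-1` _ = ((@enorm4 R : Y -> mR) @^-1` U) `*` V)//.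
  apply: leb5_rectangle => //; rewrite -[_ @^-1` _]setTI; exact: measurable_enorm4.
apply/esym; apply: (P (mscale (NngNum k0) mu5)) => U V mU mV.
change (polar_const%:E * mu5 (U `*` V) = radial4 U * leb V)%E.
rewrite (mu5_rectangle mU mV) (radial4E mU) muleA; congr (_ * _ * _)%E.
by rewrite /polar_const EFinM -wE.
Qed.

End polar.

(** * The estimates *)

Section lifted_norms.
Context {R : realType}.
Notation mR := (measurableTypeR R).
Notation X := (R5 mR).
Notation P := (mR * mR)%type.
Implicit Types (f g : R5 R -> R) (x w : R5 R) (V : set (R5 R)) (p : R).

Definition meridian (q : R * R) : R5 R := ((q.1, 0, 0, 0), q.2).

Lemma meridian_continuous : continuous meridian.
Proof.
move=> q; have f1 : {for q, continuous (fun q : R * R => q.1)} by exact: cvg_fst.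
have f2 : {for q, continuous (fun q : R * R => q.2)} by exact: cvg_snd.
have c0 : {for q, continuous (fun _ : R * R => 0 : R)} by exact: cvg_cst.
exact: (cvg_pair (cvg_pair (cvg_pair (cvg_pair f1 c0) c0) c0) f2).
Qed.

Lemma profile_on_measurable V f : open V -> (forall x, V x -> {for x, continuous f}) ->
  measurable_fun setT (profile (f \_ V) : P -> mR).
Proof.
move=> oV cf; pose W : set (R * R) := meridian @^-1` V.
have oW : open W by apply: open_comp => // q _; exact: meridian_continuous.
have mW : measurable (W : set P).
  exact: (open_preimage_measurable (separable_measurable_R2 (R := R)) oW).
rewrite (_ : profile (f \_ V) = (f \o meridian) \_ (W : set P))//.
apply/(measurable_restrictT _ mW).
apply: (@continuous_on_measurable R _ P _ id W (f \o meridian) separable_measurable_R2 oW) => q Wq.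
by apply: continuous_comp; [exact: meridian_continuous|exact: cf].
Qed.

Lemma profile_measurable f : continuous f -> measurable_fun setT (profile f : P -> mR).
Proof.
move=> cf; rewrite (_ : f = f \_ setT); last by apply/esym; exact: patch_setT.
by apply: profile_on_measurable => [|x _]; [exact: openT|exact: cf].
Qed.

Lemma Lp5E p f : Lp5 p f = ((\int[mu5]_q (`|profile f q| `^ p)%:E) `^ p^-1)%E.
Proof. by rewrite /Lp5 unlock. Qed.

Lemma Lp5_le p f g : 0 <= p ->
  measurable_fun setT (profile f : P -> mR) -> measurable_fun setT (profile g : P -> mR) ->
  (forall x, `|f x| <= `|g x|) -> (Lp5 p f <= Lp5 p g)%E.
Proof.
move=> p0 mf mg fg; rewrite !Lp5E.
have I0 (h : R5 R -> R) : (0 <= \int[mu5]_q (`|profile h q| `^ p)%:E)%E.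
  by apply: integral_ge0 => q _; rewrite lee_fin powR_ge0.
have mp (h : P -> mR) : measurable_fun setT h -> measurable_fun setT (fun q => (`|h q| `^ p)%:E).
  move=> mh; apply/measurable_EFinP; apply: (measurableT_comp (measurable_powR p)).
  exact: measurableT_comp.
apply: gt0_ler_poweR.
- by rewrite invr_ge0.
- by rewrite in_itv/= I0 leey.
- by rewrite in_itv/= I0 leey.
apply: ge0_le_integral => //; [exact: (mp _ mf)|exact: (mp _ mg)|].
by move=> q _; rewrite lee_fin ge0_ler_powR ?nnegrE//; exact: fg.
Qed.

Lemma radial_profile (T : Type) (f : R5 R -> T) x : radial f -> f x = profile f (enorm4 x.1, x.2).
Proof.
case: x => y z rf; apply: rf => /=.
by rewrite {2}/enorm4 expr0n/= !addr0 sqrtr_sqr ger0_norm// enorm4_ge0.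
Qed.

Lemma integral_radial f p : measurable_fun setT (profile f : P -> mR) -> radial f ->
  (\int[leb5]_w (`|f w| `^ p)%:E = (@polar_const R)%:E * \int[mu5]_q (`|profile f q| `^ p)%:E)%E.
Proof.
move=> mf rf; rewrite -integral_polar.
- by apply: eq_integral => w _; rewrite (radial_profile w rf).
- apply/measurable_EFinP; apply: (measurableT_comp (measurable_powR p)).
  exact: measurableT_comp.
- by move=> q; rewrite lee_fin powR_ge0.
Qed.

Lemma rieszE g x : admissible g -> (forall y, 0 <= g y) -> riesz g x = (potential 4 g x)%:E.
Proof.
move=> ag g0; have I := admissible_integrable x (or_intror erefl) ag.
rewrite /potential /Rintegral fineK; last exact: integrable_fin_num.
have [mg _] := ag.
have mk : measurable5 (fun y => g y / enorm5 (y - x) ^+ 4).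
  apply: measurable5M => //.
  rewrite (_ : (fun y => _) = (fun y => (enorm5 (- x + y) ^+ 4)^-1)).
    exact: (measurable5_translate _ (measurable5_enormV 4)).
  by apply/funext => y /=; rewrite addrC.
have [_ H] := measure_preserving_translate x.
rewrite /riesz -[LHS](H (fun y => (g y / enorm5 ((y : R5 R) - x) ^+ 4)%:E)).
- by apply: eq_integral => w _; rewrite addrAC subrr add0r.
- exact/measurable_EFinP.
- by move=> y; rewrite lee_fin mulr_ge0 ?invr_ge0 ?exprn_ge0 ?enorm5_ge0.
Qed.

Lemma test_pos_L2 f : test_function f -> pos_L2 leb5 (fun x : X => `|f x|).
Proof.
move=> tf; split => //; first exact: measurable5_norm (test_measurable5 tf).
have a2 : admissible (fun x => f x * f x).
  apply: admissible_compact; last first.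
    by have [_ [K cK sK]] := tf; exists K => // x nKx; rewrite sK// mul0r.
  by move=> x; apply: cvgM; exact: test_continuous.
have := admissible_summable a2 => /integrableP[_].
rewrite (_ : \int[leb5]_x _ = \int[leb5]_x (`|f x| ^+ 2)%:E)%E//.
by apply: eq_integral => x _; rewrite /= normrM -expr2.
Qed.

(** 3 comes from [potential_dz], 8 pi^2 from the normalisation of [newtonian5]. *)
Definition dz_const : R := 3 / (8 * pi ^+ 2).

Lemma dz_const_gt0 : 0 < dz_const.
Proof. by rewrite divr_gt0// mulr_gt0// exprn_gt0// pi_gt0. Qed.

Lemma dz_newtonian5_le f x : test_function f ->
  ((`|dz (newtonian5 f) x| / dz_const)%:E <= riesz (fun y => `|f y|%R) x)%E.
Proof.
move=> tf; rewrite rieszE//; last exact: admissible_norm (admissible_test tf).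
rewrite lee_fin ler_pdivrMr ?dz_const_gt0// /dz newtonian5_derive//.
rewrite (newtonian5_test (test_derive _ tf)).
have c0 : 0 <= (8 * pi ^+ 2)^-1 :> R by rewrite invr_ge0 mulr_ge0// exprn_ge0// pi_ge0.
rewrite normrM ger0_norm// [leRHS]mulrC /dz_const mulrAC [leRHS]mulrC.
by apply: ler_wpM2l => //; exact: potential_dz.
Qed.

(** Passing to [mu5] divides the left integral by [polar_const] and multiplies the squared L^2 norm,
    which enters with power 5/3, by it; the outer power 3/10 takes the root. *)
Definition lifted_const : R := (dz_const `^ (10 / 3) * (@hls_const R / @polar_const R
  * @polar_const R `^ (5 / 3))) `^ (3 / 10).

Lemma lifted_const_gt0 : 0 < lifted_const.
Proof.
have k0 := @polar_const_gt0 R; have h0 := @hls_const_gt0 R; have d0 := dz_const_gt0.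
by apply: powR_gt0; apply: mulr_gt0; [|apply: mulr_gt0; first apply: divr_gt0]; rewrite ?powR_gt0.
Qed.

(** The inequality [hls] on R^5 for |U| / [dz_const], read through [integral_radial] on both sides.
    The exponents close since (5/3) (3/10) = 1/2, the root defining the L^2 norm. *)
Lemma Lp5_dz_newtonian5 f : test_function f -> radial f ->
  (Lp5 (10 / 3) (fun x => - dz (newtonian5 f) x)%R <= lifted_const%:E * Lp5 2 f)%E.
Proof.
move=> tf rf; set U := fun x => _.
have k0 := @polar_const_gt0 R; have h0 := @hls_const_gt0 R; have d0 := dz_const_gt0.
have cU : continuous U.
  move=> x; apply: cvgN; apply: differentiable_continuous.
  exact: (smooth_on_differentiable (smooth_on_derive _ (newtonian5_smooth tf)) I).
have rU : radial U.
  have rN : radial (newtonian5 f) by exact: newtonian5_radial (test_measurable5 tf) rf.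
  by move=> y y' z e; rewrite /U (dz_radial rN z e).
have mU := profile_measurable cU; have mf := profile_measurable (test_continuous tf).
have Lg := test_pos_L2 tf.
pose u x := `|U x| / dz_const.
have mu : measurable5 u.
  apply: measurable5M; last exact: measurable5_cst.
  by apply: measurable5_norm; exact: continuous_measurable5.
have := hls Lg mu _ _ => /(_ (fun x => divr_ge0 (normr_ge0 _) (ltW d0))).
have u0 x : 0 <= u x by exact: divr_ge0 (normr_ge0 _) (ltW d0).
have ule x : ((u x)%:E <= riesz (fun y => `|f y|%R) x)%E.
  by rewrite /u normrN; exact: dz_newtonian5_le.
move=> /(_ ule) H.
pose A := (\int[mu5]_q (`|profile f q| `^ 2)%:E)%E.
have A0 : (0 <= A)%E by apply: integral_ge0 => q _; rewrite lee_fin powR_ge0.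
have EA : (inner leb5 (fun x : X => `|f x|) (fun x : X => `|f x|))%:E = ((@polar_const R)%:E * A)%E.
  rewrite innerE// -integral_radial//; apply: eq_integral => w _.
  by rewrite powR_mulrn// expr2.
(* A is finite because its multiple by the positive [polar_const] is a real number. *)
have [a a0 Ea] : exists2 a, 0 <= a & A = a%:E.
  move: EA A0; case: A => [a| |]//.
    by move=> _ a0; exists a.
  by rewrite gt0_muley ?lte_fin.
have {EA} EA : inner leb5 (fun x : X => `|f x|) (fun x : X => `|f x|) = @polar_const R * a.
  by move: EA; rewrite Ea -EFinM => -[].
pose B := (\int[mu5]_q (`|profile U q| `^ (10 / 3))%:E)%E.
have B0 : (0 <= B)%E by apply: integral_ge0 => q _; rewrite lee_fin powR_ge0.
have EB : ((@polar_const R)%:E * B = (dz_const `^ (10 / 3))%:E * \int[leb5]_x (u x `^ (10 / 3))%:E)%E.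
  have mup : measurable_fun [set: X] (fun x : X => (u x `^ (10 / 3))%:E).
    by apply/measurable_EFinP; exact: (measurableT_comp (measurable_powR _) mu).
  have up (x : X) : setT x -> (0 <= (u x `^ (10 / 3))%:E)%E by rewrite lee_fin powR_ge0.
  have dp : (0 <= (dz_const `^ (10 / 3))%:E)%E by rewrite lee_fin powR_ge0.
  rewrite -(integral_radial _ mU rU) -(ge0_integralZl leb5 measurableT mup up dp).
  apply: eq_integral => w _; rewrite -EFinM -powRM ?u0 ?(ltW d0)//.
  by rewrite /u mulrCA divff ?mulr1// gt_eqF.
have HB : (B <= (dz_const `^ (10 / 3) * (@hls_const R / @polar_const R
    * @polar_const R `^ (5 / 3)) * a `^ (5 / 3))%:E)%E.
  rewrite -(@lee_pmul2l _ (@polar_const R)%:E)// ?lte_fin// EB.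
  apply: (le_trans (lee_wpmul2l _ H)); first by rewrite lee_fin powR_ge0.
  rewrite -!EFinM lee_fin EA powRM// ?(ltW k0)//.
  rewrite le_eqVlt; apply/orP; left; apply/eqP; field; rewrite gt_eqF//.
rewrite !Lp5E -/B -/A Ea poweR_EFin -EFinM.
set K := _ `^ (10 / 3) * _ in HB.
have K0 : 0 <= K.
  apply: mulr_ge0; first exact: powR_ge0.
  by apply: mulr_ge0; [apply: divr_ge0; exact: ltW|exact: powR_ge0].
apply: (@le_trans _ _ ((K * a `^ (5 / 3))%:E `^ (10 / 3)^-1)%E).
  apply: gt0_ler_poweR => //.
  - by rewrite in_itv/= B0 leey.
  - by rewrite in_itv/= leey lee_fin mulr_ge0// powR_ge0.
rewrite poweR_EFin lee_fin powRM ?powR_ge0// -powRrM /lifted_const -/K.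
rewrite (_ : (10 / 3)^-1 = 3 / 10); last by field.
by rewrite (_ : 5 / 3 * (3 / 10) = 2^-1)//; field.
Qed.

End lifted_norms.

(** * Localization by a cut-off *)

Section localization.
Context {R : realType}.
Notation mR := (measurableTypeR R).
Notation P := (mR * mR)%type.
Implicit Types (f g Phi G chi : R5 R -> R) (x w : R5 R) (V Omega : set (R5 R)).

Lemma cutoff_test Omega G chi : open Omega -> smooth_on Omega G -> smooth_on setT chi ->
  (exists K : set (R5 R), [/\ compact K, K `<=` Omega & supported_in K chi]) ->
  test_function (fun x => chi x * G x).
Proof.
move=> oO sG sc [K [cK KO sK]]; split; last first.
  by exists K => // x nKx; rewrite sK// mul0r.
have oK : open (~` K).
  by apply: closed_openC; apply: compact_closed => //; exact: norm_hausdorff.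
move=> vs x _; have [Kx|nKx] := pselect (K x).
  have s1 : smooth_on Omega chi by exact: smooth_on_subset sc.
  exact: (smooth_onM oO s1 sG vs (KO _ Kx)).
(* [Omega] and the complement of K are open and cover the space. On the second set the product is
   zero, written chi - chi so that its smoothness follows from [smooth_onB]. *)
have s0 : smooth_on (~` K) (fun x => chi x - chi x).
  by apply: smooth_onB => //; exact: smooth_on_subset sc.
apply: (eq_smooth_on oK _ s0) nKx => y nKy.
by rewrite subrr sK// mul0r.
Qed.

Lemma dzB V f g x : smooth_on V f -> smooth_on V g -> V x ->
  dz (fun w => f w - g w) x = dz f x - dz g x.
Proof.
move=> sf sg Vx; apply: deriveB; apply: diff_derivable.
  exact: smooth_on_differentiable sf Vx.
exact: smooth_on_differentiable sg Vx.
Qed.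

Lemma laplacian5B V f g x : open V -> smooth_on V f -> smooth_on V g -> V x ->
  laplacian5 (fun w => f w - g w) x = laplacian5 f x - laplacian5 g x.
Proof.
move=> oV sf sg Vx; rewrite !laplacian5_axis -sumrB; apply: eq_bigr => i _.
have D y h : smooth_on V h -> V y -> derivable h y (axis i).
  by move=> sh Vy; apply: diff_derivable; exact: smooth_on_differentiable sh Vy.
have e1 : 'D_(axis i) (fun w => 'D_(axis i) (fun w => f w - g w) w) x =
    'D_(axis i) (fun w => 'D_(axis i) f w - 'D_(axis i) g w) x.
  apply: (eq_on_derive (axis i) oV Vx) => y Vy.
  exact: (deriveB (D _ _ sf Vy) (D _ _ sg Vy)).
rewrite e1.
exact: (deriveB (D _ _ (smooth_on_derive (axis i) sf) Vx) (D _ _ (smooth_on_derive (axis i) sg) Vx)).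
Qed.

Lemma Lp5_restrictD_le V (p : R) f g h : 1 <= p -> open V ->
  (forall x, V x -> {for x, continuous g}) -> (forall x, V x -> {for x, continuous h}) ->
  (forall x, V x -> f x = g x - h x) ->
  (Lp5 p (f \_ V) <= Lp5 p (g \_ V) + Lp5 p (h \_ V))%E.
Proof.
move=> p1 oV cg ch fgh.
have mg := profile_on_measurable oV cg; have mh := profile_on_measurable oV ch.
have mNh : measurable_fun setT (fun q : P => - profile (h \_ V) q : mR).
  exact: measurable_funN.
have N : (Lp5 p (h \_ V) = 'N[mu5]_(p%:E)[EFin \o (fun q : P => - profile (h \_ V) q)%R])%E.
  rewrite /Lp5 -oppe_Lnorm; congr (Lnorm _ _ _).
rewrite N; apply: le_trans (minkowski_EFin mu5 mg mNh p1).
rewrite /Lp5 le_eqVlt; apply/orP; left; apply/eqP; congr (Lnorm _ _ _).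
apply/funext => q; rewrite /= /profile !patchE; congr EFin.
by case: ifPn => [/set_mem Vq|_]; [exact: fgh|rewrite subr0].
Qed.

End localization.

Theorem proposition6p1 (R : realType) :
  exists C : R, 0 < C /\
  (* global estimate *)
  (forall G : R5 R -> R,
     radial G -> smooth_on setT G ->
     (exists2 K : set (R5 R), compact K & supported_in K G) ->
     let U := fun x => - dz (newtonian5 G) x in
     radial U /\ (Lp5 (10 / 3) U <= C%:E * Lp5 2 G)%E) /\
  (* local estimate: on a region Omega where - laplacian Phi = G, and a cutoff
     chi equal to 1 on V, G = chi G + (1 - chi) G and Phi is the potential of
     the localized source chi G plus a remainder h *)
  (forall (Omega V : set (R5 R)) (Phi G chi : R5 R -> R),
     open Omega -> radial Omega -> open V -> radial V -> V `<=` Omega ->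
     radial Phi -> smooth_on Omega Phi ->
     radial G -> smooth_on Omega G ->
     (forall x, Omega x -> - laplacian5 Phi x = G x) ->
     radial chi -> smooth_on setT chi -> (forall x, 0 <= chi x <= 1) ->
     (exists K : set (R5 R),
        [/\ compact K, K `<=` Omega & supported_in K chi]) ->
     (forall x, V x -> chi x = 1) ->
     let U := fun x => - dz Phi x in
     let Gloc := fun x => chi x * G x in
     let Uloc := fun x => - dz (newtonian5 Gloc) x in
     let h := fun x => Phi x - newtonian5 Gloc x in
     [/\ smooth_on V h,
         forall x, V x -> laplacian5 h x = 0,
         forall x, V x -> U x = Uloc x - dz h x,
         (Lp5 (10 / 3) Uloc <= C%:E * Lp5 2 Gloc)%E
       & (Lp5 (10 / 3) (U \_ V) <=
            C%:E * Lp5 2 (G \_ Omega) + Lp5 (10 / 3) (dz h \_ V))%E]).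
Proof.
exists (@lifted_const R); split; first exact: lifted_const_gt0.
split=> [G rG sG cG U|].
  have tG : test_function G by [].
  have rN : radial (newtonian5 G) by exact: newtonian5_radial (test_measurable5 tG) rG.
  split; last exact: Lp5_dz_newtonian5.
  by move=> y y' z e; rewrite /U (dz_radial rN z e).
move=> Omega V Phi G chi oO rO oV rV VO rP sP rG sG hP rc sc c01 cK c1 U Gloc Uloc h.
have tG : test_function Gloc by exact: cutoff_test cK.
have rGl : radial Gloc.
  by move=> y y' z e; rewrite /Gloc (rc _ _ _ e) (rG _ _ _ e).
have sN : smooth_on V (newtonian5 Gloc).
  by apply: smooth_on_subset (newtonian5_smooth tG).
have sPV : smooth_on V Phi by exact: smooth_on_subset sP.
have sh : smooth_on V h by exact: smooth_onB.
have Uh x : V x -> U x = Uloc x - dz h x.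
  by move=> Vx; rewrite /U /Uloc /h (dzB sPV sN Vx); ring.
have est : (Lp5 (10 / 3) Uloc <= (@lifted_const R)%:E * Lp5 2 Gloc)%E.
  exact: Lp5_dz_newtonian5.
have cU : continuous Uloc.
  move=> x; apply: cvgN; apply: differentiable_continuous.
  exact: (smooth_on_differentiable (smooth_on_derive _ (newtonian5_smooth tG)) I).
have cdh x : V x -> {for x, continuous (dz h)}.
  move=> Vx; apply: differentiable_continuous.
  exact: (smooth_on_differentiable (smooth_on_derive _ sh) Vx).
have cG x : Omega x -> {for x, continuous G}.
  move=> Ox; apply: differentiable_continuous; exact: (smooth_on_differentiable sG Ox).
split => //.
(* On [V] the cut-off is 1, so [Phi] and the Newtonian potential of [Gloc] solve the same Poisson
   equation there. *)
- move=> x Vx; rewrite /h (laplacian5B oV sPV sN Vx).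
  have e1 := hP _ (VO _ Vx); have e2 := newtonian5_poisson x tG.
  have e3 : Gloc x = G x by rewrite /Gloc (c1 _ Vx) mul1r.
  apply/eqP; rewrite subr_eq0; apply/eqP.
  exact: oppr_inj (etrans e1 (etrans (esym e3) (esym e2))).
apply: (le_trans (Lp5_restrictD_le _ oV (fun x _ => cU x) cdh Uh)).
  by rewrite ler_pdivlMr// mul1r ler_nat.
have mUV := profile_on_measurable oV (fun x _ => cU x).
have mG := profile_measurable (test_continuous tG).
have mGO := profile_on_measurable oO cG.
apply: leeD => //; apply: (@le_trans _ _ (Lp5 (10 / 3) Uloc)).
  apply: (Lp5_le _ mUV (profile_measurable cU)); first by rewrite divr_ge0.
  by move=> x; rewrite patchE; case: ifP => // _; rewrite normr0.
apply: (le_trans est); apply: lee_wpmul2l; first by rewrite lee_fin ltW// lifted_const_gt0.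
(* Inside [Omega], 0 <= chi <= 1 gives |chi G| <= |G|; outside, chi vanishes because its support
   lies in [Omega]. *)
apply: (Lp5_le _ mG mGO) => // x.
rewrite patchE /Gloc normrM; have /andP[c0 cl] := c01 x.
case: ifPn => [_|/negP nO]; first by rewrite ger0_norm// ler_piMl.
have [K [_ KO sK]] := cK.
rewrite sK ?normr0 ?mul0r// => Kx; apply: nO; exact/mem_set/KO.
Qed.
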